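(* Let $\mathcal{F}$ be a codimension one distribution of degree $d$ on $\mathbb{P}^3$ such that $t_{\mathcal{F}}=0$. Then $$T_{\mathcal{F}}\cong\mathcal{O}_{\mathbb{P}^3}(1)\oplus\mathcal{O}_{\mathbb{P}^3}(1-d)\quad\text{and}\quad d\geq 0.$$
   Context: Work over $\mathbb{C}$. A codimension one distribution $\mathcal{F}$ of degree $d$ on $\mathbb{P}^3$ is an exact sequence $0\to T_{\mathcal{F}}\to T\mathbb{P}^3\to \mathcal{I}_Z(d+2)\to 0$, where $T_{\mathcal{F}}$ (the tangent sheaf) is a rank 2 reflexive sheaf and $\mathcal{I}_Z$ is the ideal sheaf of a closed subscheme $Z=\mathrm{Sing}(\mathcal{F})$ of codimension at least 2. Define $t_{\mathcal{F}}:=\min\{k\in\mathbb{Z}: H^0(T_{\mathcal{F}}(k-1))\neq 0\}$. *)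

(* Defs.v *)
From HB Require Import structures.
From mathcomp Require Import all_boot all_order all_algebra.
From mathcomp Require Import classical_sets boolp functions topology reals complex.
From mathcomp Require Import mpoly.

Set Implicit Arguments.
Unset Strict Implicit.
Unset Printing Implicit Defensive.

Import Order.TTheory GRing.Theory Num.Theory.
Local Open Scope classical_set_scope.
Local Open Scope ring_scope.

Section Opens.
Variable X : topologicalType.

Record opens := Opens { oset :> set X; oset_open : open oset }.

Definition opensT : opens := Opens openT.
Definition opensI (U V : opens) : opens :=
  Opens (openI (oset_open U) (oset_open V)).

Definition locally (U : opens) (P : forall V : opens, V `<=` U -> Prop) : Prop :=
  forall x, oset U x -> exists V : opens, exists h : V `<=` U, oset V x /\ P V h.

Definition sheaf_cond (F : opens -> Type)
    (res : forall U V : opens, V `<=` U -> F U -> F V) : Prop :=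
  forall (U : opens) (I : Type) (V : I -> opens) (h : forall i, V i `<=` U),
    U `<=` \bigcup_i V i ->
  forall s : forall i, F (V i),
    (forall i j (W : opens) (hi : W `<=` V i) (hj : W `<=` V j),
       res _ _ hi (s i) = res _ _ hj (s j)) ->
  exists! t : F U, forall i, res _ _ (h i) t = s i.

(* Potentially zero rings are needed: the sections over the empty set. *)
Record ringSheaf := RingSheaf {
  rsec :> opens -> comPzRingType;
  rres : forall U V : opens, V `<=` U -> {rmorphism rsec U -> rsec V};
  rres_id : forall (U : opens) (h : U `<=` U) s, rres h s = s;
  rres_comp : forall (U V W : opens) (h : V `<=` U) (k : W `<=` V) s,
    rres k (rres h s) = rres (subset_trans k h) s;
  rres_sheaf : sheaf_cond (fun U V h => rres h : rsec U -> rsec V) }.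

Definition irreducible_set (Y : set X) : Prop :=
  Y !=set0 /\ forall A B : set X, closed A -> closed B ->
    Y `<=` A `|` B -> Y `<=` A \/ Y `<=` B.

(* The codimension of Z is the infimum, over the irreducible closed Y
   contained in Z, of the supremum of the lengths of the chains of
   irreducible closed sets that start at Y. *)
Definition codim_ge (n : nat) (Z : set X) : Prop :=
  forall Y, closed Y -> irreducible_set Y -> Y `<=` Z ->
  exists C : nat -> set X, [/\ C 0%N = Y,
    forall i, (i <= n)%N -> closed (C i) /\ irreducible_set (C i) &
    forall i, (i < n)%N -> C i `<` C i.+1].

End Opens.

Section Modules.
Variables (X : topologicalType) (O : ringSheaf X).
Notation opens := (opens X).

Record sheafMod := SheafMod {
  msec :> forall U : opens, lmodType (O U);
  mres : forall U V : opens, V `<=` U -> msec U -> msec V;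
  mresL : forall (U V : opens) (h : V `<=` U) a s t,
    mres h (a *: s + t) = rres O h a *: mres h s + mres h t;
  mres_id : forall (U : opens) (h : U `<=` U) s, mres h s = s;
  mres_comp : forall (U V W : opens) (h : V `<=` U) (k : W `<=` V) s,
    mres k (mres h s) = mres (subset_trans k h) s;
  mres_sheaf : sheaf_cond mres }.

Record hom (F G : sheafMod) := Hom {
  hfun :> forall U, F U -> G U;
  homL : forall U a (s t : F U), hfun (a *: s + t) = a *: hfun s + hfun t;
  hom_nat : forall (U V : opens) (h : V `<=` U) (s : F U),
    hfun (mres h s) = mres h (hfun s) }.

Definition isomorphic (F G : sheafMod) : Prop :=
  exists f : hom F G, forall U, bijective (f U).

Definition short_exact (F G H : sheafMod) (f : hom F G) (g : hom G H) : Prop :=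
  [/\ forall U, injective (f U),
      forall (U : opens) (s : G U), g U s = 0 <->
        locally (fun (V : opens) (h : V `<=` U) => exists t : F V, f V t = mres h s)
    & forall (U : opens) (s : H U),
        locally (fun (V : opens) (h : V `<=` U) => exists t : G V, g V t = mres h s)].

Record bilin (F G H : sheafMod) := Bilin {
  bfun :> forall U, F U -> G U -> H U;
  bilinLl : forall U a (s s' : F U) (t : G U),
    bfun (a *: s + s') t = a *: bfun s t + bfun s' t;
  bilinLr : forall U a (s : F U) (t t' : G U),
    bfun s (a *: t + t') = a *: bfun s t + bfun s t';
  bilin_nat : forall (U V : opens) (h : V `<=` U) (s : F U) (t : G U),
    bfun (mres h s) (mres h t) = mres h (bfun s t) }.

(* The universal property, among sheaves of O-modules, of the sheafification
   of U |-> F(U) (x)_{O(U)} G(U). *)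
Definition is_tensor (F G H : sheafMod) : Prop :=
  exists b : bilin F G H, forall (M : sheafMod) (c : bilin F G M),
    exists2 u : hom H M, (forall U (s : F U) (t : G U), u U (b U s t) = c U s t) &
      forall u' : hom H M, (forall U (s : F U) (t : G U), u' U (b U s t) = c U s t) ->
        forall U (x : H U), u' U x = u U x.

(* Every point has a neighbourhood U on which there is an exact sequence
   O^m -> O^n -> F -> 0, given by generators s and a matrix of relations r.
   For a locally noetherian ringed space this is coherence. *)
Definition coherent (F : sheafMod) : Prop :=
  forall x : X, exists U : opens, oset U x /\
  exists n m (s : 'I_n -> F U) (r : 'I_m -> 'I_n -> O U),
    (forall (V : opens) (h : V `<=` U) (t : F V),
      locally (fun (W : opens) (k : W `<=` V) => exists a : 'I_n -> O W,
        mres k t = \sum_i a i *: mres (subset_trans k h) (s i))) /\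
    (forall (V : opens) (h : V `<=` U) (a : 'I_n -> O V),
      \sum_i a i *: mres h (s i) = 0 <->
      locally (fun (W : opens) (k : W `<=` V) => exists c : 'I_m -> O W,
        forall i, rres O k (a i) =
                  \sum_j c j * rres O (subset_trans k h) (r j i))).

(* On an irreducible space: r germs at the generic point (i.e. r sections over
   a nonempty open set) form a basis of the stalk of F there over the stalk
   of O, the function field. *)
Definition has_rank (r : nat) (F : sheafMod) : Prop :=
  exists2 U : opens, U !=set0 & exists s : 'I_r -> F U,
    (forall (V : opens) (h : V `<=` U) (a : 'I_r -> O V), V !=set0 ->
       \sum_i a i *: mres h (s i) = 0 ->
       exists W : opens, exists k : W `<=` V, W !=set0 /\
         forall i, rres O k (a i) = 0) /\
    (forall (V : opens) (t : F V), V !=set0 ->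
       exists W : opens, exists (k : W `<=` V) (l : W `<=` U), W !=set0 /\
         exists a : 'I_r -> O W, mres k t = \sum_i a i *: mres l (s i)).

Record subMod (G : sheafMod) := SubMod {
  smem :> forall U, set (G U);
  smem0 : forall U, smem (0 : G U);
  smemL : forall U a (s t : G U), smem s -> smem t -> smem (a *: s + t);
  smem_res : forall (U V : opens) (h : V `<=` U) (s : G U),
    smem s -> smem (mres h s);
  smem_loc : forall (U : opens) (s : G U),
    locally (fun (V : opens) (h : V `<=` U) => smem (mres h s)) -> smem s }.

Lemma mres0 (F : sheafMod) (U V : opens) (h : V `<=` U) : mres h (0 : F U) = 0.
Proof.
have := mresL h 1 (0 : F U) 0; rewrite rmorph1 !scale1r addr0.
by move=> /eqP; rewrite -subr_eq0 opprD addrA subrr sub0r oppr_eq0 => /eqP.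
Qed.

Lemma mresD (F : sheafMod) (U V : opens) (h : V `<=` U) (s t : F U) :
  mres h (s + t) = mres h s + mres h t.
Proof. by have := mresL h 1 s t; rewrite rmorph1 !scale1r. Qed.

Lemma mresZ (F : sheafMod) (U V : opens) (h : V `<=` U) a (s : F U) :
  mres h (a *: s) = rres O h a *: mres h s.
Proof. by have := mresL h a s 0; rewrite mres0 !addr0. Qed.

Lemma mresN (F : sheafMod) (U V : opens) (h : V `<=` U) (s : F U) :
  mres h (- s) = - mres h s.
Proof. by rewrite -scaleN1r mresZ rmorphN1 scaleN1r. Qed.

Lemma mres_sep (F : sheafMod) (U : opens) (s t : F U) :
  locally (fun (V : opens) (h : V `<=` U) => mres h s = mres h t) -> s = t.
Proof.
move=> st.
pose I := {V : opens | exists h : V `<=` U, mres h s = mres h t}.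
have h (i : I) : sval i `<=` U by case: i => /= V [].
have cov : U `<=` \bigcup_(i : I) sval i.
  move=> x /st[V [k [Vx e]]].
  have P : exists h : V `<=` U, mres h s = mres h t by exists k.
  by exists (exist _ V P).
have [|u [_ uniq]] := @mres_sheaf F U I (fun i => sval i) h cov
    (fun i => mres (h i) t) _.
  by move=> i j W hi hj; rewrite !mres_comp; congr (mres _ _); apply: Prop_irrelevance.
have eq_st (i : I) (l : sval i `<=` U) : mres l s = mres l t.
  by case: i l => /= V [k e] l; rewrite (Prop_irrelevance l k).
by rewrite -(uniq s) ?(uniq t) // => i; exact: eq_st.
Qed.

End Modules.

Section SubSheaf.
Variables (X : topologicalType) (O : ringSheaf X) (G : sheafMod O).
Variable S : subMod G.
Notation opens := (opens X).

Definition sub_pred (U : opens) : pred (G U) := fun s => `[< S U s >].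

Lemma sub_pred_closed U : GRing.submod_closed (@sub_pred U).
Proof.
split; first by apply/asboolP; exact: smem0.
by move=> a s t /asboolP Ss /asboolP St; apply/asboolP/smemL.
Qed.

HB.instance Definition _ (U : opens) := GRing.isSubmodClosed.Build _ _
  (@sub_pred U) (sub_pred_closed U).

Definition sub_sec (U : opens) := {s : G U | @sub_pred U s}.
HB.instance Definition _ U := SubChoice.on (sub_sec U).
HB.instance Definition _ U :=
  [SubChoice_isSubZmodule of sub_sec U by <:].
HB.instance Definition _ U :=
  [SubZmodule_isSubLmodule of sub_sec U by <:].

Definition sub_res (U V : opens) (h : V `<=` U) (s : sub_sec U) : sub_sec V :=
  exist _ (mres h (val s)) (asboolT (smem_res h (asboolW (valP s)))).

Lemma sub_resL (U V : opens) (h : V `<=` U) a s t :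
  sub_res h (a *: s + t) = rres O h a *: sub_res h s + sub_res h t.
Proof. by apply: val_inj; rewrite /= mresL. Qed.

Lemma sub_res_id (U : opens) (h : U `<=` U) s : sub_res h s = s.
Proof. by apply: val_inj; rewrite /= mres_id. Qed.

Lemma sub_res_comp (U V W : opens) (h : V `<=` U) (k : W `<=` V) s :
  sub_res k (sub_res h s) = sub_res (subset_trans k h) s.
Proof. by apply: val_inj; rewrite /= mres_comp. Qed.

Lemma sub_sheaf : sheaf_cond sub_res.
Proof.
move=> U I V h cov s comp.
have [|t [tE tU]] := mres_sheaf h cov (s := fun i => val (s i)).
  by move=> i j W hi hj; have /(congr1 val) := comp i j W hi hj.
have St : @sub_pred U t.
  apply/asboolP/smem_loc => x /cov[i _ Vx]; exists (V i), (h i); split=> //.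
  by rewrite tE; exact: asboolW (valP (s i)).
exists (exist _ t St); split=> [i|t' t'E]; apply: val_inj => //=.
by apply: tU => i; rewrite -t'E.
Qed.

Definition subSheaf : sheafMod O :=
  SheafMod sub_resL sub_res_id sub_res_comp sub_sheaf.

End SubSheaf.
Coercion subSheaf : subMod >-> sheafMod.

Section NatMaps.
Variables (X : topologicalType) (O : ringSheaf X) (F G : sheafMod O).
Notation opens := (opens X).

(* Morphisms F|_U -> G|_U of the underlying sheaves of sets *)
Record natMap (U : opens) := NatMap {
  nmap :> forall V : opens, V `<=` U -> F V -> G V;
  nmap_nat : forall (V W : opens) (h : V `<=` U) (k : W `<=` V) s,
    nmap (subset_trans k h) (mres k s) = mres k (nmap h s) }.

HB.instance Definition _ U := gen_eqMixin (natMap U).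
HB.instance Definition _ U := gen_choiceMixin (natMap U).

Lemma natMapP U (f g : natMap U) :
  (forall (V : opens) (h : V `<=` U) s, f V h s = g V h s) -> f = g.
Proof.
case: f g => [f fn] [g gn] /= fg; have e : f = g.
  by do 2![apply: functional_extensionality_dep => ?]; apply/funext => ?.
by rewrite {}e in fn *; congr NatMap; exact: Prop_irrelevance.
Qed.

Variable U : opens.

Program Definition nm0 : natMap U := @NatMap U (fun V h s => 0) _.
Next Obligation. by move=> * /=; rewrite mres0. Qed.
Program Definition nmN (f : natMap U) : natMap U :=
  @NatMap U (fun V h s => - f V h s) _.
Next Obligation. by move=> * /=; rewrite nmap_nat mresN. Qed.
Program Definition nmD (f g : natMap U) : natMap U :=
  @NatMap U (fun V h s => f V h s + g V h s) _.
Next Obligation. by move=> * /=; rewrite !nmap_nat mresD. Qed.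
Program Definition nmZ (a : O U) (f : natMap U) : natMap U :=
  @NatMap U (fun V h s => rres O h a *: f V h s) _.
Next Obligation. by move=> * /=; rewrite !nmap_nat mresZ rres_comp. Qed.

Lemma nmDA : associative nmD.
Proof. by move=> f g k; apply: natMapP => V h s /=; rewrite addrA. Qed.
Lemma nmDC : commutative nmD.
Proof. by move=> f g; apply: natMapP => V h s /=; rewrite addrC. Qed.
Lemma nm0D : left_id nm0 nmD.
Proof. by move=> f; apply: natMapP => V h s /=; rewrite add0r. Qed.
Lemma nmND : left_inverse nm0 nmN nmD.
Proof. by move=> f; apply: natMapP => V h s /=; rewrite addNr. Qed.
HB.instance Definition _ := GRing.isZmodule.Build (natMap U) nmDA nmDC nm0D nmND.

Lemma nmZA a b f : nmZ a (nmZ b f) = nmZ (a * b) f.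
Proof. by apply: natMapP => V h s /=; rewrite scalerA rmorphM. Qed.
Lemma nm1Z : left_id 1 nmZ.
Proof. by move=> f; apply: natMapP => V h s /=; rewrite rmorph1 scale1r. Qed.
Lemma nmZDr : right_distributive nmZ +%R.
Proof. by move=> a f g; apply: natMapP => V h s /=; rewrite scalerDr. Qed.
Lemma nmZDl f : {morph nmZ^~ f : a b / a + b}.
Proof. by move=> a b; apply: natMapP => V h s /=; rewrite rmorphD scalerDl. Qed.
HB.instance Definition _ :=
  GRing.Zmodule_isLmodule.Build (O U) (natMap U) nmZA nm1Z nmZDr nmZDl.

End NatMaps.

Section NatMapSheaf.
Variables (X : topologicalType) (O : ringSheaf X) (F G : sheafMod O).
Notation opens := (opens X).

Program Definition nm_res (U V : opens) (h : V `<=` U) (f : natMap F G U) :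
  natMap F G V := @NatMap _ _ F G V (fun W k s => f W (subset_trans k h) s) _.
Next Obligation.
move=> U V h f W W' k l s /=; rewrite -nmap_nat.
by congr (nmap _ _ _); exact: Prop_irrelevance.
Qed.

Lemma nm_resL (U V : opens) (h : V `<=` U) a f g :
  nm_res h (a *: f + g) = rres O h a *: nm_res h f + nm_res h g.
Proof. by apply: natMapP => W k s /=; rewrite rres_comp. Qed.

Lemma nm_res_id (U : opens) (h : U `<=` U) f : nm_res h f = f.
Proof.
apply: natMapP => W k s /=.
by congr (nmap _ _ _); exact: Prop_irrelevance.
Qed.

Lemma nm_res_comp (U V W : opens) (h : V `<=` U) (k : W `<=` V) f :
  nm_res k (nm_res h f) = nm_res (subset_trans k h) f.
Proof.
apply: natMapP => W' l s /=.
by congr (nmap _ _ _); exact: Prop_irrelevance.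
Qed.

Lemma nm_sheaf : sheaf_cond nm_res.
Proof.
move=> U I V h cov f comp.
pose v (W : opens) i := opensI W (V i).
have vl (W : opens) i : v W i `<=` W by move=> x [].
have vr (W : opens) i : v W i `<=` V i by move=> x [].
have vcov (W : opens) : W `<=` U -> W `<=` \bigcup_i v W i.
  by move=> k x Wx; have [i _ Vx] := cov x (k x Wx); exists i.
have fE i j (W : opens) (hi : W `<=` V i) (hj : W `<=` V j) s :
    f i W hi s = f j W hj s.
  have /(congr1 (fun g : natMap F G W => g W (@subset_refl _ W) s)) /= :=
    comp i j W hi hj.
  rewrite (Prop_irrelevance (subset_trans _ hi) hi).
  by rewrite (Prop_irrelevance (subset_trans _ hj) hj).
have gl (W : opens) (k : W `<=` U) (s : F W) :
    {t : G W | forall i, mres (vl W i) t = f i _ (vr W i) (mres (vl W i) s) &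
       forall t', (forall i, mres (vl W i) t' = f i _ (vr W i) (mres (vl W i) s))
         -> t = t'}.
  apply: cid2; have [|t [? ?]] := mres_sheaf (vl W) (vcov W k)
    (s := fun i => f i _ (vr W i) (mres (vl W i) s)); last by exists t.
  move=> i j W' hi hj; rewrite -!nmap_nat !mres_comp.
  rewrite (fE i j _ _ (subset_trans hj (vr W j))).
  by congr (nmap _ _ _); congr (mres _ _); exact: Prop_irrelevance.
pose gf (W : opens) (k : W `<=` U) (s : F W) : G W := s2val (gl W k s).
have gn (W W' : opens) (k : W `<=` U) (l : W' `<=` W) s :
    gf W' (subset_trans l k) (mres l s) = mres l (gf W k s).
  rewrite /gf; case: (gl W' _ _) => t /= tE; apply => i.
  case: (gl W k s) => u /= uE _.
  have m : v W' i `<=` v W i by move=> x [/l].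
  have -> : mres (vl W' i) (mres l u) = mres m (mres (vl W i) u).
    by rewrite !mres_comp; congr (mres _ _); exact: Prop_irrelevance.
  rewrite uE -nmap_nat !mres_comp.
  rewrite (Prop_irrelevance (subset_trans m (vr W i)) (vr W' i)).
  by congr (nmap _ _ _); congr (mres _ _); exact: Prop_irrelevance.
exists (NatMap gn); split.
  move=> i; apply: natMapP => W k s /=; rewrite /gf.
  case: (gl _ _ _) => t /= tE; apply => j.
  by rewrite -nmap_nat (fE i j _ _ (vr W j)).
move=> g gE; apply: natMapP => W k s /=; rewrite /gf.
case: (gl _ _ _) => t /= tE; apply => i.
rewrite -(gE i) /= -nmap_nat.
by congr (nmap _ _ _); exact: Prop_irrelevance.
Qed.

Definition natMapSheaf : sheafMod O :=
  SheafMod nm_resL nm_res_id nm_res_comp nm_sheaf.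

Definition is_lin (U : opens) (f : natMapSheaf U) : Prop :=
  forall (V : opens) (h : V `<=` U) a (s t : F V),
    f V h (a *: s + t) = a *: f V h s + f V h t.

Lemma is_lin0 U : is_lin (0 : natMapSheaf U).
Proof. by move=> V h a s t /=; rewrite scaler0 addr0. Qed.

Lemma is_linL U a (f g : natMapSheaf U) :
  is_lin f -> is_lin g -> is_lin (a *: f + g).
Proof.
move=> fl gl V h b s t /=; rewrite fl gl !scalerDr !scalerA.
by rewrite [_ * b]mulrC -!addrA; congr (_ + _); rewrite addrCA.
Qed.

Lemma is_lin_res (U V : opens) (h : V `<=` U) (f : natMapSheaf U) :
  is_lin f -> is_lin (mres h f).
Proof. by move=> fl W k a s t; exact: fl. Qed.

Lemma is_lin_loc (U : opens) (f : natMapSheaf U) :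
  locally (fun (V : opens) (h : V `<=` U) => is_lin (mres h f)) -> is_lin f.
Proof.
move=> fl V h a s t; apply: mres_sep => x Vx.
have [W [k [Wx lW]]] := fl x (h x Vx).
have l1 : opensI V W `<=` V by move=> ? [].
have l2 : opensI V W `<=` W by move=> ? [].
exists (opensI V W), l1; split=> //; rewrite mresL -!nmap_nat mresL.
by rewrite (Prop_irrelevance (subset_trans l1 h) (subset_trans l2 k)); exact: lW.
Qed.

Definition sheafHom : sheafMod O :=
  SubMod is_lin0 is_linL is_lin_res is_lin_loc.

Definition direct_sum_sec (U : opens) : lmodType (O U) := (F U * G U)%type.
Definition direct_sum_res (U V : opens) (h : V `<=` U)
    (s : direct_sum_sec U) : direct_sum_sec V := (mres h s.1, mres h s.2).

Lemma direct_sum_resL (U V : opens) (h : V `<=` U) a s t :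
  direct_sum_res h (a *: s + t) =
    rres O h a *: direct_sum_res h s + direct_sum_res h t.
Proof. by rewrite /direct_sum_res /= !mresL. Qed.

Lemma direct_sum_res_id (U : opens) (h : U `<=` U) s : direct_sum_res h s = s.
Proof. by case: s => s t; rewrite /direct_sum_res !mres_id. Qed.

Lemma direct_sum_res_comp (U V W : opens) (h : V `<=` U) (k : W `<=` V) s :
  direct_sum_res k (direct_sum_res h s) = direct_sum_res (subset_trans k h) s.
Proof. by rewrite /direct_sum_res /= !mres_comp. Qed.

Lemma direct_sum_sheaf : sheaf_cond direct_sum_res.
Proof.
move=> U I V h cov s comp.
have [|t1 [E1 u1]] := mres_sheaf h cov (s := fun i => (s i).1).
  by move=> i j W hi hj; have [] := comp i j W hi hj.
have [|t2 [E2 u2]] := mres_sheaf h cov (s := fun i => (s i).2).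
  by move=> i j W hi hj; have [] := comp i j W hi hj.
exists (t1, t2); split=> [i|[t1' t2'] tE].
  by rewrite /direct_sum_res /= E1 E2 -surjective_pairing.
by congr (_, _); [apply: u1|apply: u2] => i; rewrite -tE.
Qed.

Definition direct_sum : sheafMod O := SheafMod
  direct_sum_resL direct_sum_res_id direct_sum_res_comp direct_sum_sheaf.

End NatMapSheaf.

Section StructureModule.
Variables (X : topologicalType) (O : ringSheaf X).
Notation opens := (opens X).

Lemma struct_resL (U V : opens) (h : V `<=` U) (a : O U) (s t : (O U)^o) :
  rres O h (a *: s + t) = rres O h a *: (rres O h s : (O V)^o) + rres O h t.
Proof. by rewrite rmorphD rmorphM. Qed.

Definition structMod : sheafMod O := @SheafMod _ O (fun U => (O U)^o)
  (fun U V h => rres O h) struct_resL (@rres_id _ O) (@rres_comp _ O)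
  (@rres_sheaf _ O).

Definition dual (F : sheafMod O) : sheafMod O := sheafHom F structMod.

(* coherent, and the canonical map from F to its double dual is bijective *)
Definition reflexive_sheaf (F : sheafMod O) : Prop :=
  coherent F /\
  forall (U : opens) (p : dual (dual F) U), exists! s : F U,
    forall (V : opens) (h : V `<=` U) (f : dual F V),
      val p V h f = val f V (@subset_refl _ V) (mres h s).

(* The points x with I_x <> O_x, i.e. the support of the closed subscheme
   defined by I *)
Definition support_quotient (I : subMod structMod) : set X :=
  [set x | forall U : opens, oset U x -> ~ I U (1 : O U)].

End StructureModule.

(* P^3 is treated as a classical variety: its points are the lines of K^4,
   i.e. the closed points of the scheme.  Restriction to closed points
   identifies the lattices of open sets, the structure sheaves, and hence the
   sheaves of modules of the two. *)
Section ProjectiveSpace.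
Variable K : closedFieldType.

Definition proj3 := {L : {vspace 'rV[K]_4} | \dim L == 1%N}.
HB.instance Definition _ := Choice.on proj3.

Definition zeros (S : set {mpoly K[4]}) : set proj3 :=
  [set L : proj3 | forall f (v : 'rV[K]_4), S f -> v \in val L -> f.@[v 0] = 0].

Definition zariski_open (U : set proj3) : Prop :=
  exists2 S : set {mpoly K[4]},
    (forall f, S f -> exists n : nat, f \is n.-homog) & U = ~` zeros S.

Lemma zerosCP (S : set {mpoly K[4]}) (L : proj3) :
  (~` zeros S) L <-> exists f (v : 'rV[K]_4), [/\ S f, v \in val L & f.@[v 0] != 0].
Proof.
split=> [zL|[f [v [Sf vL /eqP fv]]] zL]; last by apply: fv; exact: zL.
apply: contrapT => nex; apply: zL => f v Sf vL; apply: contrapT => /eqP fv.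
by apply: nex; exists f, v.
Qed.

Lemma homog_scale n (f : {mpoly K[4]}) c (v : 'rV[K]_4) :
  f \is n.-homog -> f.@[(c *: v) 0] = c ^+ n * f.@[v 0].
Proof.
move=> /dhomogP fn; rewrite !mevalE mulr_sumr; apply: eq_big_seq => m mf.
rewrite mulrCA; congr (_ * _); under eq_bigr => i _ do rewrite mxE exprMn.
by rewrite big_split /= prodrXr -mdegE fn.
Qed.

Lemma proj3_colinear (L : proj3) (v w : 'rV[K]_4) :
  v != 0 -> v \in val L -> w \in val L -> exists c, w = c *: v.
Proof.
case: L => /= L /eqP L1 v0 vL wL.
have : (<[v]> == L)%VS by rewrite eqEdim -memvE vL dim_vline v0 L1.
by move=> /eqP vE; move: wL; rewrite -vE => /vlineP.
Qed.

Lemma proj3_inj (L M : proj3) (v : 'rV[K]_4) :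
  v != 0 -> v \in val L -> v \in val M -> L = M.
Proof.
have line (N : proj3) : v != 0 -> v \in val N -> <[v]>%VS = val N.
  case: N => /= N /eqP N1 v0 vN; apply/eqP.
  by rewrite eqEdim -memvE vN dim_vline v0 N1.
by move=> v0 /(line L v0) eL /(line M v0) eM; apply: val_inj; rewrite -eL.
Qed.

Lemma zariski_openT : zariski_open setT.
Proof.
exists [set 1]; first by move=> _ ->; exists 0%N; exact: dhomog1.
apply/seteqP; split=> // L _; apply/zerosCP.
by exists 1, 0; rewrite mem0v meval1 oner_neq0.
Qed.

Lemma zariski_openI : setI_closed zariski_open.
Proof.
move=> _ _ [S Sh ->] [T Th ->].
exists [set f | exists g h, [/\ S g, T h & f = g * h]].
  move=> _ [g [h [/Sh[m gm] /Th[n hn] ->]]]; exists (m + n)%N.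
  exact: dhomogM.
apply/seteqP; split=> L.
  move=> [/zerosCP[f [v [Sf vL fv]]] /zerosCP[g [w [Tg wL gw]]]].
  apply/zerosCP.
  have [v0|v0] := eqVneq v 0.
    exists (f * g), w; split=> //; first by exists f, g.
    rewrite mevalM mulf_neq0 //; have [m fm] := Sh _ Sf.
    move: fv; rewrite v0 -(scale0r w) (homog_scale _ _ fm).
    by rewrite mulf_eq0 negb_or => /andP[].
  have [c wE] := proj3_colinear v0 vL wL.
  exists (f * g), v; split=> //; first by exists f, g.
  rewrite mevalM mulf_neq0 //; have [n gn] := Th _ Tg.
  by move: gw; rewrite wE (homog_scale _ _ gn) mulf_eq0 negb_or => /andP[].
move=> /zerosCP[_ [v [[f [g [Sf Tg ->]]] vL]]].
rewrite mevalM mulf_eq0 negb_or => /andP[fv gv].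
by split; apply/zerosCP; [exists f, v|exists g, v].
Qed.

Lemma zariski_open_bigU (I : Type) (U : I -> set proj3) :
  (forall i, zariski_open (U i)) -> zariski_open (\bigcup_i U i).
Proof.
move=> Uo; exists [set f | (exists n : nat, f \is n.-homog) /\
    ~` zeros [set f] `<=` \bigcup_i U i]; first by move=> f [].
apply/seteqP; split=> L.
  move=> [i _ UL]; have [S Sh UE] := Uo i.
  move: UL; rewrite UE => /zerosCP[f [v [Sf vL fv]]]; apply/zerosCP.
  exists f, v; split=> //; split; first exact: Sh.
  move=> M /zerosCP[_ [w [-> wM fw]]]; exists i => //; rewrite UE.
  by apply/zerosCP; exists f, w.
move=> /zerosCP[f [v [[_ +] vL fv]]]; apply.
by apply/zerosCP; exists f, v.
Qed.

HB.instance Definition _ := isOpenTopological.Build proj3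
  zariski_openT zariski_openI zariski_open_bigU.

Lemma open_zariski (U : set proj3) : open U = zariski_open U.
Proof. by []. Qed.

Notation opens := (opens proj3).

Definition cone (U : opens) :=
  {v : 'rV[K]_4 | v != 0 /\ exists2 L : proj3, oset U L & v \in val L}.

Lemma cone_incl_subproof (U V : opens) (h : V `<=` U) (v : cone V) :
  sval v != 0 /\ exists2 L : proj3, oset U L & sval v \in val L.
Proof. by case: v => v [v0 [L VL vL]]; split=> //; exists L => //; exact: h. Qed.

Definition cone_incl (U V : opens) (h : V `<=` U) (v : cone V) : cone U :=
  exist _ (sval v) (cone_incl_subproof h v).

(* A section of O(k) over U is a function on the cone over U that is locally
   a quotient p / q of homogeneous polynomials with deg p = deg q + k. *)
Definition regular (k : int) (U : opens) (s : cone U -> K) : Prop :=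
  locally (fun (V : opens) (h : V `<=` U) =>
    exists m n (p q : {mpoly K[4]}),
      [/\ p \is m.-homog, q \is n.-homog, m%:Z = n%:Z + k &
        forall v : cone V, q.@[sval v 0] != 0 /\
          s (cone_incl h v) = p.@[sval v 0] / q.@[sval v 0]]).

Lemma coneP (U : opens) (v w : cone U) : sval v = sval w -> v = w.
Proof. by case: v w => [v hv] [w hw] /= e; apply: eq_exist. Qed.

Lemma cone_incl_id (U : opens) (h : U `<=` U) v : cone_incl h v = v.
Proof. exact: coneP. Qed.

Lemma cone_incl_comp (U V W : opens) (h : V `<=` U) (k : W `<=` V) v :
  cone_incl h (cone_incl k v) = cone_incl (subset_trans k h) v.
Proof. exact: coneP. Qed.

Lemma regularM k l U (s t : cone U -> K) :
  regular k s -> regular l t -> regular (k + l) (s * t).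
Proof.
move=> rs rt x Ux.
have [V [h [Vx [m [n [p [q [pm qn mn sE]]]]]]]] := rs x Ux.
have [W [i [Wx [m' [n' [p' [q' [pm' qn' mn' tE]]]]]]]] := rt x Ux.
have jV : opensI V W `<=` V by move=> ? [].
have jW : opensI V W `<=` W by move=> ? [].
exists (opensI V W), (subset_trans jV h); split=> //.
exists (m + m')%N, (n + n')%N, (p * p'), (q * q'); split.
- exact: dhomogM.
- exact: dhomogM.
- by rewrite !PoszD mn mn' addrACA.
move=> v; have [q0 e] := sE (cone_incl jV v).
have [q0' e'] := tE (cone_incl jW v).
rewrite !mevalM mulf_neq0 //; split=> //.
rewrite -cone_incl_comp [LHS]/=.
have -> : (s * t) (cone_incl h (cone_incl jV v)) =
    s (cone_incl h (cone_incl jV v)) * t (cone_incl i (cone_incl jW v)).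
  by congr (_ * t _); exact: coneP.
by rewrite e e' invfM mulrACA.
Qed.

Lemma regularB k U (s t : cone U -> K) :
  regular k s -> regular k t -> regular k (s - t).
Proof.
move=> rs rt x Ux.
have [V [h [Vx [m [n [p [q [pm qn mn sE]]]]]]]] := rs x Ux.
have [W [i [Wx [m' [n' [p' [q' [pm' qn' mn' tE]]]]]]]] := rt x Ux.
have jV : opensI V W `<=` V by move=> ? [].
have jW : opensI V W `<=` W by move=> ? [].
exists (opensI V W), (subset_trans jV h); split=> //.
exists (m + n')%N, (n + n')%N, (p * q' - q * p'), (q * q'); split.
- have e : (m + n' = n + m')%N.
    by apply/eqP; rewrite -eqz_nat !PoszD mn mn' addrAC addrA.
  by apply: rpredB; [|rewrite e]; exact: dhomogM.
- exact: dhomogM.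
- by rewrite !PoszD mn addrAC.
move=> v; have [q0 e] := sE (cone_incl jV v).
have [q0' e'] := tE (cone_incl jW v).
rewrite mevalB !mevalM mulf_neq0 //; split=> //.
rewrite -cone_incl_comp.
have -> : (s - t) (cone_incl h (cone_incl jV v)) =
    s (cone_incl h (cone_incl jV v)) - t (cone_incl i (cone_incl jW v)).
  by congr (_ - t _); exact: coneP.
rewrite e e' /= mulrBl invfM mulrACA divff // mulr1.
by congr (_ - _); rewrite mulrACA divff ?mul1r.
Qed.

Lemma regular_poly (U : opens) m (p : {mpoly K[4]}) :
  p \is m.-homog -> regular m%:Z (fun v : cone U => p.@[sval v 0]).
Proof.
move=> pm x Ux; exists U, (@subset_refl _ U); split=> //.
exists m, 0%N, p, 1; split=> //; first exact: dhomog1.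
by move=> v; rewrite meval1 oner_neq0 divr1.
Qed.

Lemma regular_cst (U : opens) (c : K) : regular 0 (fun v : cone U => c).
Proof.
suff cm : (c%:MP : {mpoly K[4]}) \is 0.-homog.
  by have := @regular_poly U 0 c%:MP cm; under eq_fun do rewrite mevalC.
by apply/dhomogP => m; rewrite msuppC; case: eqP => //; rewrite inE => _ /eqP ->; exact: mdeg0.
Qed.

Lemma regular_res k (U V : opens) (h : V `<=` U) (s : cone U -> K) :
  regular k s -> regular k (s \o cone_incl h).
Proof.
move=> rs x Vx; have [W [i [Wx [m [n [p [q [pm qn mn sE]]]]]]]] := rs x (h x Vx).
have jV : opensI V W `<=` V by move=> ? [].
have jW : opensI V W `<=` W by move=> ? [].
exists (opensI V W), jV; split=> //; exists m, n, p, q; split=> // v.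
have [q0 e] := sE (cone_incl jW v); split=> //.
by rewrite -e /=; congr s; exact: coneP.
Qed.

Lemma regular_loc k (U : opens) (s : cone U -> K) :
  locally (fun (V : opens) (h : V `<=` U) => regular k (s \o cone_incl h)) ->
  regular k s.
Proof.
move=> rs x /rs[V [h [Vx /(_ x Vx)[W [i [Wx [m [n [p [q [pm qn mn sE]]]]]]]]]]].
exists W, (subset_trans i h); split=> //; exists m, n, p, q; split=> // v.
by have [q0 <-] := sE v; split=> //=; congr s; exact: coneP.
Qed.

Definition regular_pred k (U : opens) : pred (cone U -> K) :=
  fun s => `[< regular k s >].

Lemma openD_subproof (f : {mpoly K[4]}) n :
  f \is n.-homog -> open (~` zeros [set f]).
Proof. by move=> fn; rewrite open_zariski; exists [set f] => // _ ->; exists n. Qed.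

Lemma regular0 k (U : opens) : regular k (0 : cone U -> K).
Proof.
move=> L UL.
have [i [v [vL vi]]] : exists i : 'I_4, exists v, v \in val L /\ v 0 i != 0.
  case: (L) => M /= /eqP M1; pose v := vpick M.
  have v0 : v != 0 by rewrite vpick0 -dimv_eq0 M1.
  have /rV0Pn[i vi] := v0; exists i, v; split=> //; exact: memv_pick.
have Xh (j : nat) : ('X_i ^+ j : {mpoly K[4]}) \is j.-homog.
  by rewrite -{2}(mul1n j); apply: dhomogMn; rewrite dhomogX /= mdeg1.
pose D := Opens (openD_subproof (Xh 1%N)).
have DL : oset D L.
  by apply/zerosCP; exists 'X_i, v; rewrite mevalXU.
have jU : opensI U D `<=` U by move=> ? [].
exists (opensI U D), jU; split=> //.
have [m' [n' e]] : exists m' n' : nat, m'%:Z = n'%:Z + k.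
  case: k => k; first by exists k, 0%N; rewrite -PoszD.
  by exists 0%N, k.+1; rewrite NegzE subrr.
exists m', n', 0, ('X_i ^+ n'); split=> //; first exact: dhomog0.
move=> w; have [w0 [M [UM /zerosCP[_ [u [-> uM ui]]]] wM]] := svalP w.
rewrite meval0 mul0r; split=> //.
have [c uE] := proj3_colinear w0 wM uM.
move: ui; rewrite mevalXU uE mxE mulf_eq0 negb_or => /andP[_ wi].
by rewrite rmorphXn /= mevalXU expf_neq0.
Qed.

Section Sections.
Variables (k : int) (U : opens).

Lemma regular_zmod_closed : GRing.zmod_closed (@regular_pred k U).
Proof.
split; first by apply/asboolP; exact: regular0.
by move=> s t /asboolP rs /asboolP rt; apply/asboolP; exact: regularB.
Qed.
HB.instance Definition _ := GRing.isZmodClosed.Build _ (@regular_pred k U)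
  regular_zmod_closed.

Definition twist_sec := {s : cone U -> K | @regular_pred k U s}.
HB.instance Definition _ := SubChoice.on twist_sec.
HB.instance Definition _ := [SubChoice_isSubZmodule of twist_sec by <:].

Definition regular_fun_pred : pred (cone U -> K) := @regular_pred 0 U.

Lemma regular_fun_closed : GRing.subring_closed regular_fun_pred.
Proof.
split.
- by apply/asboolP; exact: (@regular_cst U 1).
- by move=> s t /asboolP rs /asboolP rt; apply/asboolP; exact: regularB.
- move=> s t /asboolP rs /asboolP rt; apply/asboolP.
  by rewrite -[0]addr0; exact: regularM.
Qed.

Definition regular_fun := {s : cone U -> K | regular_fun_pred s}.
HB.instance Definition _ := SubChoice.on regular_fun.
HB.instance Definition _ := GRing.SubChoice_isSubComPzRing.Build _ _
  regular_fun regular_fun_closed.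

Definition twist_scale (a : regular_fun) (s : twist_sec) : twist_sec.
Proof.
refine (exist _ (val a * val s) _); apply/asboolP.
have := regularM (asboolW (valP a)) (asboolW (valP s)).
by rewrite add0r.
Defined.

Lemma twist_scaleA a b s :
  twist_scale a (twist_scale b s) = twist_scale (a * b) s.
Proof. by apply: val_inj; rewrite /= mulrA. Qed.
Lemma twist_scale1 : left_id 1 twist_scale.
Proof. by move=> s; apply: val_inj; rewrite /= mul1r. Qed.
Lemma twist_scaleDr : right_distributive twist_scale +%R.
Proof. by move=> a s t; apply: val_inj; rewrite /= mulrDr. Qed.
Lemma twist_scaleDl s : {morph twist_scale^~ s : a b / a + b}.
Proof. by move=> a b; apply: val_inj; rewrite /= mulrDl. Qed.
HB.instance Definition _ := GRing.Zmodule_isLmodule.Build regular_fun twist_sec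
  twist_scaleA twist_scale1 twist_scaleDr twist_scaleDl.

End Sections.

Definition cone_res k (U V : opens) (h : V `<=` U) (s : twist_sec k U) :
    twist_sec k V :=
  exist _ (val s \o cone_incl h)
    (asboolT (regular_res h (asboolW (valP s)))).

Lemma cone_res_sheaf k : sheaf_cond (@cone_res k).
Proof.
move=> U I V h cov s comp.
have ci (v : cone U) : {iw : {i : I & cone (V i)} |
    v = cone_incl (h (projT1 iw)) (projT2 iw)}.
  apply: cid; have [v0 [L UL vL]] := svalP v; have [i _ VL] := cov L UL.
  have P : sval v != 0 /\ exists2 L : proj3, oset (V i) L & sval v \in val L.
    by split=> //; exists L.
  exists (existT _ i (exist _ (sval v) P)); exact: coneP.
pose t (v : cone U) : K :=
  val (s (projT1 (sval (ci v)))) (projT2 (sval (ci v))).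
have tE i (v : cone (V i)) : t (cone_incl (h i) v) = val (s i) v.
  rewrite /t; case: (ci _) => -[j w] /= /(congr1 sval) /= vw.
  have hi : opensI (V i) (V j) `<=` V i by move=> ? [].
  have hj : opensI (V i) (V j) `<=` V j by move=> ? [].
  have P : sval v != 0 /\
      exists2 L : proj3, oset (opensI (V i) (V j)) L & sval v \in val L.
    have [v0 [L VL vL]] := svalP v; split=> //.
    have [_ [M VM wM]] := svalP w; exists L => //; split=> //.
    suff -> : L = M by [].
    by apply: proj3_inj v0 vL _; rewrite vw.
  have /(congr1 (fun f => val f (exist _ (sval v) P))) /= := comp i j _ hi hj.
  have -> : cone_incl hi (exist _ (sval v) P) = v by exact: coneP.
  by have -> : cone_incl hj (exist _ (sval v) P) = w by exact: coneP.
have rt : regular_pred k t.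
  apply/asboolP/regular_loc => L /cov[i _ VL]; exists (V i), (h i); split=> //.
  suff -> : t \o cone_incl (h i) = val (s i) by exact: asboolW (valP (s i)).
  by apply/funext => v; exact: tE.
exists (exist _ t rt); split=> [i|t' t'E]; apply: val_inj; apply/funext => v /=.
  exact: tE.
by case: (ci v) => -[i w] /= ->; rewrite tE -t'E.
Qed.

Definition rfun_res (U V : opens) (h : V `<=` U) (s : regular_fun U) :
  regular_fun V := cone_res h s.

Lemma rfun_res_zmod (U V : opens) (h : V `<=` U) : zmod_morphism (rfun_res h).
Proof. by move=> s t; apply: val_inj. Qed.
HB.instance Definition _ (U V : opens) (h : V `<=` U) :=
  GRing.isZmodMorphism.Build _ _ (rfun_res h) (rfun_res_zmod h).
Lemma rfun_res_monoid (U V : opens) (h : V `<=` U) :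
  monoid_morphism (rfun_res h).
Proof. by split=> [|s t]; apply: val_inj. Qed.
HB.instance Definition _ (U V : opens) (h : V `<=` U) :=
  GRing.isMonoidMorphism.Build _ _ (rfun_res h) (rfun_res_monoid h).

Lemma cone_res_id k (U : opens) (h : U `<=` U) (s : twist_sec k U) :
  cone_res h s = s.
Proof. by apply: val_inj; apply/funext => v /=; rewrite cone_incl_id. Qed.

Lemma cone_res_comp k (U V W : opens) (h : V `<=` U) (l : W `<=` V)
    (s : twist_sec k U) :
  cone_res l (cone_res h s) = cone_res (subset_trans l h) s.
Proof. by apply: val_inj; apply/funext => v /=; rewrite cone_incl_comp. Qed.

Definition strO : ringSheaf proj3 := @RingSheaf proj3
  (fun U => regular_fun U) (fun U V h => rfun_res h)
  (@cone_res_id 0) (@cone_res_comp 0) (@cone_res_sheaf 0).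

Lemma cone_resL k (U V : opens) (h : V `<=` U) (a : strO U)
    (s t : twist_sec k U) :
  cone_res h (a *: s + t) = rres strO h a *: cone_res h s + cone_res h t.
Proof. exact: val_inj. Qed.

Definition OP (k : int) : sheafMod strO := @SheafMod proj3 strO
  (fun U => twist_sec k U) (@cone_res k) (@cone_resL k) (@cone_res_id k)
  (@cone_res_comp k) (@cone_res_sheaf k).

Definition is_twist (F : sheafMod strO) (k : int) (H : sheafMod strO) : Prop :=
  is_tensor F (OP k) H.

Definition cstO (U : opens) (c : K) : strO U :=
  exist _ (fun v => c) (asboolT (regular_cst c)).

(* Together with additivity and the Leibniz rule, the vanishing of D on
   constants amounts to K-linearity. *)
Definition is_der (U : opens)
    (D : natMapSheaf (structMod strO) (structMod strO) U) : Prop :=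
  forall (V : opens) (h : V `<=` U),
    [/\ forall f g : strO V, D V h (f + g) = D V h f + D V h g,
        forall c : K, D V h (cstO V c) = 0 &
        forall f g : strO V, D V h (f * g) = f *: D V h g + g *: D V h f].

Lemma is_der0 U : is_der (0 : natMapSheaf (structMod strO) (structMod strO) U).
Proof. by move=> V h; split=> * /=; rewrite ?scaler0 ?addr0. Qed.

Lemma is_derL U a (D E : natMapSheaf (structMod strO) (structMod strO) U) :
  is_der D -> is_der E -> is_der (a *: D + E).
Proof.
move=> dD dE V h; have [D1 D2 D3] := dD V h; have [E1 E2 E3] := dE V h.
split=> [f g|c|f g] /=.
- by rewrite D1 E1 scalerDr addrACA.
- by rewrite D2 E2 scaler0 addr0.
- have sC (b c : strO V) (x : structMod strO V) : b *: (c *: x) = c *: (b *: x).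
    by rewrite !scalerA mulrC.
  by rewrite D3 E3 !scalerDr addrACA; congr (_ + _ + (_ + _)); exact: sC.
Qed.

Lemma is_der_res (U V : opens) (h : V `<=` U)
    (D : natMapSheaf (structMod strO) (structMod strO) U) :
  is_der D -> is_der (mres h D).
Proof. by move=> dD W k; exact: dD. Qed.

Lemma is_der_loc (U : opens)
    (D : natMapSheaf (structMod strO) (structMod strO) U) :
  locally (fun (V : opens) (h : V `<=` U) => is_der (mres h D)) -> is_der D.
Proof.
move=> dD V h.
have loc x : oset V x -> exists W : opens, exists l : W `<=` V, oset W x /\
    [/\ forall f g : strO W, D W (subset_trans l h) (f + g) =
           D W (subset_trans l h) f + D W (subset_trans l h) g,
        forall c : K, D W (subset_trans l h) (cstO W c) = 0 &
        forall f g : strO W, D W (subset_trans l h) (f * g) =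
           f *: D W (subset_trans l h) g + g *: D W (subset_trans l h) f].
  move=> Vx; have [W [k [Wx dW]]] := dD x (h x Vx).
  have l1 : opensI V W `<=` V by move=> ? [].
  have l2 : opensI V W `<=` W by move=> ? [].
  exists (opensI V W), l1; split=> //.
  rewrite (Prop_irrelevance (subset_trans l1 h) (subset_trans l2 k)).
  exact: dW.
split=> [f g|c|f g]; apply: (@mres_sep _ _ (structMod strO)) => x /loc[W [l [Wx [d1 d2 d3]]]];
  exists W, l; split=> //.
- rewrite mresD -!nmap_nat -d1; congr (nmap _ _ _); exact: rmorphD.
- rewrite mres0 -nmap_nat -(d2 c); congr (nmap _ _ _); exact: val_inj.
- rewrite mresD !mresZ -!nmap_nat -d3; congr (nmap _ _ _); exact: rmorphM.
Qed.

(* T = Der_K(O, O) = Hom(Omega, O) *)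
Definition tangent_sheaf : sheafMod strO :=
  SubMod is_der0 is_derL is_der_res is_der_loc.

(* The singular scheme Z is given by its ideal sheaf: closed subschemes of the
   noetherian scheme P^3 are the same as coherent sheaves of ideals.
   dist_twist is I_Z(d + 2), which is only determined up to isomorphism. *)
Record distribution (d : int) := Distribution {
  dist_tangent : sheafMod strO;
  dist_reflexive : reflexive_sheaf dist_tangent;
  dist_rank : has_rank 2 dist_tangent;
  dist_ideal : subMod (structMod strO);
  dist_coherent : coherent dist_ideal;
  dist_codim : codim_ge 2 (support_quotient dist_ideal);
  dist_twist : sheafMod strO;
  dist_twistP : is_twist dist_ideal (d + 2) dist_twist;
  dist_incl : hom dist_tangent tangent_sheaf;
  dist_proj : hom tangent_sheaf dist_twist;
  dist_exact : short_exact dist_incl dist_proj }.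

Definition has_section (F : sheafMod strO) (k : int) : Prop :=
  exists2 H : sheafMod strO, is_twist F k H & exists s : H (opensT proj3), s <> 0.

Definition is_min_section_twist (F : sheafMod strO) (t : int) : Prop :=
  has_section F (t - 1) /\ forall k, has_section F (k - 1) -> t <= k.

End ProjectiveSpace.

(* Main.v *)
Require Import Defs.
From mathcomp Require Import all_boot all_order all_algebra reals complex.
From mathcomp Require Import classical_sets boolp functions topology.
From mathcomp Require Import mpoly ring zify.

(* Contraction with the distribution is a twisted 1-form [sum A_j dx_j] with
   coefficients of degree [d + 1] and [sum x_j A_j = 0].  Its scheme of zeros is
   contained in [Z], which has codimension at least two, so the [A_j] have no
   common factor.  A section of [T_F(-1)] is a constant vector field
   [sum e_j d/dx_j] with [sum e_j A_j = 0].  If [e_i0 != 0], then with the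
   linear forms [y_j = x_j - (e_j / e_i0) x_i0], [j != i0], one gets
   [sum_{j != i0} y_j A_j = 0], and exactness of the Koszul complex yields
   [A = y x B] (a cross product) with [B] homogeneous of degree [d]; in
   particular [d >= 0].  The fields [e] and [B] then generate [T_F] freely: a
   local field [w] annihilated by the form reduces modulo [e] to
   [alpha y + gamma B], where [gamma A = y x w] and [alpha A = w x B], and
   [alpha], [gamma] are regular because the [A_j] are coprime in a factorial
   ring. *)

Set Implicit Arguments.
Unset Strict Implicit.
Unset Printing Implicit Defensive.

Import Order.TTheory GRing.Theory Num.Theory.
Local Open Scope classical_set_scope.
Local Open Scope ring_scope.

(** * Factorial rings *)

(** Factoriality of [{mpoly K[4]}] replaces cohomology. A regular function on any open set is one
    reduced fraction; hence it extends across a locus of codimension two, and functions proportional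
    to the coprime [A_j] are a regular multiple of them. Vector fields enter through the Euler
    sequence: locally they lift to [sum w_j d/dx_j] with [w_j] in [O(1)], and the lift is unique up
    to multiples of [sum x_j d/dx_j]. The [y_j] are the linear forms that vanish at the point [e],
    equivalently those annihilated by the constant field [e]; the relation [sum y_j A_j = 0] is
    [sum x_j A_j = 0] after [A_i0] has been eliminated by [sum e_j A_j = 0]. Twists are given by a
    universal property only, and are made concrete as [Hom(O(-k), F)]. *)

Section Factoriality.
Variable R : idomainType.
Implicit Types a b c p q : R.

Definition divides a b : Prop := exists c, b = c * a.
(* [0] is prime here: the zero ideal of a domain is a prime ideal. *)
Definition prime_elt p : Prop :=
  p \isn't a GRing.unit /\ forall a b, divides p (a * b) -> divides p a \/ divides p b.
Definition irred p : Prop :=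
  [/\ p != 0, p \isn't a GRing.unit &
      forall a b, p = a * b -> a \is a GRing.unit \/ b \is a GRing.unit].

(** Products of primes up to a unit. Asking every nonzero element to be one gives existence and
    uniqueness of factorizations at once, and an induction over the prime factors. *)
Inductive prime_product : R -> Prop :=
| prime_product_unit u : u \is a GRing.unit -> prime_product u
| prime_product_mul p a :
    prime_elt p -> p != 0 -> prime_product a -> prime_product (p * a).

Definition factorial_ring : Prop := forall a, a != 0 -> prime_product a.

Lemma prime_productM a b :
  prime_product a -> prime_product b -> prime_product (a * b).
Proof.
elim=> {a} [u uu|p a pp p0 _ IH] pb.
  elim: pb => {b} [v vu|p b pp p0 _ IH].
    by apply: prime_product_unit; rewrite unitrM uu.
  by rewrite mulrCA; apply: prime_product_mul.
by rewrite -mulrA; apply: prime_product_mul => //; exact: IH.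
Qed.

Lemma divides_mull a b c : divides a b -> divides a (c * b).
Proof. by move=> [x ->]; exists (c * x); rewrite mulrA. Qed.

Lemma divides_mulr a b c : divides a b -> divides a (b * c).
Proof. by rewrite mulrC; exact: divides_mull. Qed.

Lemma irred_prime p : factorial_ring -> irred p -> prime_elt p.
Proof.
move=> fR [p0 pu pI]; case: (fR _ p0) (pu) (pI) => {p0 pu pI} [u uu|q a].
  by rewrite uu.
move=> [qu qP] q0 _ pu /(_ _ _ erefl)[|au]; first by rewrite (negPf qu).
split=> // x y [c]; rewrite mulrA => xy.
have [|[z ->]|[z ->]] := qP x y; first by exists (c * a); rewrite xy mulrAC.
- by left; exists (z / a); rewrite [q * a]mulrC mulrA divrK.
- by right; exists (z / a); rewrite [q * a]mulrC mulrA divrK.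
Qed.

End Factoriality.

(** * Gauss's lemma over a factorial ring *)

Section PolyFactorial.
Import Pdiv.Idomain.
Variable R : idomainType.
Implicit Types p q s t : {poly R}.
Hypothesis fR : factorial_ring R.

Lemma divides_polyC (c : R) p : divides c%:P p <-> forall i, divides c p`_i.
Proof.
split=> [[q ->] i|cp]; first by rewrite coefMC; exists q`_i.
elim/poly_ind: p cp => [|p a IH] cp; first by exists 0; rewrite mul0r.
have [|q ->] := IH.
  by move=> i; have := cp i.+1; rewrite coefD coefMX coefC addr0.
have [b] := cp 0%N; rewrite coefD coefMX coefC add0r /= => ->.
by exists (q * 'X + b%:P); rewrite mulrDl mulrAC polyCM.
Qed.

Lemma divides_polyMX (c : R) p (a : R) :
  divides c%:P p -> divides c a -> divides c%:P (p * 'X + a%:P).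
Proof.
by move=> [q ->] [b ->]; exists (q * 'X + b%:P); rewrite mulrDl mulrAC polyCM.
Qed.

(** Gauss's lemma. [c] divides the product of the constant terms, hence one of them; that factor
    loses its constant term and a power of ['X], and the induction continues with the shorter
    polynomial. *)
Lemma prime_polyC (c : R) : prime_elt c -> prime_elt c%:P.
Proof.
move=> [cu cP]; split; first by rewrite poly_unitE coefC /= (negPf cu) andbF.
elim/poly_ind=> [|p a IHp]; first by left; exists 0; rewrite mul0r.
elim/poly_ind=> [|q b IHq]; first by right; exists 0; rewrite mul0r.
move=> /divides_polyC cpq.
have := cpq 0%N; rewrite coefM big_ord1 !coefD !coefMX !coefC !add0r /=.
have cM r (x : R) s : divides c x -> (forall i, divides c ((r * 'X + x%:P) * s)`_i) ->
    divides c%:P (r * s).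
  move=> [y ->] crs; apply/divides_polyC => i; have [z] := crs i.+1.
  rewrite mulrDl mulrAC coefD coefMX /= coefCM => /eqP.
  rewrite -subr_eq0 -addrA addr_eq0 opprB => /eqP ->.
  by exists (z - y * s`_i.+1); rewrite mulrBl mulrAC.
move=> /cP[ca|cb].
  have [cp|cq] := IHp (q * 'X + b%:P) (cM _ _ _ ca cpq); last by right.
  by left; exact: divides_polyMX.
have [||cq] := IHq; last by right; exact: divides_polyMX.
  by rewrite mulrC; apply: cM cb _ => i; rewrite mulrC.
by left.
Qed.

Lemma irred_polyC (c : R) : irred c%:P -> irred c.
Proof.
move=> [c0 cu cI]; split; first by apply: contraNneq c0 => ->.
  by move: cu; rewrite poly_unitE coefC size_polyC /=; move: c0; rewrite polyC_eq0 => ->.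
move=> a b cab; have := cI a%:P b%:P; rewrite -polyCM -cab.
by move=> /(_ erefl); rewrite !poly_unitE !coefC => -[] /andP[_ ?]; [left|right].
Qed.

Section Primitive.
Variable p : {poly R}.
(** The primes of [r] are cancelled one at a time, each from [s] or from [t] by Gauss's lemma.
    Constants do not change the size, so a factorization over the fraction field descends to [R]
    with the same degrees. *)
Lemma factor_clear_denominator (r : R) s t : prime_product r ->
  r%:P * p = s * t -> exists s' t', [/\ p = s' * t', size s' = size s & size t' = size t].
Proof.
move=> pr; elim: pr s t => {r} [r ru|c r cp c0 _ IH] s t rs.
  exists (r^-1%:P * s), t; split=> //; first by rewrite -mulrA -rs mulrA -polyCM mulVr ?mul1r.
  have r0 : r^-1 != 0 by rewrite invr_eq0; apply: contraTneq ru => ->; rewrite unitr0.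
  by rewrite mul_polyC size_scale.
have cP0 : c%:P != 0 by rewrite polyC_eq0.
have [|[u su]|[u tu]] := (prime_polyC cp).2 s t.
- by exists (r%:P * p); rewrite -rs polyCM; ring.
- have [|s' [t' [e es et]]] := IH u t.
    by apply: (mulfI cP0); rewrite mulrA -polyCM rs su; ring.
  by exists s', t'; split=> //; rewrite es su mulrC mul_polyC size_scale.
- have [|s' [t' [e es et]]] := IH s u.
    by apply: (mulfI cP0); rewrite mulrA -polyCM rs tu; ring.
  by exists s', t'; split=> //; rewrite et tu mulrC mul_polyC size_scale.
Qed.

Hypothesis prim : forall c : R, prime_elt c -> c != 0 -> ~ divides c%:P p.

(** A prime of [r] cannot divide the primitive [p], so it is cancelled from [t]: divisibility by [p]
    over the fraction field implies divisibility over [R]. *)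
Lemma primitive_cancel (r : R) s t : prime_product r ->
  r%:P * s = p * t -> exists u, s = p * u.
Proof.
move=> pr; elim: pr s t => {r} [r ru|c r cp c0 _ IH] s t rs.
  by exists (r^-1%:P * t); rewrite mulrCA -rs mulrA -polyCM mulVr ?mul1r.
have [|/(prim cp c0) //|[u tu]] := (prime_polyC cp).2 p t.
  by exists (r%:P * s); rewrite -rs polyCM; ring.
apply: (IH _ u); have cP0 : c%:P != 0 by rewrite polyC_eq0.
by apply: (mulfI cP0); rewrite mulrA -polyCM rs tu; ring.
Qed.

End Primitive.

(* Pseudo-divisibility over [R] is divisibility over its fraction field. *)
Lemma irred_poly_prime p : irred p -> prime_elt p.
Proof.
move=> pI; have [p0 pu pF] := pI.
have [p1|p1] := leqP (size p) 1.
  rewrite (size1_polyC p1) in pI *.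
  exact: prime_polyC (irred_prime fR (irred_polyC pI)).
have prim (c : R) : prime_elt c -> c != 0 -> ~ divides c%:P p.
  move=> [cu _] c0 [q pE].
  have [qu|] := pF q c%:P pE.
  - by move: qu p1; rewrite pE poly_unitE => /andP[/eqP q1 _];
    rewrite mulrC mul_polyC size_scale // q1.
  - by rewrite poly_unitE coefC (negPf cu) andbF.
split=> // a b [c abE].
have fP (r : R) : r != 0 -> prime_product r by exact: fR.
have [/dvdpP[[r q] /= r0 raE]|npa] := boolP (p %| a).
  left; have [|u ->] := @primitive_cancel p prim r a q (fP _ r0).
    by rewrite mul_polyC raE mulrC.
  by exists u; rewrite mulrC.
(* The gcd over the fraction field yields a factorization of [p] over [R]. Since [p] is irreducible
   and does not divide [a], the gcd is constant. *)
right; have cop : coprimep p a.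
  have /dvdpP[[r q] /= r0 rpE] := dvdp_gcdl p a.
  have [|s [t [pE ss st]]] := @factor_clear_denominator p r q (gcdp p a) (fP _ r0).
    by rewrite mul_polyC.
  rewrite /coprimep -st.
  have [su|] := pF s t pE; last by rewrite poly_unitE => /andP[].
  case/negP: npa; move: su; rewrite poly_unitE ss => /andP[/eqP q1 _].
  apply: dvdp_trans (dvdp_gcdr p a).
  have /size1_polyC qE : (size q <= 1)%N by rewrite q1.
  apply/dvdpP; exists (q`_0, r%:P) => /=.
    by apply: contra_eq_neq q1 => q0; rewrite qE q0 polyC0 size_poly0.
  by rewrite mul_polyC rpE -mul_polyC -qE.
(* Bezout: a nonzero constant [c2] is a combination of [p] and [a]. Multiplied by [b] it becomes
   divisible by [p], and [c2] is cancelled by primitivity. *)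
have /Bezout_coprimepP[[u v] /= /eqpP[[c1 c2] /= /andP[c10 c20] e]] := cop.
have [|w ->] := @primitive_cancel p prim c2 b (c1 *: u * b + c1 *: (v * c)) (fP _ c20).
  move: e; rewrite alg_polyC => <-; rewrite -!mul_polyC mulrDr mulrDl.
  rewrite -[X in _ + X]mulrA -[v * a * b]mulrA abE; ring.
by exists w; rewrite mulrC.
Qed.

End PolyFactorial.

(** * Factoriality in several variables *)

Section MpolyFactorial.
Variable K : fieldType.

Definition of_muni n (p : {poly {mpoly K[n]}}) : {mpoly K[n.+1]} :=
  (map_poly (@mwiden n K) p).['X_ord_max].

Lemma of_muniM n : {morph @of_muni n : p q / p * q}.
Proof. by move=> p q; rewrite /of_muni rmorphM hornerM. Qed.

Lemma of_muniD n : {morph @of_muni n : p q / p + q}.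
Proof. by move=> p q; rewrite /of_muni rmorphD hornerD. Qed.

Lemma of_muni1 n : @of_muni n 1 = 1.
Proof. by rewrite /of_muni rmorph1 hornerC. Qed.

Lemma of_muni0 n : @of_muni n 0 = 0.
Proof. by rewrite /of_muni rmorph0 horner0. Qed.

Lemma muniX n (m : 'X_{1..n.+1}) : muni ('X_[m] : {mpoly K[n.+1]}) =
  'X_[[multinom m (widen_ord (leqnSn n) i) | i < n]] *: 'X^(m ord_max).
Proof. by rewrite muniE msuppX big_seq1 mcoeffX eqxx scale1r. Qed.

Lemma of_muniK n : cancel (@muni n K) (@of_muni n).
Proof.
elim/mpolyind=> [|c m p _ _ IH]; first by rewrite muni0 of_muni0.
rewrite muniD of_muniD; congr (_ + _); last exact: IH.
rewrite muniZ muniX.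
rewrite /of_muni -!mul_polyC !rmorphM /= !map_polyC /= map_polyXn.
rewrite !hornerM !hornerC hornerXn mwidenC mwidenX mul_mpolyC; congr (_ *: _).
rewrite mpolyXn -mpolyXD; congr 'X_[_]; apply/mnmP => i.
rewrite mnmDE mulmnE mnm1E.
case: (unliftP ord_max i) => [j|] ->.
  have -> : lift ord_max j = widen_ord (leqnSn n) j.
    by apply: val_inj; rewrite /= /bump leqNgt ltn_ord.
  by rewrite mnmwiden_widen mnmE -val_eqE /= gtn_eqF ?ltn_ord // addn0.
by rewrite mnmwiden_ordmax eqxx mul1n.
Qed.

Lemma muni_inj n : injective (@muni n K).
Proof. exact: can_inj (@of_muniK n). Qed.

Lemma muni_mwiden n (p : {mpoly K[n]}) : muni (mwiden p) = p%:P.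
Proof.
elim/mpolyind: p => [|c m p _ _ IH]; first by rewrite mwiden0 muni0 polyC0.
rewrite mwidenD muniD IH mwidenZ muniZ mwidenX muniX polyCD; congr (_ + _).
rewrite mnmwiden_ordmax expr0 -!mul_polyC mulr1 -polyCM mul_mpolyC; congr (_ *: 'X_[_])%:P.
by apply/mnmP => i; rewrite mnmE mnmwiden_widen.
Qed.

Lemma muniK n : cancel (@of_muni n) (@muni n K).
Proof.
elim/poly_ind=> [|p c IH]; first by rewrite of_muni0 muni0.
rewrite of_muniD of_muniM muniD muniM IH; congr (_ * _ + _).
  rewrite /of_muni map_polyX hornerX muniX mnm1E eqxx expr1.
  rewrite (_ : [multinom _ | _ < _] = 0%MM) ?mpolyX0 ?scale1r //.
  by apply/mnmP => i; rewrite mnmE mnm0E mnm1E -val_eqE /= gtn_eqF ?ltn_ord.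
by rewrite /of_muni map_polyC hornerC muni_mwiden.
Qed.

Lemma meval_muni n (p : {mpoly K[n.+1]}) (v : 'I_n.+1 -> K) :
  p.@[v] = (map_poly (meval (v \o widen_ord (leqnSn n))) (muni p)).[v ord_max].
Proof.
elim/mpolyind: p => [|c m p _ _ IH].
  by rewrite meval0 muni0 rmorph0 horner0.
rewrite mevalD muniD rmorphD hornerD IH; congr (_ + _).
rewrite muniZ muniX -!mul_polyC !rmorphM /= !map_polyC /= map_polyXn.
rewrite !hornerM !hornerC hornerXn mevalC mevalZ !mevalX; congr (_ * _).
rewrite big_ord_recr /=; congr (_ * _).
by apply: eq_bigr => i _; rewrite mnmE.
Qed.

Lemma muni_unit n (p : {mpoly K[n.+1]}) :
  (p \is a GRing.unit) = (muni p \is a GRing.unit).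
Proof.
apply/idP/idP => [pu|pu]; first exact: rmorph_unit.
apply/unitrPr; exists (of_muni (muni p)^-1).
by rewrite -{1}(of_muniK p) -of_muniM divrr // of_muni1.
Qed.

Lemma muni_prime n (p : {mpoly K[n.+1]}) : prime_elt p <-> prime_elt (muni p).
Proof.
have dvdE (a b : {mpoly K[n.+1]}) : divides a b <-> divides (muni a) (muni b).
  split=> [[c ->]|[c e]]; first by exists (muni c); rewrite muniM.
  by exists (of_muni c); apply: muni_inj; rewrite muniM muniK.
split=> -[pu pP]; split.
- by rewrite -muni_unit.
- move=> a b; rewrite -(muniK a) -(muniK b) -muniM => /dvdE/pP.
  by case=> /dvdE; [left|right].
- by rewrite muni_unit.
- by move=> a b /dvdE; rewrite muniM => /pP [] /dvdE; [left|right].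
Qed.

Lemma muni_irred n (p : {mpoly K[n.+1]}) : irred p -> irred (muni p).
Proof.
move=> [p0 pu pI]; split; first by rewrite -(muni0 n K) (inj_eq (@muni_inj n)).
  by rewrite -muni_unit.
move=> a b e; have := pI (of_muni a) (of_muni b).
by rewrite -of_muniM -e of_muniK !muni_unit !muniK; apply.
Qed.

Lemma mpoly_unitP n (p : {mpoly K[n]}) : (p \is a GRing.unit) = (msize p == 1%N).
Proof.
apply/idP/idP => [/andP[/eqP -> cu]|/msize_poly1P[c c0 ->]].
  by move: cu; rewrite mpolyCK unitfE msizeC => ->.
apply/andP; split; rewrite ?mpolyCK ?eqxx //=; last by rewrite unitfE.
Qed.

(** Induction on [msize]: both factors of a proper factorization have positive degree, hence are
    smaller than the product. *)
Lemma mpoly_factor_irred n (P : {mpoly K[n]} -> Prop) :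
  (forall u, u \is a GRing.unit -> P u) -> (forall p, irred p -> P p) ->
  (forall p q, p != 0 -> q != 0 -> P p -> P q -> P (p * q)) ->
  forall p, p != 0 -> P p.
Proof.
move=> Pu Pi PM p; have [k] := ubnP (msize p); elim: k p => // k IH p pk p0.
have [pu|pu] := boolP (p \is a GRing.unit); first exact: Pu.
have [[a [b [e au bu]]]|nab] := pselect (exists a b, [/\ p = a * b,
    a \isn't a GRing.unit & b \isn't a GRing.unit]).
  move: p0; rewrite e mulf_eq0 negb_or => /andP[a0 b0].
  move: pk; rewrite e msizeM // => pk.
  move: au bu; rewrite !mpoly_unitP -msize_poly_eq0 in a0 *.
  rewrite -msize_poly_eq0 in b0 => au bu.
  apply: PM; rewrite -?msize_poly_eq0 //; apply: IH; rewrite -?msize_poly_eq0 //;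
    move: pk a0 b0 au bu; move: (mmeasure _ a) (mmeasure _ b) => x y; lia.
apply: Pi; split=> // a b e.
have [au|au] := boolP (a \is a GRing.unit); first by left.
have [bu|bu] := boolP (b \is a GRing.unit); first by right.
by case: nab; exists a, b.
Qed.

Lemma mpoly_factorial n : factorial_ring {mpoly K[n]}.
Proof.
elim: n => [|n IH] p p0.
  apply: prime_product_unit; rewrite mpoly_unitP (nvar0_mpolyC p) msizeC.
  by move: p0; rewrite (nvar0_mpolyC p) mpolyC_eq0 mpolyCK => ->.
apply: mpoly_factor_irred p0 => [u uu|q qI|q r _ _]; last exact: prime_productM.
  exact: prime_product_unit.
have [q0 _ _] := qI; rewrite -[q]mulr1; apply: prime_product_mul => //.
  exact/muni_prime/(irred_poly_prime IH)/muni_irred.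
exact/prime_product_unit/unitr1.
Qed.

End MpolyFactorial.

(** * Coprime families and lowest terms *)

Section Coprimality.
Variable R : idomainType.

Lemma prime_elt0 : prime_elt (0 : R).
Proof.
split=> [|a b [c /eqP]]; first by rewrite unitr0.
by rewrite mulr0 mulf_eq0 => /orP[] /eqP ->; [left|right]; exists 0; rewrite mulr0.
Qed.

Lemma prime_elt_divides_prime (p q : R) : prime_elt p -> p != 0 -> prime_elt q ->
  divides q p -> divides p q.
Proof.
move=> [pu pP] p0 [qu _] [c e]; have [|pc|//] := pP c q.
  by rewrite -e; exists 1; rewrite mul1r.
case: pc => d cE; case/negP: qu; apply/unitrPr; exists d; apply: (mulfI p0).
by rewrite mulr1 {2}e cE; ring.
Qed.

Lemma divides_trans (a b c : R) : divides a b -> divides b c -> divides a c.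
Proof. by move=> [x ->] [y ->]; exists (y * x); rewrite mulrA. Qed.

(** Each prime of [c] misses some [A k], hence divides [s]; it is cancelled from [c] and from
    [s]. *)
Lemma prime_product_gauss I (A : I -> R) (c s : R) : prime_product c ->
  (forall q, prime_elt q -> q != 0 -> divides q c -> ~ forall k, divides q (A k)) ->
  (forall k, divides c (s * A k)) -> divides c s.
Proof.
move=> cP; elim: cP s => {c} [u uu|p c pp p0 cP IH] s cop dv.
  by exists (s / u); rewrite divrK.
have [q sE] : divides p s.
  have := cop p pp p0 (divides_mulr _ (ex_intro _ 1 (esym (mul1r _)))).
  move=> /existsNP[k npk]; have [|//|/npk//] := pp.2 s (A k).
  by apply: divides_trans (dv k); exists c; rewrite mulrC.
have [||r qE] := IH q.
- by move=> t tp t0 tc; apply: cop => //; exact: divides_mull.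
- move=> k; have [d e] := dv k; exists d; apply: (mulfI p0).
  by rewrite mulrA [p * q]mulrC -sE e; ring.
- by exists r; rewrite sE qE; ring.
Qed.

(** By proportionality [A k0] divides [p k0 * A k] for every [k]; as the [A k] have no common prime,
    it divides [p k0], and the quotient is the factor for all [k]. *)
Lemma proportional_multiple I (A p : I -> R) : factorial_ring R ->
  (exists k, A k != 0) ->
  (forall q, prime_elt q -> q != 0 -> ~ forall k, divides q (A k)) ->
  (forall j k, p j * A k = p k * A j) -> exists g, forall k, p k = g * A k.
Proof.
move=> fR [k0 A0] cop pA.
have [||g e] := @prime_product_gauss I A (A k0) (p k0) (fR _ A0).
- by move=> q qp q0 _; exact: cop.
- by move=> k; exists (p k); rewrite pA.
by exists g => k; apply: (mulIf A0); rewrite pA e; ring.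
Qed.

Definition coprime_elts (p q : R) : Prop :=
  forall t, prime_elt t -> t != 0 -> divides t p -> ~ divides t q.

Lemma lowest_terms (p q : R) : prime_product q ->
  exists r p' q', [/\ p = r * p', q = r * q' & coprime_elts p' q'].
Proof.
move=> qP; elim: qP p => {q} [u uu|t q tp t0 _ IH] p.
  exists 1, p, u; rewrite !mul1r; split=> // t [tu _] t0 _ [c e].
  by move: uu; rewrite e unitrM (negPf tu) andbF.
have [[p1 pE]|ntp] := pselect (divides t p).
  have [r [p' [q' [e1 e2 cop]]]] := IH p1.
  by exists (t * r), p', q'; split=> //; rewrite ?pE ?e1 ?e2; ring.
have [r [p' [q' [e1 e2 cop]]]] := IH p.
exists r, p', (t * q'); split=> //; first by rewrite e2; ring.
move=> w wp w0 wp' /wp.2[wt|]; last exact: cop.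
apply: ntp; rewrite e1; apply/divides_mull/(divides_trans _ wp').
exact: prime_elt_divides_prime.
Qed.

Lemma coprime_divides (p q s : R) : factorial_ring R -> q != 0 ->
  coprime_elts p q -> divides q (s * p) -> divides q s.
Proof.
move=> fR q0 cop qsp; apply: (@prime_product_gauss unit (fun _ => p)) => //.
  exact: fR.
by move=> t tp t0 tq /(_ tt) tp'; exact: (cop t).
Qed.

End Coprimality.

Lemma mpoly_ring_ind n (R : nzRingType) (P : {mpoly R[n]} -> Prop) :
  (forall c, P c%:MP) -> (forall i, P 'X_i) ->
  (forall p q, P p -> P q -> P (p + q)) -> (forall p q, P p -> P q -> P (p * q)) ->
  forall p, P p.
Proof.
move=> PC PX PD PM; elim/mpolyind=> [|c m p _ _ Pp]; first exact: PC 0.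
apply: (PD _ _ _ Pp); rewrite -mul_mpolyC; apply: (PM _ _ (PC c)).
rewrite mpolyXE_id; elim/big_rec: _ => [|i q _ Pq]; first exact: PC 1.
apply: (PM _ _ _ Pq); elim: (m i) => [|k IH]; first exact: PC 1.
by rewrite exprS; apply: (PM).
Qed.

Lemma mpolyXi_neq0 n (R : nzRingType) (i : 'I_n) : 'X_i != 0 :> {mpoly R[n]}.
Proof. by rewrite -msize_poly_eq0 msizeX mdeg1. Qed.

(** * Factors and components of homogeneous polynomials *)

Section Homogeneous.
Variables (n : nat) (R : idomainType).
Implicit Types p q : {mpoly R[n]}.

Lemma mcoeff_mlastM p q :
  (p * q)@_(mlast p + mlast q) = p@_(mlast p) * q@_(mlast q).
Proof.
have supp0 r : r = 0 -> r@_(mlast r) = 0 by move=> ->; rewrite mcoeff0.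
have [p0|p0] := eqVneq p 0; first by rewrite supp0 // p0 !mul0r mcoeff0.
have [q0|q0] := eqVneq q 0; first by rewrite [q@__]supp0 // q0 !mulr0 mcoeff0.
rewrite mpolyME (bigD1_seq (mlast p, mlast q)) /=; first last.
+ by rewrite allpairs_uniq // => -[? ?] [].
+ by rewrite allpairs_f // !mlast_supp.
rewrite mcoeffD mcoeffZ mcoeffX eqxx mulr1 big_seq_cond raddf_sum /= big1 ?addr0 //.
case=> m1 m2; case/andP=> /allpairsP[[x1 x2] /= [/mlast_lemc + /mlast_lemc + [-> ->]]] {m1 m2}.
rewrite mcoeffZ mcoeffX le_eqVlt => /predU1P[<-|l1] l2; last first.
  by rewrite (gt_eqF (ltmc_le_add l1 l2)) ?mulr0.
rewrite xpair_eqE eqxx /= eqm_add2l => /negPf ->; exact: mulr0.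
Qed.

(** The monomial order refines the degree. The degrees of the leading and of the last monomial are
    both additive; for the product they coincide, so they coincide for each factor. *)
Lemma dhomog_factor d p q : p * q != 0 -> p * q \is d.-homog ->
  exists e, p \is e.-homog.
Proof.
move=> pq0 /dhomogP pqd; have := pq0; rewrite mulf_eq0 negb_or => /andP[p0 q0].
have e1 : (mdeg (mlead p) + mdeg (mlead q) = d)%N.
  by rewrite -mdegD -mleadM //; apply/pqd/mlead_supp.
have e2 : (mdeg (mlast p) + mdeg (mlast q) = d)%N.
  rewrite -mdegD; apply: pqd; rewrite mcoeff_msupp mcoeff_mlastM mulf_neq0 //.
    by rewrite -mcoeff_msupp mlast_supp.
  by rewrite -mcoeff_msupp mlast_supp.
have h (r : {mpoly R[n]}) m : m \in msupp r -> (mdeg (mlast r) <= mdeg m <= mdeg (mlead r))%N.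
  by move=> mr; rewrite !lemc_mdeg ?mlast_lemc ?msupp_le_mlead.
exists (mdeg (mlead p)); apply/dhomogP => m /h/andP[l1 l2].
apply/eqP; rewrite eqn_leq l2; apply: leq_trans l1.
have /andP[_] := h _ _ (mlead_supp q0).
have /andP[] := h _ _ (mlast_supp q0).
by move: e1 e2; clear; lia.
Qed.

(** Lets the quotients found by division be replaced by their homogeneous components. *)
Lemma pihomogM1 d p q : p \is 1.-homog ->
  pihomog mdeg d.+1 (p * q) = p * pihomog mdeg d q.
Proof.
move=> p1; rewrite {1}(pihomog_partitionE (leqnn (msize q))) mulr_sumr raddf_sum /=.
have hE (i : nat) : pihomog mdeg d.+1 (p * pihomog mdeg i q) =
    if i == d then p * pihomog mdeg i q else 0.
  have pi1 : p * pihomog mdeg i q \is (1 + i).-homog by apply/dhomogM/pihomogP.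
  case: eqP => [<-|/eqP di]; first by rewrite pihomog_dE.
  by rewrite (pihomog_ne0 _ pi1) // eqSS.
under eq_bigr do rewrite hE.
have [dq|dq] := ltnP d (msize q).
  by rewrite -big_mkcond (big_pred1 (Ordinal dq)) => [|i]; rewrite -?val_eqE.
rewrite big1 => [|i _]; last first.
  by rewrite ltn_eqF // (leq_trans (ltn_ord i)).
have -> : pihomog mdeg d q = 0; last by rewrite mulr0.
rewrite pihomogE big_seq_cond big_pred0 // => m; apply/negP => /andP[/msize_mdeg_lt].
by move=> mq /eqP md; move: mq; rewrite md ltnNge dq.
Qed.

End Homogeneous.

(** * Zeros of prime polynomials *)

Section Nullstellensatz.
Import Pdiv.Idomain.
Variable K : closedFieldType.

Lemma exists_nonroot (p : {poly K}) : p != 0 -> exists t, p.[t] != 0.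
Proof.
move=> p0; have [p1|p1] := leqP (size p) 1.
  exists 0; move: p0; rewrite (size1_polyC p1) hornerC.
  by apply: contraNneq => ->; rewrite polyC0.
have /closed_rootP[t] : size (p - 1) != 1%N.
  by rewrite size_polyDl ?gtn_eqF // size_polyN size_poly1.
rewrite /root hornerD hornerN hornerC subr_eq0 => /eqP pt.
by exists t; rewrite pt oner_neq0.
Qed.

Definition extend_point n (v : 'I_n -> K) (t : K) (i : 'I_n.+1) : K :=
  if unlift ord_max i is Some j then v j else t.

Lemma meval_extend n (v : 'I_n -> K) t (p : {mpoly K[n.+1]}) :
  p.@[extend_point v t] = (map_poly (meval v) (muni p)).[t].
Proof.
rewrite meval_muni /extend_point unlift_none; congr horner.
apply: eq_map_poly => q; apply: meval_eq => i /=.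
have -> : widen_ord (leqnSn n) i = lift ord_max i.
  by apply: val_inj; rewrite /= /bump leqNgt ltn_ord.
by rewrite liftK.
Qed.

(* With [h = 0] this says that a nonzero polynomial has a nonzero value. *)
Lemma prime_nullstellensatz n (h g : {mpoly K[n]}) :
  prime_elt h -> ~ divides h g -> exists v : 'I_n -> K, h.@[v] = 0 /\ g.@[v] != 0.
Proof.
elim: n h g => [|n IH] h g.
  move=> [hu _] nhg; exists (fun=> 0).
  have h0 : h = 0.
    apply: contraNeq hu; rewrite mpoly_unitP (nvar0_mpolyC h) mpolyC_eq0 => h0.
    by rewrite msizeC h0.
  rewrite h0 meval0 (nvar0_mpolyC g) mevalC; split=> //.
  apply: contra_not_neq nhg => g0.
  by exists 0; rewrite (nvar0_mpolyC g) g0 mul0r.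
move=> /muni_prime hp nhg.
have {nhg} : ~ divides (muni h) (muni g).
  by apply: contra_not nhg => -[c e]; exists (of_muni c); apply: muni_inj;
    rewrite muniM muniK.
suff H h' g' : prime_elt h' -> ~ divides h' g' -> exists (v : 'I_n -> K) t,
    (map_poly (meval v) h').[t] = 0 /\ (map_poly (meval v) g').[t] != 0.
  by move=> /(H _ _ hp)[v [t e]]; exists (extend_point v t); rewrite !meval_extend.
(* If [h'] is constant in the last variable, it fails to divide some coefficient of [g']. The
   induction hypothesis makes this coefficient nonzero at a zero of [h'], and the last coordinate
   then avoids the roots of the specialised [g']. *)
move=> {h g hp} hp nhg; have [hu hP] := hp; have [h1|h1] := leqP (size h') 1.
  move: hp nhg; rewrite (size1_polyC h1); set c := h'`_0 => -[cu cP] nhg.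
  have [i ni] : exists i, ~ divides c g'`_i.
    by apply/existsNP => dc; apply/nhg/divides_polyC.
  have cp : prime_elt c.
    split; first by apply: contra cu => cu; exact: rmorph_unit.
    have dC a : divides c%:P a%:P -> divides c a.
      by move/divides_polyC/(_ 0%N); rewrite coefC.
    move=> a b [d ab]; have [|/dC|/dC] := cP a%:P b%:P; [|by left|by right].
    by exists d%:P; rewrite -!polyCM ab.
  have [v [cv gv]] := IH _ _ cp ni.
  have [|t gt] := @exists_nonroot (map_poly (meval v) g').
    by apply: contraNneq gv => g0; rewrite -(coef_map (meval v)) g0 coef0.
  by exists v, t; rewrite map_polyC /= hornerC.
have h0 : h' != 0 by rewrite -size_poly_gt0 (ltn_trans _ h1).
have cst (r : {mpoly K[n]}) a : r != 0 -> ~ divides h' a -> ~ divides h' (r *: a).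
  move=> r0 nha; rewrite -mul_polyC => /hP[|//] [c e].
  have c0 : c != 0 by apply: contraNneq r0 => c0; rewrite -polyC_eq0 e c0 mul0r.
  have := congr1 (fun p : {poly _} => size p) e; rewrite size_polyC r0 size_mul //.
  by move: h1; rewrite -size_poly_gt0 in c0; move: c0; clear; lia.
(* [h'] is prime of positive degree in the last variable, so a common factor over the fraction field
   would make [h'] divide [g']. *)
have cop : coprimep h' g'.
  have /dvdpP[[r q] /= r0 hE] := dvdp_gcdl h' g'.
  have [|[c qE]|[c gE]] := hP q (gcdp h' g').
  - by exists r%:P; rewrite mul_polyC.
  - have : r%:P = c * gcdp h' g'.
      by apply: (mulIf h0); rewrite mul_polyC hE qE; ring.
    move=> /(congr1 (fun p : {poly _} => size p)).
    have gn0 : gcdp h' g' != 0 by rewrite gcdp_eq0 (negPf h0).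
    have [c0|c0] := eqVneq c 0.
      move/eqP: hE; rewrite qE c0 !mul0r -mul_polyC mulf_eq0 polyC_eq0.
      by rewrite (negPf r0) (negPf h0).
    rewrite size_polyC r0 size_mul // /coprimep; rewrite -!size_poly_gt0 in c0 gn0.
    by move: c0 gn0; clear; lia.
  - have /dvdpP[[r' q'] /= r0' e] := dvdp_gcdr h' g'.
    by case: (cst _ _ r0' nhg); rewrite e gE; exists (q' * c); rewrite mulrA.
have /Bezout_coprimepP[[u w] /= /eqpP[[c1 c2] /= /andP[c10 c20] e]] := cop.
(* The prime 0 turns the induction hypothesis into the existence of a point where the Bezout
   constant [c2] and the leading coefficient of [h'] do not vanish. There [h'] keeps a root in the
   last variable, and [g'] is nonzero at that root. *)
have [||v [_ +]] := IH 0 (c2 * lead_coef h'); first exact: prime_elt0.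
  move=> [c /eqP]; rewrite mulr0 mulf_eq0 (negPf c20) lead_coef_eq0 (negPf h0) //.
rewrite mevalM mulf_eq0 negb_or => /andP[c2v hv].
have /closed_rootP[t /rootP ht] : size (map_poly (meval v) h') != 1%N.
  by rewrite size_map_poly_id0 // gtn_eqF.
exists v, t; split=> //.
apply: contraNneq c2v => gt; move: (congr1 (fun p => (map_poly (meval v) p).[t]) e).
rewrite -!mul_polyC !rmorphM rmorphD !rmorphM /= !map_polyC !hornerE /= ht gt.
by rewrite meval1 mulr1 !mulr0 addr0 mulr0 => <-.
Qed.

Lemma meval_neq0 n (g : {mpoly K[n]}) : g != 0 -> exists v, g.@[v] != 0.
Proof.
move=> g0; have [|v [_ gv]] := @prime_nullstellensatz n 0 g (prime_elt0 _).
  by move=> [c /eqP]; rewrite mulr0 (negPf g0).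
by exists v.
Qed.

(** A non-unit that divides a variable is a constant multiple of it, and two different variables are
    not proportional. *)
Lemma prime_not_divides_var n (h : {mpoly K[n]}) (i j : 'I_n) :
  prime_elt h -> i != j -> divides h 'X_i -> ~ divides h 'X_j.
Proof.
move=> [hu hP] ij [c0 e0] [c1 e1].
have cC k (c : {mpoly K[n]}) : 'X_k = c * h -> exists2 a, a != 0 & c = a%:MP.
  move=> e; apply/msize_poly1P; have := mpolyXi_neq0 K k.
  rewrite e mulf_eq0 negb_or => /andP[c_0 h_0].
  have := congr1 (fun p : {mpoly _[_]} => msize p) e; rewrite msizeM // msizeX mdeg1.
  move: hu c_0 h_0; rewrite mpoly_unitP -!msize_poly_eq0.
  by move: (msize _) (msize _); clear; lia.
have [[a0 a00 E0] [a1 a10 E1]] := (cC _ _ e0, cC _ _ e1).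
have : a1 *: 'X_i = a0 *: 'X_j :> {mpoly K[n]}.
  by rewrite e0 e1 E0 E1 -!mul_mpolyC; ring.
move=> /(congr1 (mcoeff U_(i))); rewrite !mcoeffZ !mcoeffXU eqxx mulr1.
by rewrite eq_sym (negPf ij) mulr0 => /eqP; rewrite (negPf a10).
Qed.

(** A hypersurface is not contained in the codimension two locus where both variables vanish; this
    yields extension across that locus. *)
Lemma nullstellensatz_var n (h : {mpoly K[n]}) (i j : 'I_n) :
  prime_elt h -> i != j ->
  exists v : 'I_n -> K, h.@[v] = 0 /\ (v i != 0 \/ v j != 0).
Proof.
move=> hp ij; have [hi|ni] := pselect (divides h 'X_i).
  have [v [hv]] := prime_nullstellensatz hp (prime_not_divides_var hp ij hi).
  by rewrite mevalXU; exists v; split=> //; right.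
have [v [hv]] := prime_nullstellensatz hp ni.
by rewrite mevalXU; exists v; split=> //; left.
Qed.

(** An extra factor ['X_i] that [h] does not divide keeps the zero away from the origin; of two
    variables at least one will do. *)
Lemma homog_nullstellensatz n (h g : {mpoly K[n.+2]}) :
  prime_elt h -> ~ divides h g ->
  exists v : 'I_n.+2 -> K, [/\ exists i, v i != 0, h.@[v] = 0 & g.@[v] != 0].
Proof.
move=> hp nhg; have [i ni] : exists i, ~ divides h 'X_i.
  have [h0|n0] := pselect (divides h 'X_ord0); last by exists ord0.
  by exists ord_max; apply: prime_not_divides_var h0.
have [|v [hv]] := @prime_nullstellensatz _ h (g * 'X_i) hp; first by move=> /hp.2[].
rewrite mevalM mevalXU mulf_eq0 negb_or => /andP[gv vi].
by exists v; split=> //; exists i.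
Qed.

End Nullstellensatz.

(** * Koszul relations *)

Section CrossProduct.
Variable R : comPzRingType.
Implicit Types a b w y : 'I_3 -> R.

Definition cross a b (j : 'I_3) : R :=
  a (ordS j) * b (ordS (ordS j)) - a (ordS (ordS j)) * b (ordS j).

Lemma ord3P (P : 'I_3 -> Prop) :
  P (@Ordinal 3 0 isT) -> P (@Ordinal 3 1 isT) -> P (@Ordinal 3 2 isT) -> forall j, P j.
Proof. by move=> P0 P1 P2 [[|[|[|//]]] j]; rewrite (bool_irrelevance j isT). Qed.

Lemma ordS3 :
  (ordS (@Ordinal 3 0 isT) = @Ordinal 3 1 isT) *
  (ordS (@Ordinal 3 1 isT) = @Ordinal 3 2 isT) *
  (ordS (@Ordinal 3 2 isT) = @Ordinal 3 0 isT).
Proof. by do !split; apply: val_inj. Qed.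

Lemma sum_ord3 (V : nmodType) (F : 'I_3 -> V) : \sum_j F j =
  F (@Ordinal 3 0 isT) + F (@Ordinal 3 1 isT) + F (@Ordinal 3 2 isT).
Proof.
rewrite !big_ord_recl big_ord0 addr0 addrA.
by do ![congr (_ + _)]; congr F; apply: val_inj.
Qed.

Lemma dot_cross a b : \sum_j b j * cross a b j = 0.
Proof. rewrite sum_ord3 /cross !ordS3; ring. Qed.

Lemma cross_comb a b (x z : R) : (forall j, x * a j + z * b j = 0) ->
  forall j, z * cross a b j = 0 /\ x * cross a b j = 0.
Proof.
move=> h j; split.
  transitivity (a (ordS j) * (x * a (ordS (ordS j)) + z * b (ordS (ordS j)))
    - a (ordS (ordS j)) * (x * a (ordS j) + z * b (ordS j))).
    by rewrite /cross; ring.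
  by rewrite !h !mulr0 subrr.
transitivity (b (ordS (ordS j)) * (x * a (ordS j) + z * b (ordS j))
    - b (ordS j) * (x * a (ordS (ordS j)) + z * b (ordS (ordS j)))).
  by rewrite /cross; ring.
by rewrite !h !mulr0 subrr.
Qed.

Section Orthogonal.
Variables a b w : 'I_3 -> R.
Hypothesis wab : \sum_j w j * cross a b j = 0.

Let vanish (x y z : R) : x = y + z * \sum_j w j * cross a b j -> x = y.
Proof. by rewrite wab mulr0 addr0. Qed.

(** The vector product of [a x w] and [a x b] is, up to sign, [a] times the determinant of [a], [w],
    [b], which is zero by [wab]; hence the witnesses [z] are coordinates of [a] up to sign. *)
Lemma cross_orthl j k : cross a w j * cross a b k = cross a w k * cross a b j.
Proof.
elim/ord3P: j; elim/ord3P: k => //.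
- by apply: (vanish (z := - a (@Ordinal 3 2 isT))); rewrite sum_ord3 /cross !ordS3; ring.
- by apply: (vanish (z := a (@Ordinal 3 1 isT))); rewrite sum_ord3 /cross !ordS3; ring.
- by apply: (vanish (z := a (@Ordinal 3 2 isT))); rewrite sum_ord3 /cross !ordS3; ring.
- by apply: (vanish (z := - a (@Ordinal 3 0 isT))); rewrite sum_ord3 /cross !ordS3; ring.
- by apply: (vanish (z := - a (@Ordinal 3 1 isT))); rewrite sum_ord3 /cross !ordS3; ring.
- by apply: (vanish (z := a (@Ordinal 3 0 isT))); rewrite sum_ord3 /cross !ordS3; ring.
Qed.

(** Cramer's rule for [w] in the plane of [a] and [b]. For [j != k] it is an identity; for [j = k]
    the two sides differ by the dot product that [wab] kills. *)
Lemma cross_decomp j k :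
  cross a b k * w j = cross w b k * a j + cross a w k * b j.
Proof.
elim/ord3P: k; elim/ord3P: j.
- by apply: (vanish (z := 1)); rewrite sum_ord3 /cross !ordS3; ring.
- by apply: (vanish (z := 0)); rewrite sum_ord3 /cross !ordS3; ring.
- by apply: (vanish (z := 0)); rewrite sum_ord3 /cross !ordS3; ring.
- by apply: (vanish (z := 0)); rewrite sum_ord3 /cross !ordS3; ring.
- by apply: (vanish (z := 1)); rewrite sum_ord3 /cross !ordS3; ring.
- by apply: (vanish (z := 0)); rewrite sum_ord3 /cross !ordS3; ring.
- by apply: (vanish (z := 0)); rewrite sum_ord3 /cross !ordS3; ring.
- by apply: (vanish (z := 0)); rewrite sum_ord3 /cross !ordS3; ring.
- by apply: (vanish (z := 1)); rewrite sum_ord3 /cross !ordS3; ring.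
Qed.

End Orthogonal.

Lemma cross_orthr a b w : \sum_j w j * cross a b j = 0 ->
  forall j k, cross w b j * cross a b k = cross w b k * cross a b j.
Proof.
have crossC x y j : cross x y j = - cross y x j by rewrite /cross; ring.
move=> wab j k; rewrite ![cross w b _]crossC ![cross a b _]crossC !mulrNN.
apply: cross_orthl; rewrite -[RHS]oppr0 -{}[in RHS]wab -sumrN; apply: eq_bigr => i _.
by rewrite [cross b a _]crossC mulrN.
Qed.

End CrossProduct.

Section Koszul.
Variable K : fieldType.
Variables (i0 : 'I_4) (c : 'I_3 -> K).

Definition lform (j : 'I_3) : {mpoly K[4]} := 'X_(lift i0 j) - c j *: 'X_i0.

(** The substitution of [c j] times [X_i0] for [X_(lift i0 j)], [j] in [S]: a retraction whose
    kernel is the ideal of these linear forms. *)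
Definition kill_lforms (S : pred 'I_3) : 4.-tuple {mpoly K[4]} :=
  [tuple if unlift i0 k is Some j then 'X_k - (if S j then lform j else 0) else 'X_k
    | k < 4].

Lemma homogX (i : 'I_4) : ('X_i : {mpoly K[4]}) \is 1.-homog.
Proof. by rewrite dhomogX /= mdeg1. Qed.

Lemma lform_homog j : lform j \is 1.-homog.
Proof. by rewrite rpredB // ?rpredZ ?homogX. Qed.

Lemma lform_neq0 j : lform j != 0.
Proof.
apply/eqP => /(congr1 (mcoeff U_(lift i0 j))); rewrite mcoeffB mcoeffZ !mcoeffXU.
by rewrite eqxx (negPf (neq_lift _ _)) mulr0 subr0 mcoeff0 => /eqP; rewrite oner_eq0.
Qed.

Lemma lform_kill S j : lform j \mPo kill_lforms S = if S j then 0 else lform j.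
Proof.
rewrite comp_mpolyB comp_mpolyZ !comp_mpolyXU -!tnth_nth !tnth_mktuple.
rewrite unlift_none liftK; case: ifP => _; last by rewrite subr0.
by rewrite /lform; ring.
Qed.

Lemma kill_lforms_ideal S p :
  exists q, p - (p \mPo kill_lforms S) = \sum_(j | S j) lform j * q j.
Proof.
elim/mpoly_ring_ind: p => [a|i|p q [p' pE] [q' qE]|p q [p' pE] [q' qE]].
- exists (fun=> 0); rewrite comp_mpolyC subrr big1 // => j _; exact: mulr0.
- rewrite comp_mpolyXU -tnth_nth tnth_mktuple.
  case: unliftP => [j ->|_]; last first.
    by exists (fun=> 0); rewrite subrr big1 // => j _; exact: mulr0.
  exists (fun k => (k == j)%:R).
  under eq_bigr do rewrite mulr_natr mulrb.
  rewrite -big_mkcondr; have [Sj|Sj] := boolP (S j).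
    by rewrite (big_pred1 j) => [|k]; rewrite ?subKr //= andbC; case: eqP => //= ->.
  by rewrite big_pred0 ?subr0 ?subrr // => k; case: eqP => [->|]; rewrite ?andbF ?andbT ?(negPf Sj).
- exists (fun j => p' j + q' j); rewrite comp_mpolyD opprD addrACA pE qE -big_split.
  by apply: eq_bigr => j _; rewrite mulrDr.
- exists (fun j => p' j * q + (p \mPo kill_lforms S) * q' j).
  rewrite rmorphM /=; transitivity ((p - (p \mPo kill_lforms S)) * q
    + (p \mPo kill_lforms S) * (q - (q \mPo kill_lforms S))); first by ring.
  rewrite pE qE mulr_suml mulr_sumr -big_split; apply: eq_bigr => j _ /=; ring.
Qed.

(** The substitution kills the forms in [S] and fixes [lform j], a nonzero element of a domain: the
    linear forms are a regular sequence in every order. *)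
Lemma lform_regular_seq (S : pred 'I_3) j p q : ~~ S j ->
  lform j * p = \sum_(k | S k) lform k * q k ->
  exists r, p = \sum_(k | S k) lform k * r k.
Proof.
move=> Sj e; have [r pE] := kill_lforms_ideal S p; exists r; rewrite -pE.
suff -> : p \mPo kill_lforms S = 0 by rewrite subr0.
have : lform j * p \mPo kill_lforms S = 0.
  rewrite e rmorph_sum big1 // => k Sk.
  by rewrite rmorphM /= lform_kill Sk mul0r.
rewrite rmorphM /= lform_kill (negPf Sj) => /eqP.
by rewrite mulf_eq0 (negPf (lform_neq0 j)) => /eqP.
Qed.

Lemma koszul m (A : 'I_3 -> {mpoly K[4]}) :
  (forall j, A j \is m.-homog) -> \sum_j lform j * A j = 0 ->
  (exists j, A j != 0) ->
  exists d B, [/\ m = d.+1, forall j, B j \is d.-homog & forall j, A j = cross lform B j].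
Proof.
move=> Am yA [j0 Aj0].
pose o0 := @Ordinal 3 0 isT; pose o1 := @Ordinal 3 1 isT; pose o2 := @Ordinal 3 2 isT.
have [P A0] : exists P, A o0 = \sum_(k | k != o0) lform k * P k.
  apply: (@lform_regular_seq (fun k => k != o0) o0 _ (fun k => - A k)) => //.
  apply/eqP; rewrite -subr_eq0 -sumrN -[X in _ == X]yA [X in _ == X](bigD1 o0) //=.
  by apply/eqP; congr (_ + _); apply: eq_bigr => k _; rewrite mulrN opprK.
rewrite big_mkcond sum_ord3 /= add0r -/o1 -/o2 in A0.
rewrite sum_ord3 -/o0 -/o1 -/o2 A0 in yA.
(* With [A o0] substituted, [yA] says that [lform o1] times [A o1 + lform o0 * P o1] plus [lform o2]
   times [A o2 + lform o0 * P o2] is zero. *)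
have [S' A2] : exists S', A o2 + lform o0 * P o2 = \sum_(k | k == o1) lform k * S' k.
  apply: (@lform_regular_seq (fun k => k == o1) o2 _
    (fun k => - (A k + lform o0 * P k))) => //.
  rewrite big_pred1_eq; apply/eqP; rewrite -subr_eq0 -yA; apply/eqP; ring.
rewrite big_pred1_eq in A2.
have A1 : A o1 + lform o0 * P o1 = - (lform o2 * S' o1).
  apply: (mulfI (lform_neq0 o1)); apply/eqP; rewrite -subr_eq0 -yA; apply/eqP.
  have -> : A o2 = lform o1 * S' o1 - lform o0 * P o2 by rewrite -A2 addrK.
  ring.
(* In degree zero the [A j] are constants in the ideal of the linear forms, hence vanish. This is
   what excludes distributions of degree -1. *)
case: m Am => [|d] Am.
  have y0 j : (lform j).@[fun=> 0] = 0.
    by rewrite mevalB mevalZ !mevalXU mulr0 subr0.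
  have A_eq0 j : (A j).@[fun=> 0] = 0 -> A j = 0.
    suff -> : A j = ((A j)@_0)%:MP by rewrite mevalC => ->.
    apply/mpolyP => w; rewrite mcoeffC; have [->|w0] := eqVneq w 0%MM; first by rewrite mulr1.
    by rewrite mulr0 (dhomog_nemf_coeff (Am j)) // mdeg_eq0.
  case/eqP: Aj0; apply: A_eq0; elim/ord3P: j0.
  - by rewrite -/o0 A0 mevalD !mevalM !y0 !mul0r addr0.
  - have /(congr1 (meval (fun=> 0))) := A1.
    by rewrite mevalD mevalN !mevalM !y0 !mul0r addr0 oppr0.
  - have /(congr1 (meval (fun=> 0))) := A2.
    by rewrite mevalD !mevalM !y0 !mul0r addr0.
(* Read off from the equations for the three [A j]. The quotients [S'] and [P] need not be
   homogeneous, but their parts of degree [d] satisfy the same equations. *)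
pose B j := pihomog mdeg d (if j == o0 then - S' o1 else if j == o1 then - P o2 else P o1).
exists d, B; split=> // [j|j]; first exact: pihomogP.
rewrite -(pihomog_dE (Am j)) /cross /B -!pihomogM1 ?lform_homog // -pihomogB.
congr (pihomog _ _ _); elim/ord3P: j {Aj0}; rewrite ?ordS3 /= -/o0 -/o1 -/o2.
- by rewrite A0; ring.
- by apply: (addIr (lform o0 * P o1)); rewrite A1; ring.
- by apply: (addIr (lform o0 * P o2)); rewrite A2; ring.
Qed.

End Koszul.

(** * Regular functions *)

Section Regular.
Variable K : closedFieldType.
Notation opens := (opens (proj3 K)).
Implicit Types U V W : opens.
Implicit Types p q f g : {mpoly K[4]}.

Definition line_of (v : 'rV[K]_4) (v0 : v != 0) : proj3 K :=
  exist _ <[v]>%VS (introT eqP (etrans (dim_vline v) (congr1 nat_of_bool v0))).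

Lemma mem_line_of v (v0 : v != 0) : v \in val (line_of v0).
Proof. exact: memv_line. Qed.

Lemma proj3_vector (L : proj3 K) : exists2 v, v != 0 & v \in val L.
Proof.
case: L => L /= /eqP L1; exists (vpick L); last exact: memv_pick.
by rewrite vpick0 -dimv_eq0 L1.
Qed.

Lemma cone_coord U (v : cone U) : exists i, sval v 0 i != 0.
Proof. by have [/rV0Pn] := svalP v. Qed.

Lemma opens_cone U (L : proj3 K) : oset U L -> exists v : cone U, sval v \in val L.
Proof.
move=> UL; have [v v0 vL] := proj3_vector L.
have P : v != 0 /\ exists2 L : proj3 K, oset U L & v \in val L by split=> //; exists L.
by exists (exist _ v P).
Qed.

Lemma cone_of U (v : 'rV[K]_4) (L : proj3 K) : v != 0 -> oset U L -> v \in val L ->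
  exists w : cone U, sval w = v.
Proof.
move=> v0 UL vL.
have P : v != 0 /\ exists2 L : proj3 K, oset U L & v \in val L by split=> //; exists L.
by exists (exist _ v P).
Qed.

Lemma cone_mem U (v : cone U) (L : proj3 K) : sval v \in val L -> oset U L.
Proof.
by move=> vL; have [v0 [M UM vM]] := svalP v; rewrite (proj3_inj v0 vL vM).
Qed.

Lemma cone_basis U (v : cone U) : exists f n, [/\ f \is n.-homog, f.@[sval v 0] != 0 &
  forall w : 'rV[K]_4, w != 0 -> f.@[w 0] != 0 -> exists w' : cone U, sval w' = w].
Proof.
have [v0 [L UL vL]] := svalP v; have [S Sh UE] := oset_open U.
have /zerosCP[f [u [Sf uL fu]]] : (~` zeros S) L by rewrite -UE.
have [n fn] := Sh _ Sf; have [c uE] := proj3_colinear v0 vL uL.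
exists f, n; split=> //.
  by move: fu; rewrite uE (homog_scale _ _ fn) mulf_eq0 negb_or => /andP[].
move=> w w0 fw; apply: (@cone_of U w (line_of w0)) => //; last exact: mem_line_of.
by rewrite UE; apply/zerosCP; exists f, w; split=> //; exact: mem_line_of.
Qed.

Lemma meval_row (v : 'I_4 -> K) p : p.@[(\row_i v i) 0] = p.@[v].
Proof. by apply: meval_eq => i; rewrite mxE. Qed.

Lemma row_neq0 (v : 'I_4 -> K) i : v i != 0 -> (\row_i v i : 'rV[K]_4) != 0.
Proof. by move=> vi; apply/rV0Pn; exists i; rewrite mxE. Qed.

Lemma cone_vanish U p : U !=set0 -> (forall v : cone U, p.@[sval v 0] = 0) -> p = 0.
Proof.
move=> [L /opens_cone[v _]] pU; have [f [n [fn fv fU]]] := cone_basis v.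
apply: contrapT => /eqP p0.
have f0 : f != 0 by apply: contraNneq fv => ->; rewrite meval0.
(* The factor [f] keeps the point inside [U], the factor ['X_ord0] away from the origin. *)
have [|w] := @meval_neq0 K 4 (p * f * 'X_ord0).
  by rewrite !mulf_neq0 // mpolyXi_neq0.
rewrite !mevalM mevalXU !mulf_eq0 !negb_or => /andP[/andP[pw fw] w0].
have [||w' w'E] := fU (\row_i w i); rewrite ?meval_row //; first exact: row_neq0 w0.
by have /eqP := pU w'; rewrite w'E meval_row (negPf pw).
Qed.

(** Projective space is irreducible because a product of nonzero polynomials has a nonzero value. *)
Lemma opensI_neq0 U V : U !=set0 -> V !=set0 -> opensI U V !=set0.
Proof.
move=> [L /opens_cone[v _]] [M /opens_cone[w _]].
have [f [n [fn fv fU]]] := cone_basis v; have [g [m [gm gw gV]]] := cone_basis w.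
have neq0 (h : {mpoly K[4]}) u : h.@[u] != 0 -> h != 0 by apply: contraNneq => ->; rewrite meval0.
have [|u] := @meval_neq0 K 4 (f * g * 'X_ord0).
  by rewrite !mulf_neq0 ?(neq0 _ _ fv) ?(neq0 _ _ gw) // mpolyXi_neq0.
rewrite !mevalM mevalXU !mulf_eq0 !negb_or => /andP[/andP[fu gu] u0].
have r0 := row_neq0 u0.
have [||x xE] := fU (\row_i u i); rewrite ?meval_row //.
have [||y yE] := gV (\row_i u i); rewrite ?meval_row //.
exists (line_of r0); split.
  by apply: (@cone_mem U x); rewrite xE mem_line_of.
by apply: (@cone_mem V y); rewrite yE mem_line_of.
Qed.
End Regular.

(** * Regular functions as reduced fractions *)

Section Fractions.
Variable K : closedFieldType.
Notation opens := (opens (proj3 K)).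
Implicit Types U V W : opens.
Implicit Types p q f g : {mpoly K[4]}.

Definition is_fraction U (s : cone U -> K) p q : Prop :=
  forall v : cone U, q.@[sval v 0] != 0 /\ s v = p.@[sval v 0] / q.@[sval v 0].

Lemma fraction_den_neq0 U (s : cone U -> K) p q : U !=set0 -> is_fraction s p q -> q != 0.
Proof.
move=> [L /opens_cone[v _]] /(_ v)[qv _].
by apply: contraNneq qv => ->; rewrite meval0.
Qed.

Lemma fraction_eq U V W (s : cone U -> K) (h : V `<=` U) (k : W `<=` U) p q p' q' :
  V !=set0 -> W !=set0 ->
  is_fraction (s \o cone_incl h) p q -> is_fraction (s \o cone_incl k) p' q' ->
  p * q' = p' * q.
Proof.
move=> V0 W0 e e'; apply/eqP; rewrite -subr_eq0; apply/eqP.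
apply: (cone_vanish (opensI_neq0 V0 W0)) => v.
have jV : opensI V W `<=` V by move=> ? [].
have jW : opensI V W `<=` W by move=> ? [].
have [qv] := e (cone_incl jV v); have [qv'] := e' (cone_incl jW v).
rewrite /= (_ : cone_incl h _ = cone_incl k (cone_incl jW v)); last exact: coneP.
move=> -> /eqP; rewrite eqr_div // => /eqP e''.
by rewrite mevalB !mevalM e'' subrr.
Qed.

(** The zero polynomial is homogeneous of every degree, so for [p = 0] the degrees carry no
    information; hence the alternative, here and below. *)
Lemma fraction_regular U (s : cone U -> K) m n p q k : p \is m.-homog -> q \is n.-homog ->
  (p = 0 \/ m%:Z = n%:Z + k) -> is_fraction s p q -> regular k s.
Proof.
move=> pm qn [p0|e] sE.
  rewrite (_ : s = 0); first exact: regular0.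
  by apply/funext => v; have [_ ->] := sE v; rewrite p0 meval0 mul0r.
move=> L UL; exists U, (@subset_refl _ U); split=> //.
exists m, n, p, q; split=> // v; have [qv] := sE v.
by rewrite (_ : cone_incl _ v = v) //; exact: coneP.
Qed.

(* Reduced local fractions agree up to units because the polynomial ring is
   factorial. *)
Lemma regular_fraction U (s : cone U -> K) k : regular k s ->
  exists p q m n, [/\ p \is m.-homog, q \is n.-homog, p = 0 \/ m%:Z = n%:Z + k,
    is_fraction s p q & coprime_elts p q].
Proof.
move=> rs; have triv : (forall v, s v = 0) -> exists p q m n,
  [/\ p \is m.-homog, q \is n.-homog, p = 0 \/ m%:Z = n%:Z + k,
    is_fraction s p q & coprime_elts p q].
  move=> s0; exists 0, 1, 0%N, 0%N; split; [exact: dhomog0|exact: dhomog1|by left| |].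
    by move=> v; rewrite s0 meval0 mul0r meval1 oner_neq0.
  by move=> t [tu _] _ _ [c e]; case/negP: tu; apply/unitrPr; exists c; rewrite mulrC.
have [[L UL]|U0] := pselect (U !=set0); last first.
  by apply: triv => v; case: U0; have [_ [L UL _]] := svalP v; exists L.
have [V [h [VL [m [n [p [q [pm qn mn sE]]]]]]]] := rs L UL.
have V0 : V !=set0 by exists L.
have {}sE : is_fraction (s \o cone_incl h) p q by [].
have q0 := fraction_den_neq0 V0 sE.
have [r [p' [q' [pE qE cop]]]] := lowest_terms p (@mpoly_factorial K 4 q q0).
have r0 : r != 0 by apply: contraNneq q0 => r0; rewrite qE r0 mul0r.
have q0' : q' != 0 by apply: contraNneq q0 => q0'; rewrite qE q0' mulr0.
(* Near any point of [U] the function is some [p2 / q2] with [p' * q2 = p2 * q']. By coprimality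
   [q'] divides [q2], so it does not vanish there. *)
have sE' : is_fraction s p' q'.
  move=> v; have [_ [M UM vM]] := svalP v.
  have [W [l [WM [m2 [n2 [p2 [q2 [_ _ _ sE2]]]]]]]] := rs M UM.
  have W0 : W !=set0 by exists M.
  have := fraction_eq V0 W0 sE sE2; rewrite pE qE => e.
  have {}e : p' * q2 = p2 * q' by apply: (mulfI r0); rewrite mulrA e; ring.
  have [|c q2E] := @coprime_divides _ p' q' q2 (@mpoly_factorial K 4) q0' cop.
    by exists p2; rewrite mulrC.
  have [w wE] : exists w : cone W, sval w = sval v.
    by apply: cone_of vM => //; have [] := svalP v.
  have [] := sE2 w; rewrite (_ : cone_incl l w = v); last exact: coneP.
  rewrite wE => q2v ->; move: (q2v); rewrite {1}q2E mevalM mulf_eq0 negb_or => /andP[_ q'v].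
  split=> //; apply/eqP; rewrite eqr_div // -!mevalM -e mulrC.
  by rewrite [q2 * _]mulrC.
have [p'0|p'0] := eqVneq p' 0.
  by apply: triv => v; have [_ ->] := sE' v; rewrite p'0 meval0 mul0r.
have [d rd] : exists d : nat, (r \is d.-homog) by apply: (@dhomog_factor _ _ n r q'); rewrite -qE.
have [l pl] : exists l : nat, (p' \is l.-homog).
  apply: (@dhomog_factor _ _ m p' r); rewrite mulrC -?pE //.
  by rewrite pE mulf_neq0.
have [b qb] : exists b : nat, (q' \is b.-homog).
  by apply: (@dhomog_factor _ _ n q' r); rewrite mulrC -?qE.
exists p', q', l, b; split=> //; right.
have p0 : p != 0 by rewrite pE mulf_neq0.
have e1 : m = (d + l)%N by apply: dhomog_uniq p0 pm _; rewrite pE; exact: dhomogM.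
have e2 : n = (d + b)%N by apply: dhomog_uniq q0 qn _; rewrite qE; exact: dhomogM.
by move: mn; rewrite e1 e2 !PoszD -addrA => /addrI.
Qed.

Lemma regular_dense U (s : cone U -> K) k f : f != 0 -> regular k s ->
  (forall v : cone U, f.@[sval v 0] != 0 -> s v = 0) -> forall v, s v = 0.
Proof.
move=> f0 /regular_fraction[p [q [m [n [_ _ _ sE _]]]]] sf v.
have U0 : U !=set0 by have [_ [L UL _]] := svalP v; exists L.
suff p0 : p = 0 by have [_ ->] := sE v; rewrite p0 meval0 mul0r.
have /eqP : p * f = 0.
  apply: (cone_vanish U0) => w; rewrite mevalM; have [->|/sf] := eqVneq f.@[sval w 0] 0.
    by rewrite mulr0.
  have [qw ->] := sE w => /eqP.
  by rewrite mulf_eq0 invr_eq0 (negPf qw) orbF => /eqP ->; rewrite mul0r.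
by rewrite mulf_eq0 (negPf f0) orbF => /eqP.
Qed.

(** Extension across codimension two: a prime factor of the reduced denominator would vanish at a
    point outside the line [x_i = x_j = 0], where the function is regular. So the denominator is
    constant. *)
Lemma regular_polynomial U (s : cone U -> K) k (i j : 'I_4) : i != j -> regular k s ->
  (forall v : 'rV[K]_4, v 0 i != 0 \/ v 0 j != 0 -> exists w : cone U, sval w = v) ->
  exists p m, [/\ p \is m.-homog, p = 0 \/ m%:Z = k & forall v : cone U, s v = p.@[sval v 0]].
Proof.
move=> ij /regular_fraction[p [q [m [n [pm qn mn sE cop]]]]] Uij.
have qu : q \is a GRing.unit.
  have U0 : U !=set0.
    have [|w _] := Uij (\row_k (k == i)%:R); first by left; rewrite mxE eqxx oner_neq0.
    by have [_ [L UL _]] := svalP w; exists L.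
  have qP := @mpoly_factorial K 4 q (fraction_den_neq0 U0 sE).
  case: qP sE {qn mn cop} => [//|h q' hp h0 _] sE.
  have [v [hv vij]] := nullstellensatz_var hp ij.
  have [|w wE] := Uij (\row_k v k); first by rewrite !mxE.
  by have [+ _] := sE w; rewrite wE mevalM mulf_eq0 negb_or !meval_row hv eqxx.
have /msize_poly1P[c c0 qE] : msize q == 1%N by rewrite -mpoly_unitP.
exists (c^-1 *: p), m; split; first by apply: dhomogZ.
  case: mn => [->|->]; [by left; rewrite scaler0|right].
  have q0 : q != 0 by rewrite qE mpolyC_eq0.
  suff -> : n = 0%N by rewrite add0r.
  apply: dhomog_uniq q0 qn _; rewrite qE -alg_mpolyC; by apply/dhomogZ/dhomog1.
by move=> v; have [_ ->] := sE v; rewrite qE mevalC mevalZ mulrC.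
Qed.

End Fractions.

(** * Proportional families and partial derivatives *)

Section PartialDerivatives.
Variable K : closedFieldType.
Notation opens := (opens (proj3 K)).
Implicit Types U V W : opens.
Implicit Types p q f g : {mpoly K[4]}.

Lemma dhomog_bigprod (I : Type) (r : seq I) (P : pred I) (F : I -> {mpoly K[4]}) d :
  (forall i, P i -> F i \is (d i).-homog) ->
  \prod_(i <- r | P i) F i \is (\sum_(i <- r | P i) d i)%N.-homog.
Proof.
move=> Fd; elim/big_rec2: _ => [|i e p Pi pe]; first exact: dhomog1.
by apply: dhomogM (Fd _ Pi) pe.
Qed.

(** After clearing denominators by the common [Q], the numerators are proportional to the coprime
    [A j], hence equal to [g] times them; the factor [g / Q] has no pole on [U]. *)
Lemma regular_multiple r U (P : 'I_r -> cone U -> K) (A : 'I_r -> {mpoly K[4]}) k n :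
  (forall j, regular k (P j)) -> (forall j, A j \is n.-homog) ->
  (exists j, A j != 0) ->
  (forall t, prime_elt t -> t != 0 -> ~ forall j, divides t (A j)) ->
  (forall v j l, P j v * (A l).@[sval v 0] = P l v * (A j).@[sval v 0]) ->
  exists2 s : cone U -> K, regular (k - n%:Z) s &
    forall v j, P j v = s v * (A j).@[sval v 0].
Proof.
move=> rP An [j0 A0] cop PA; have [U0|U0] := pselect (U !=set0); last first.
  by exists 0 => [|v]; [exact: regular0|case: U0; have [_ [L UL _]] := svalP v; exists L].
have /choice[p /choice[q /choice[a /choice[b H]]]] := fun j => regular_fraction (rP j).
pose Q := \prod_j q j; pose Q' j := \prod_(l | l != j) q l.
have QE j : Q = q j * Q' j by rewrite /Q (bigD1 j).
have Qh : Q \is (\sum_j b j)%N.-homog by apply: dhomog_bigprod => j _; have [] := H j.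
have Qh' j : Q' j \is (\sum_(l | l != j) b l)%N.-homog.
  by apply: dhomog_bigprod => l _; have [] := H l.
have qv j (v : cone U) : (q j).@[sval v 0] != 0 by have [_ _ _ /(_ v)[]] := H j.
have Q'v j (v : cone U) : (Q' j).@[sval v 0] != 0.
  by rewrite rmorph_prod; apply/prodf_neq0 => l _; exact: qv.
have PE j v : P j v * Q.@[sval v 0] = (p j * Q' j).@[sval v 0].
  have [_ _ _ /(_ v)[_ ->] _] := H j.
  by rewrite (QE j) !mevalM mulrA divfK.
have pA j l : p j * Q' j * A l = p l * Q' l * A j.
  apply/eqP; rewrite -subr_eq0; apply/eqP/(cone_vanish U0) => v.
  rewrite mevalB mevalM [X in _ - X]mevalM -!PE mulrAC PA [X in _ - X]mulrAC.
  by rewrite subrr.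
have [g gE] := proportional_multiple (@mpoly_factorial K 4) (ex_intro _ j0 A0) cop pA.
pose s (v : cone U) := g.@[sval v 0] / Q.@[sval v 0].
have Qv (v : cone U) : Q.@[sval v 0] != 0 by rewrite (QE j0) mevalM mulf_neq0.
have sE : is_fraction s g Q by [].
exists s => [|v j]; last first.
  by apply: (mulIf (Qv v)); rewrite PE gE mevalM /s mulrAC divfK.
have [g0|g0] := eqVneq g 0.
  have gh : g \is 0.-homog by rewrite g0; exact: dhomog0.
  by apply: (fraction_regular gh Qh _ sE); left.
have gA0 : g * A j0 != 0 by rewrite mulf_neq0.
have [ph qh + _ _] := H j0; case=> [p0|e].
  by case/eqP: gA0; rewrite -gE p0 mul0r.
have pQh := dhomogM ph (Qh' j0); rewrite gE in pQh.
have [d gd] := dhomog_factor gA0 pQh.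
apply: (fraction_regular gd Qh _ sE); right.
have := dhomog_uniq gA0 (dhomogM gd (An j0)) pQh.
rewrite [X in _ = X%:Z + _](bigD1 j0) //= => /(congr1 Posz); rewrite !PoszD e.
move: (\sum_(_ | _) _)%N (a j0) (b j0) => N x y; clear; lia.
Qed.

(** Some fraction for [s], with default [0 / 1]. The quotient rule below does not depend on the
    choice, by [pderivE]. *)
Definition fraction_of U (s : cone U -> K) : {mpoly K[4]} * {mpoly K[4]} :=
  xget (0, 1) [set pq | is_fraction s pq.1 pq.2].

Lemma fraction_ofP U (s : cone U -> K) k : regular k s ->
  is_fraction s (fraction_of s).1 (fraction_of s).2.
Proof.
move=> /regular_fraction[p [q [_ [_ [_ _ _ sE _]]]]].
by rewrite /fraction_of; case: xgetP => [pq _|/(_ (p, q))]; [apply|case].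
Qed.

Definition qderiv (i : 'I_4) p q := p^`M(i) * q - p * q^`M(i).

Definition pderiv (i : 'I_4) U (s : cone U -> K) (v : cone U) : K :=
  (qderiv i (fraction_of s).1 (fraction_of s).2).@[sval v 0] /
    (fraction_of s).2.@[sval v 0] ^+ 2.

Lemma pderivE i U V (s : cone U -> K) k (h : V `<=` U) p q (v : cone V) : regular k s ->
  is_fraction (s \o cone_incl h) p q ->
  pderiv i s (cone_incl h v) = (qderiv i p q).@[sval v 0] / q.@[sval v 0] ^+ 2.
Proof.
move=> /fraction_ofP; rewrite /pderiv; case: (fraction_of s) => p' q' /= sE' sE.
have V0 : V !=set0 by have [_ [L VL _]] := svalP v; exists L.
have e := @fraction_eq _ U V V s h h p q p' q' V0 V0 sE (fun w => sE' (cone_incl h w)).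
have de := congr1 (mderiv i) e; rewrite !mderivM in de.
have [q'v _] := sE' (cone_incl h v); have [qv _] := sE v.
apply/eqP; rewrite eqr_div ?expf_neq0 // -!rmorphXn /= -!mevalM.
apply/eqP; congr meval; rewrite /qderiv.
(* The two sides differ by multiples of the relation [p * q' = p' * q] and of its derivative. *)
have -> : (p'^`M(i) * q' - p' * q'^`M(i)) * q ^+ 2 =
    (p^`M(i) * q - p * q^`M(i)) * q' ^+ 2
    + q' * q * ((p'^`M(i) * q + p' * q^`M(i)) - (p^`M(i) * q' + p * q'^`M(i)))
    + (q * q'^`M(i) + q' * q^`M(i)) * (p * q' - p' * q) by ring.
by rewrite de e !subrr !mulr0 !addr0.
Qed.

Lemma pderiv_res i U V (s : cone U -> K) k (h : V `<=` U) (v : cone V) : regular k s ->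
  pderiv i (s \o cone_incl h) v = pderiv i s (cone_incl h v).
Proof.
move=> rs; have rs' := regular_res h rs; have sE := fraction_ofP rs'.
by rewrite (pderivE i v rs sE).
Qed.

Lemma pderiv_fraction i U (s : cone U -> K) k p q v : regular k s -> is_fraction s p q ->
  pderiv i s v = (qderiv i p q).@[sval v 0] / q.@[sval v 0] ^+ 2.
Proof.
move=> rs sE; have sE' : is_fraction (s \o cone_incl (@subset_refl _ U)) p q.
  by move=> w; rewrite /= cone_incl_id.
by rewrite -(pderivE i v rs sE') cone_incl_id.
Qed.

Lemma mderiv_homog i m p : p \is m.-homog -> p^`M(i) \is m.-1.-homog.
Proof.
move=> /dhomogP ph; apply/dhomogP => w; rewrite mcoeff_msupp mcoeff_deriv => wp.
have : (w + U_(i))%MM \in msupp p.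
  by rewrite mcoeff_msupp; apply: contraNneq wp => ->; rewrite mul0rn.
move=> /ph => e; have {}e : mdeg (w + U_(i))%MM = m := e.
by rewrite -e mdegD mdeg1 addn1.
Qed.

Lemma mderiv_homog0 i p : p \is 0.-homog -> p^`M(i) = 0.
Proof.
move=> /dhomogP ph; apply/mpolyP => w; rewrite mcoeff_deriv mcoeff0.
suff -> : p@_(w + U_(i)) = 0 by rewrite mul0rn.
apply/eqP; rewrite mcoeff_eq0; apply/negP => /ph e.
by have : mdeg (w + U_(i))%MM = 0%N := e; rewrite mdegD mdeg1 addn1.
Qed.

Lemma qderiv_homog i m n p q : p \is m.-homog -> q \is n.-homog ->
  qderiv i p q \is (m + n).-1.-homog.
Proof.
move=> ph qh; apply: rpredB.
  have := mderiv_homog i ph; case: m ph => [|m] ph dp.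
    by rewrite mderiv_homog0 // mul0r; exact: dhomog0.
  by rewrite addSn; apply: dhomogM.
have := mderiv_homog i qh; case: n qh => [|n] qh dq.
  by rewrite (mderiv_homog0 i qh) mulr0; exact: dhomog0.
by rewrite addnS; apply: dhomogM.
Qed.

Lemma pderiv_regular i U (s : cone U -> K) k : regular k s -> regular (k - 1) (pderiv i s).
Proof.
move=> rs; have [p [q [m [n [ph qh mn sE _]]]]] := regular_fraction rs.
have dE : is_fraction (pderiv i s) (qderiv i p q) (q ^+ 2).
  move=> v; rewrite (pderiv_fraction i v rs sE) rmorphXn /=; split=> //.
  by rewrite expf_neq0 //; have [] := sE v.
have q2 : q ^+ 2 \is (n * 2).-homog by apply: dhomogMn.
apply: (fraction_regular (qderiv_homog i ph qh) q2 _ dE).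
case: mn => [p0|mn].
  by left; rewrite /qderiv p0 mderiv0 !mul0r subrr.
(* The predecessor in the degree of [qderiv] is truncated only when both degrees are zero, and then
   [qderiv] vanishes. *)
case: m n ph qh mn {q2} => [|m] [|n] ph qh mn; [left|right; lia..].
by rewrite /qderiv !mderiv_homog0 // mulr0 mul0r subrr.
Qed.

Lemma fractionD U (s t : cone U -> K) p q p' q' : is_fraction s p q -> is_fraction t p' q' ->
  is_fraction (s + t) (p * q' + p' * q) (q * q').
Proof.
move=> sE tE v; have [qv e] := sE v; have [qv' e'] := tE v.
rewrite mevalD !mevalM mulf_neq0 //; split=> //.
by rewrite -[LHS]/(s v + t v) e e' addf_div.
Qed.

Lemma fractionM U (s t : cone U -> K) p q p' q' : is_fraction s p q -> is_fraction t p' q' ->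
  is_fraction (s * t) (p * p') (q * q').
Proof.
move=> sE tE v; have [qv e] := sE v; have [qv' e'] := tE v.
by rewrite !mevalM mulf_neq0 //; split=> //; rewrite -[LHS]/(s v * t v) e e' mulf_div.
Qed.

Lemma regularD U (s t : cone U -> K) k : regular k s -> regular k t -> regular k (s + t).
Proof.
move=> rs rt; have -> : s + t = s - (0 - t) by rewrite sub0r opprK.
by apply: regularB rs _; apply: regularB rt; exact: regular0.
Qed.

Lemma pderivD i U (s t : cone U -> K) k v : regular k s -> regular k t ->
  pderiv i (s + t) v = pderiv i s v + pderiv i t v.
Proof.
move=> rs rt; have sE := fraction_ofP rs; have tE := fraction_ofP rt.
rewrite (pderiv_fraction i v (regularD rs rt) (fractionD sE tE)).
rewrite (pderiv_fraction i v rs sE) (pderiv_fraction i v rt tE) /qderiv.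
have [qv _] := sE v; have [qv' _] := tE v.
rewrite !(mevalB, mevalD, mevalM, mderivD, mderivM).
by field; rewrite qv qv'.
Qed.

Lemma pderivM i U (s t : cone U -> K) k l v : regular k s -> regular l t ->
  pderiv i (s * t) v = s v * pderiv i t v + t v * pderiv i s v.
Proof.
move=> rs rt; have sE := fraction_ofP rs; have tE := fraction_ofP rt.
rewrite (pderiv_fraction i v (regularM rs rt) (fractionM sE tE)).
rewrite (pderiv_fraction i v rs sE) (pderiv_fraction i v rt tE) /qderiv.
have [qv sv] := sE v; have [qv' tv] := tE v; rewrite sv tv.
rewrite !(mevalB, mevalD, mevalM, mderivD, mderivM).
by field; rewrite qv qv'.
Qed.

Lemma pderivC i U (c : K) (v : cone U) : pderiv i (fun _ : cone U => c) v = 0.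
Proof.
have cE : is_fraction (fun _ : cone U => c) c%:MP 1.
  by move=> w; rewrite meval1 mevalC divr1 oner_neq0.
rewrite (pderiv_fraction i v (@regular_cst K U c) cE) /qderiv.
by rewrite mderivC mderiv_homog0 ?dhomog1 // mulr0 mul0r subrr meval0 mul0r.
Qed.

End PartialDerivatives.

(** * Vector fields *)

Section Sections.
Variable K : closedFieldType.
Notation opens := (opens (proj3 K)).
Notation O := (strO K).
Notation T := (tangent_sheaf K).
Implicit Types U V W : opens.

Definition secfun k U (a : OP K k U) : cone U -> K := proj1_sig (a : twist_sec k U).
Definition mksec k U (s : cone U -> K) (rs : regular k s) : OP K k U :=
  exist _ s (asboolT rs).
Definition ofun U (f : O U) : cone U -> K := proj1_sig (f : regular_fun U).
Definition mkfun U (s : cone U -> K) (rs : regular 0 s) : O U := exist _ s (asboolT rs).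

Lemma secfun_regular k U (a : OP K k U) : regular k (secfun a).
Proof. exact: asboolW (proj2_sig (a : twist_sec k U)). Qed.
Lemma ofun_regular U (f : O U) : regular 0 (ofun f).
Proof. exact: asboolW (proj2_sig (f : regular_fun U)). Qed.
Lemma secfun_mk k U s (rs : regular k s) : secfun (mksec rs : OP K k U) = s.
Proof. by []. Qed.
Lemma ofun_mk U s (rs : regular 0 s) : ofun (mkfun rs : O U) = s.
Proof. by []. Qed.
Lemma secfun_inj k U (a b : OP K k U) : (forall v, secfun a v = secfun b v) -> a = b.
Proof. by move=> ab; apply: val_inj; apply/funext. Qed.
Lemma ofun_inj U (f g : O U) : (forall v, ofun f v = ofun g v) -> f = g.
Proof. by move=> ab; apply: val_inj; apply/funext. Qed.
Lemma secfunD k U (a b : OP K k U) v : secfun (a + b) v = secfun a v + secfun b v.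
Proof. by []. Qed.
Lemma secfun0 k U v : secfun (0 : OP K k U) v = 0.
Proof. by []. Qed.
Lemma secfunZ k U (f : O U) (a : OP K k U) v : secfun (f *: a) v = ofun f v * secfun a v.
Proof. by []. Qed.
Lemma secfun_res k U V (h : V `<=` U) (a : OP K k U) v :
  secfun (mres h a) v = secfun a (cone_incl h v).
Proof. by []. Qed.
Lemma ofunD U (f g : O U) v : ofun (f + g) v = ofun f v + ofun g v.
Proof. by []. Qed.
Lemma ofunM U (f g : O U) v : ofun (f * g) v = ofun f v * ofun g v.
Proof. by []. Qed.
Lemma ofun0 U v : ofun (0 : O U) v = 0.
Proof. by []. Qed.
Lemma ofun_res U V (h : V `<=` U) (f : O U) v :
  ofun (rres O h f) v = ofun f (cone_incl h v).
Proof. by []. Qed.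
Lemma ofun_cst U c v : ofun (cstO U c) v = c.
Proof. by []. Qed.

Definition dapp U (D : T U) V (h : V `<=` U) (f : O V) : O V := nmap (proj1_sig D) h f.

Lemma dapp_irr U (D : T U) V (h h' : V `<=` U) (f : O V) : dapp D h f = dapp D h' f.
Proof. by rewrite (Prop_irrelevance h h'). Qed.

Lemma tangent_ext U (D E : T U) :
  (forall V (h : V `<=` U) f, dapp D h f = dapp E h f) -> D = E.
Proof. by move=> DE; apply: val_inj; apply: natMapP => V h f; exact: DE. Qed.

Lemma dapp_res U (D : T U) V W (h : V `<=` U) (k : W `<=` V) (l : W `<=` U) f :
  dapp D l (rres O k f) = rres O k (dapp D h f).
Proof. rewrite (dapp_irr D l (subset_trans k h)); exact: (nmap_nat (proj1_sig D) h k f). Qed.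

Lemma dapp_mres U V W (D : T U) (k : V `<=` U) (h : W `<=` V) (l : W `<=` U) f :
  dapp (mres k D) h f = dapp D l f.
Proof. exact: (dapp_irr D (subset_trans h k) l f). Qed.

Lemma dappDl U (D E : T U) V (h : V `<=` U) f : dapp (D + E) h f = dapp D h f + dapp E h f.
Proof. by []. Qed.
Lemma dapp0l U V (h : V `<=` U) f : dapp (0 : T U) h f = 0.
Proof. by []. Qed.
Lemma dappZl U (a : O U) (D : T U) V (h : V `<=` U) f :
  dapp (a *: D) h f = rres O h a * dapp D h f.
Proof. by []. Qed.

Lemma dapp_der U (D : T U) : is_der (proj1_sig D).
Proof. exact: asboolW (proj2_sig D). Qed.

Lemma dappD U (D : T U) V (h : V `<=` U) f g : dapp D h (f + g) = dapp D h f + dapp D h g.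
Proof. by have [e _ _] := dapp_der D h; exact: e. Qed.
Lemma dappC U (D : T U) V (h : V `<=` U) c : dapp D h (cstO V c) = 0.
Proof. by have [_ e _] := dapp_der D h; exact: e. Qed.
Lemma dappM U (D : T U) V (h : V `<=` U) f g :
  dapp D h (f * g) = f * dapp D h g + g * dapp D h f.
Proof. by have [_ _ e] := dapp_der D h; exact: e. Qed.
Lemma dapp1 U (D : T U) V (h : V `<=` U) : dapp D h 1 = 0.
Proof.
rewrite -(dappC D h 1); congr (dapp D h _); exact: ofun_inj.
Qed.

Definition in_chart i U : Prop := forall v : cone U, sval v 0 i != 0.

Lemma in_chart_sub i U V : V `<=` U -> in_chart i U -> in_chart i V.
Proof. by move=> h Ui v; exact: (Ui (cone_incl h v)). Qed.

Lemma chart_regular i j U : in_chart i U ->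
  regular 0 (fun v : cone U => sval v 0 j / sval v 0 i).
Proof.
move=> Ui; apply: (@fraction_regular K U _ 1 1 'X_j 'X_i); rewrite ?homogX //; first by right.
by move=> v; rewrite !mevalXU; split.
Qed.

Definition chart i j U (Ui : in_chart i U) : O U := mkfun (chart_regular j Ui).

Lemma chartE i j U (Ui : in_chart i U) v : ofun (chart j Ui) v = sval v 0 j / sval v 0 i.
Proof. by []. Qed.

Lemma chart_res i j U V (h : V `<=` U) (Ui : in_chart i U) (Vi : in_chart i V) :
  rres O h (chart j Ui) = chart j Vi.
Proof. exact: ofun_inj. Qed.

Lemma chart_id i U (Ui : in_chart i U) : chart i Ui = 1.
Proof. by apply: ofun_inj => v; rewrite chartE divff. Qed.

(** Every regular function on a chart is a quotient of two polynomials in the affine coordinates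
    [x_j / x_i], and the Leibniz rule determines a derivation on these. *)
Lemma tangent_chart_ext i U (D E : T U) (Ui : in_chart i U) :
  (forall j, dapp D (@subset_refl _ U) (chart j Ui) = dapp E (@subset_refl _ U) (chart j Ui)) ->
  D = E.
Proof.
move=> DE; apply: tangent_ext => V h f; have Vi := in_chart_sub h Ui.
have {}DE j : dapp D h (chart j Vi) = dapp E h (chart j Vi).
  rewrite -(chart_res j h Ui Vi).
  by rewrite (dapp_res D (@subset_refl _ U)) DE (dapp_res E (@subset_refl _ U)).
have poly p : exists g : O V, (forall v, ofun g v = p.@[fun j => sval v 0 j / sval v 0 i]) /\
    dapp D h g = dapp E h g.
  elim/mpoly_ring_ind: p => [c|j|p q [g [ge gD]] [g' [ge' gD']]|p q [g [ge gD]] [g' [ge' gD']]].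
  - by exists (cstO V c); split=> [v|]; rewrite ?mevalC // !dappC.
  - by exists (chart j Vi); split=> [v|]; rewrite ?mevalXU.
  - by exists (g + g'); split=> [v|]; rewrite ?mevalD ?ofunD ?ge ?ge' // !dappD gD gD'.
  - by exists (g * g'); split=> [v|]; rewrite ?mevalM ?ofunM ?ge ?ge' // !dappM gD gD'.
have [p [q [m [n [ph qh mn fE _]]]]] := regular_fraction (ofun_regular f).
have dehom d (v : cone V) r : r \is d.-homog ->
    r.@[fun j => sval v 0 j / sval v 0 i] = (sval v 0 i)^-1 ^+ d * r.@[sval v 0].
  by move=> rh; rewrite -(homog_scale _ _ rh); apply: meval_eq => j; rewrite mxE mulrC.
have [a [aE aD]] := poly p; have [b [bE bD]] := poly q.
(* Dividing [p] and [q] by powers of [x_i] makes them functions on the chart; the powers agree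
   because [f] has degree zero. *)
have fb : f * b = a.
  apply: ofun_inj => v; rewrite ofunM aE bE; have [qv ->] := fE v.
  rewrite (dehom _ _ _ ph) (dehom _ _ _ qh).
  case: mn => [->|]; first by rewrite meval0 !(mul0r, mulr0).
  by rewrite addr0 => -[->]; rewrite mulrCA divfK.
have := aD; rewrite -fb !dappM bD => /addrI e.
apply: ofun_inj => v; have /(congr1 (fun g => ofun g v)) := e.
rewrite !ofunM; apply: mulfI; rewrite bE (dehom _ _ _ qh) mulf_neq0 //.
  by rewrite expf_neq0 // invr_eq0.
by have [] := fE v.
Qed.

Section VectorField.
Variables (U : opens) (w : 'I_4 -> OP K 1 U).

(** The map from four copies of [O(1)] to the tangent sheaf in the Euler sequence: [sum w_j d/dx_j]
    acting on functions of degree zero. *)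
Definition vfield_fun V (h : V `<=` U) (f : O V) : cone V -> K :=
  fun v => \sum_j secfun (w j) (cone_incl h v) * pderiv j (ofun f) v.

Lemma vfield_regular V (h : V `<=` U) (f : O V) : regular 0 (vfield_fun h f).
Proof.
have -> : vfield_fun h f = \sum_j ((secfun (w j) \o cone_incl h) * pderiv j (ofun f)).
  by apply/funext => v; rewrite fct_sumE.
apply: big_ind => [|s t|j _]; [exact: regular0|exact: regularD|].
rewrite (_ : 0 = 1 + (0 - 1)) //; apply: regularM; last exact/pderiv_regular/ofun_regular.
exact/regular_res/secfun_regular.
Qed.

Lemma vfield_nat V W (h : V `<=` U) (k : W `<=` V) (f : structMod O V) :
  mkfun (vfield_regular (subset_trans k h) (mres k f)) =
  mres k (mkfun (vfield_regular h f) : structMod O V).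
Proof.
apply: ofun_inj => v; rewrite ofun_mk; apply: eq_bigr => j _.
rewrite cone_incl_comp; congr (_ * _).
exact: (pderiv_res j k v (ofun_regular f)).
Qed.

Definition vfield_map : natMapSheaf (structMod O) (structMod O) U :=
  @NatMap _ _ (structMod O) (structMod O) U (fun V h f => mkfun (vfield_regular h f)) vfield_nat.

Lemma vfield_der : is_der vfield_map.
Proof.
move=> V h; split=> [f g|c|f g]; apply: ofun_inj => v.
- change (vfield_fun h (f + g) v = vfield_fun h f v + vfield_fun h g v).
  rewrite /vfield_fun -big_split; apply: eq_bigr => j _ /=; rewrite -mulrDr; congr (_ * _).
  exact: pderivD (ofun_regular f) (ofun_regular g).
- change (vfield_fun h (cstO V c) v = 0); rewrite /vfield_fun big1 // => j _.
  by rewrite [pderiv _ _ _]pderivC mulr0.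
- change (vfield_fun h (f * g) v = ofun f v * vfield_fun h g v + ofun g v * vfield_fun h f v).
  rewrite /vfield_fun !mulr_sumr -big_split; apply: eq_bigr => j _ /=.
  rewrite [pderiv j _ v](pderivM j v (ofun_regular f) (ofun_regular g)); ring.
Qed.

Definition vfield : T U := exist _ vfield_map (asboolT vfield_der).

Lemma vfieldE V (h : V `<=` U) f v : ofun (dapp vfield h f) v =
  \sum_j secfun (w j) (cone_incl h v) * pderiv j (ofun f) v.
Proof. by []. Qed.

End VectorField.

Lemma vfield_chart U (w : 'I_4 -> OP K 1 U) V (h : V `<=` U) i l (Vi : in_chart i V) v :
  ofun (dapp (vfield w) h (chart l Vi)) v =
  (secfun (w l) (cone_incl h v) * sval v 0 i - secfun (w i) (cone_incl h v) * sval v 0 l)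
    / sval v 0 i ^+ 2.
Proof.
have dX j k : ('X_k : {mpoly K[4]})^`M(j) = (k == j)%:R.
  rewrite mderivX mnm1E; case: eqP => [->|_]; last by rewrite scale0r.
  by rewrite scale1r (_ : (_ - _)%MM = 0%MM) ?mpolyX0 //; apply/mnmP => m;
    rewrite mnmBE subnn mnm0E.
have XE : is_fraction (ofun (chart l Vi)) 'X_l 'X_i.
  by move=> u; rewrite !mevalXU; split=> //; exact: Vi.
rewrite vfieldE; under eq_bigr => j _.
  rewrite (pderiv_fraction j v (ofun_regular (chart l Vi)) XE) /qderiv !dX.
  rewrite mevalB !mevalM !mevalXU !rmorph_nat mulrA.
  over.
rewrite -mulr_suml; congr (_ / _).
have delta k (F : 'I_4 -> K) : \sum_j F j * (k == j)%:R = F k.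
  rewrite (bigD1 k) //= eqxx mulr1 big1 ?addr0 // => j /negPf jk.
  by rewrite eq_sym jk mulr0.
rewrite -[X in X * _ - _](delta l (fun j => secfun (w j) (cone_incl h v))).
rewrite -[X in _ - X * _](delta i (fun j => secfun (w j) (cone_incl h v))).
rewrite !mulr_suml -sumrB; apply: eq_bigr => j _; ring.
Qed.

(** The Euler sequence is surjective on charts: the lift is normalised by [w i = 0], and
    [x_l = x_i * (x_l / x_i)] then gives [w l]. *)
Lemma tangent_vfield i U (D : T U) (Ui : in_chart i U) :
  exists w : 'I_4 -> OP K 1 U, D = vfield w /\ forall l v,
    secfun (w l) v = sval v 0 i * ofun (dapp D (@subset_refl _ U) (chart l Ui)) v.
Proof.
have rx (l : 'I_4) : regular 1
    ((fun v : cone U => sval v 0 i) * ofun (dapp D (@subset_refl _ U) (chart l Ui))).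
  rewrite -[1]addr0; apply: regularM (ofun_regular _).
  have := @regular_poly K U 1 'X_i (homogX K i); congr (regular _ _).
  by apply/funext => v; rewrite mevalXU.
exists (fun l => mksec (rx l)); split=> //.
apply: (tangent_chart_ext (Ui := Ui)) => l; apply: ofun_inj => v.
rewrite vfield_chart cone_incl_id !secfun_mk.
rewrite -![((_ : cone U -> K) * _) v]/(_ * _) chart_id dapp1 ofun0 mulr0 mul0r subr0.
by rewrite expr2 invfM mulrA mulfK // mulrC mulKf.
Qed.

Definition chart_open (i : 'I_4) : opens := Opens (openD_subproof (homogX K i)).

Lemma mem_chart_open i (v : 'rV[K]_4) (L : proj3 K) :
  v 0 i != 0 -> v \in val L -> oset (chart_open i) L.
Proof. by move=> vi vL; apply/zerosCP; exists 'X_i, v; rewrite mevalXU. Qed.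

Lemma in_chart_open i : in_chart i (chart_open i).
Proof.
move=> v; have [v0 [L /zerosCP[_ [u [-> uL ui]]] vL]] := svalP v.
have [c uE] := proj3_colinear v0 vL uL.
by move: ui; rewrite mevalXU uE mxE mulf_eq0 negb_or => /andP[].
Qed.

Lemma in_chartI i U : in_chart i (opensI U (chart_open i)).
Proof. by apply: in_chart_sub (@in_chart_open i) => ? []. Qed.

Lemma opensI_subl U V : opensI U V `<=` U. Proof. by move=> ? []. Qed.
Lemma cone_opensI U V (v : cone U) (L : proj3 K) : sval v \in val L -> oset V L ->
  exists w : cone (opensI U V), sval w = sval v.
Proof.
move=> vL VL; have [v0 _] := svalP v.
by apply: (cone_of v0 _ vL); split=> //; exact: cone_mem vL.
Qed.

Lemma cone_chart U (v : cone U) i : sval v 0 i != 0 ->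
  exists w : cone (opensI U (chart_open i)), cone_incl (@opensI_subl U (chart_open i)) w = v.
Proof.
move=> vi; have [_ [L UL vL]] := svalP v.
have [w wv] := cone_opensI vL (mem_chart_open vi vL).
by exists w; exact: coneP.
Qed.

Lemma mres_sep_chart (F : sheafMod O) U (s t : F U) :
  (forall i V (h : V `<=` U), in_chart i V -> mres h s = mres h t) -> s = t.
Proof.
move=> st; apply: mres_sep => L UL; have [v vL] := opens_cone UL.
have [i vi] := cone_coord v.
exists (opensI U (chart_open i)), (@opensI_subl _ _); split.
  by split=> //; exact: mem_chart_open vi vL.
exact/st/in_chartI.
Qed.

Lemma vfield_res U V (h : V `<=` U) (w : 'I_4 -> OP K 1 U) :
  mres h (vfield w) = vfield (fun j => mres h (w j)).
Proof.
apply: tangent_ext => W k f; rewrite (dapp_mres _ h k (subset_trans k h)).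
apply: ofun_inj => v; rewrite !vfieldE; apply: eq_bigr => j _.
by rewrite secfun_res cone_incl_comp.
Qed.

Lemma vfieldL U a (w w' : 'I_4 -> OP K 1 U) :
  vfield (fun j => a *: w j + w' j) = a *: vfield w + vfield w'.
Proof.
apply: tangent_ext => V h f; apply: ofun_inj => v.
rewrite dappDl dappZl ofunD ofunM !vfieldE mulr_sumr -big_split.
by apply: eq_bigr => j _; rewrite secfunD secfunZ ofun_res mulrDl mulrA.
Qed.

Lemma cross_subE (a a' b b' x y : K) :
  (a - a') * x = (b - b') * y <-> a * x - b * y = a' * x - b' * y.
Proof.
have eS : (a - a') * x - (b - b') * y = (a * x - b * y) - (a' * x - b' * y) by ring.
by split=> e; apply/eqP; rewrite -subr_eq0; [rewrite -eS|rewrite eS]; rewrite e subrr.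
Qed.

(* The kernel of [vfield] consists of the multiples of the Euler field. *)
Lemma vfield_eq U (w w' : 'I_4 -> OP K 1 U) : vfield w = vfield w' <->
  forall v i l, (secfun (w l) v - secfun (w' l) v) * sval v 0 i =
    (secfun (w i) v - secfun (w' i) v) * sval v 0 l.
Proof.
split=> [e v i l|e].
  have [k vk] := cone_coord v; have [u uv] := cone_chart vk.
  have d m : (secfun (w m) v - secfun (w' m) v) * sval v 0 k =
    (secfun (w k) v - secfun (w' k) v) * sval v 0 m.
    have /(congr1 (fun D => ofun (dapp D (@opensI_subl _ _) (chart m (@in_chartI k U))) u)) := e.
    rewrite !vfield_chart uv (_ : sval u = sval v); last by rewrite -uv.
    move/(mulIf (_ : (sval v 0 k ^+ 2)^-1 != 0)); rewrite invr_eq0 expf_neq0 // => /(_ isT) e'.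
    exact/cross_subE.
  by apply: (mulIf vk); rewrite mulrAC d mulrAC -d; ring.
apply: mres_sep_chart => i V h Vi; rewrite !vfield_res.
apply: (tangent_chart_ext (Ui := Vi)) => l; apply: ofun_inj => v.
rewrite !vfield_chart !secfun_res !cone_incl_id; congr (_ / _).
exact/cross_subE/(e (cone_incl h v) i l).
Qed.

End Sections.

(** * Twists *)

Section ModuleMaps.
Variables (X : topologicalType) (O : ringSheaf X).
Notation opens := (opens X).
Implicit Types U V W : opens.

Lemma mres_irr (F : sheafMod O) (U V : opens) (h h' : V `<=` U) (s : F U) :
  mres h s = mres h' s.
Proof. by rewrite (Prop_irrelevance h h'). Qed.

Lemma semilinear0 (R : pzRingType) (M N : lmodType R) (f : M -> N) :
  (forall a s t, f (a *: s + t) = a *: f s + f t) -> f 0 = 0.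
Proof.
move=> fL; have := fL 1 0 0; rewrite !scale1r addr0 => /eqP.
by rewrite -subr_eq0 opprD addrA subrr sub0r oppr_eq0 => /eqP.
Qed.

Section Hom.
Variables (F G : sheafMod O) (f : Defs.hom F G) (U : opens).
Lemma hom0 : f U 0 = 0. Proof. exact: semilinear0 (homL f (U := U)). Qed.
Lemma homZ a s : f U (a *: s) = a *: f U s.
Proof. by have := homL f a s 0; rewrite hom0 !addr0. Qed.
Lemma homD s t : f U (s + t) = f U s + f U t.
Proof. by have := homL f 1 s t; rewrite !scale1r. Qed.
Lemma homN s : f U (- s) = - f U s.
Proof. by rewrite -!scaleN1r homZ. Qed.
Lemma homB s t : f U (s - t) = f U s - f U t.
Proof. by rewrite homD homN. Qed.
End Hom.

Section Bilin.
Variables (F G H : sheafMod O) (b : bilin F G H) (U : opens).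
Lemma bilinZl a s t : b U (a *: s) t = a *: b U s t.
Proof.
have b0 : b U 0 t = 0 by apply: (@semilinear0 _ _ _ (b U ^~ t)) => *; exact: bilinLl.
by have := bilinLl b a s 0 t; rewrite b0 !addr0.
Qed.
Lemma bilinZr a s t : b U s (a *: t) = a *: b U s t.
Proof.
have b0 : b U s 0 = 0 by apply: (@semilinear0 _ _ _ (b U s)) => *; exact: bilinLr.
by have := bilinLr b a s t 0; rewrite b0 !addr0.
Qed.
End Bilin.

Definition happ (F G : sheafMod O) U (p : sheafHom F G U) V (h : V `<=` U) : F V -> G V :=
  fun s => nmap (proj1_sig p) h s.

Section SheafHom.
Variables (F G : sheafMod O) (U : opens).
Implicit Types p q : sheafHom F G U.
Lemma happL p V (h : V `<=` U) a s t : happ p h (a *: s + t) = a *: happ p h s + happ p h t.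
Proof. exact: (asboolW (proj2_sig p)). Qed.
Lemma happZ p V (h : V `<=` U) a s : happ p h (a *: s) = a *: happ p h s.
Proof. by have := happL p h a s 0; rewrite (semilinear0 (happL p h)) !addr0. Qed.
Lemma happ_res p V W (h : V `<=` U) (k : W `<=` V) (l : W `<=` U) s :
  happ p l (mres k s) = mres k (happ p h s).
Proof.
by rewrite (Prop_irrelevance l (subset_trans k h)); exact: (nmap_nat (proj1_sig p) h k s).
Qed.
Lemma happ_mres p V W (h : V `<=` U) (k : W `<=` V) (l : W `<=` U) s :
  happ (mres h p) k s = happ p l s.
Proof. by rewrite (Prop_irrelevance l (subset_trans k h)). Qed.
Lemma happ_lin p q a V (h : V `<=` U) s :
  happ (a *: p + q) h s = rres O h a *: happ p h s + happ q h s.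
Proof. by []. Qed.
Lemma happ_ext p q : (forall V (h : V `<=` U) s, happ p h s = happ q h s) -> p = q.
Proof. by move=> pq; apply: val_inj; apply: natMapP => V h s; exact: pq. Qed.
End SheafHom.

Definition mksheafHom (F G : sheafMod O) U (p : forall V, V `<=` U -> F V -> G V)
  (pn : forall V W (h : V `<=` U) (k : W `<=` V) s,
    p W (subset_trans k h) (mres k s) = mres k (p V h s))
  (pL : forall V (h : V `<=` U) a s t, p V h (a *: s + t) = a *: p V h s + p V h t) :
  sheafHom F G U :=
  exist _ (NatMap pn : natMapSheaf F G U) (asboolT (pL : is_lin (NatMap pn : natMapSheaf F G U))).

(** By injectivity the local preimages agree on overlaps, hence glue. *)
Lemma hom_local_image (F G : sheafMod O) (f : Defs.hom F G) : (forall U, injective (f U)) ->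
  forall U (s : G U),
    locally (fun (V : opens) (h : V `<=` U) => exists t : F V, f V t = mres h s) ->
  exists t : F U, f U t = s.
Proof.
move=> fI U s loc.
pose I := {V : opens | exists h : V `<=` U, exists t : F V, f V t = mres h s}.
have h (i : I) : sval i `<=` U by case: i => /= V [].
have tP (i : I) : exists t : F (sval i), f _ t = mres (h i) s.
  case: i h => /= V [k [t e]] h; exists t; rewrite e; exact: mres_irr.
pose t i := sval (cid (tP i)).
have tE i : f _ (t i) = mres (h i) s := svalP (cid (tP i)).
have cov : U `<=` \bigcup_(i : I) sval i.
  move=> x /loc[V [k [Vx e]]].
  by exists (exist _ V (ex_intro _ k e) : I).
have [|u [uE _]] := mres_sheaf h cov (s := t).
  move=> i j W hi hj; apply: fI; rewrite !hom_nat !tE !mres_comp; exact: mres_irr.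
exists u; apply: mres_sep => x /cov[i _ Vx]; exists (sval i), (h i); split=> //.
by rewrite -hom_nat uE tE.
Qed.

End ModuleMaps.

Section Twist.
Variable K : closedFieldType.
Notation opens := (opens (proj3 K)).
Notation O := (strO K).
Implicit Types U V W : opens.

Lemma xpow_regular i k U : in_chart i U -> regular k (fun v : cone U => sval v 0 i ^ k).
Proof.
have Xh n : ('X_i ^+ n : {mpoly K[4]}) \is n.-homog.
  by have := dhomogMn n (homogX K i); rewrite mul1n.
move=> Ui; case: k => n.
  apply: (fraction_regular (Xh n) (dhomog1 _ _)); first by right; rewrite add0r.
  by move=> v; rewrite meval1 rmorphXn /= mevalXU divr1 oner_neq0.
apply: (fraction_regular (dhomog1 _ _) (Xh n.+1)); first by right; rewrite NegzE subrr.
move=> v; rewrite meval1 rmorphXn /= mevalXU div1r expf_neq0 //; exact: Ui.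
Qed.

Definition xpow i k U (Ui : in_chart i U) : OP K k U := mksec (xpow_regular k Ui).

Lemma xpow_res i k U V (h : V `<=` U) (Ui : in_chart i U) (Vi : in_chart i V) :
  mres h (xpow k Ui) = xpow k Vi.
Proof. exact: secfun_inj. Qed.

Variables (k l : int) (kl : k + l = 0).

Lemma pair_regular U (t : OP K k U) (r : OP K l U) : regular 0 (secfun t * secfun r).
Proof. by rewrite -kl; apply: regularM; exact: secfun_regular. Qed.
Definition pairOP U (t : OP K k U) (r : OP K l U) : O U := mkfun (pair_regular t r).

Lemma pairOPE U (t : OP K k U) (r : OP K l U) v :
  ofun (pairOP t r) v = secfun t v * secfun r v.
Proof. by []. Qed.

Lemma pairOP_xpow i U (Ui : in_chart i U) (t : OP K k U) :
  t = pairOP t (xpow l Ui) *: xpow k Ui.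
Proof.
apply: secfun_inj => v; rewrite secfunZ pairOPE !secfun_mk.
by rewrite -mulrA -expfzDr ?(Ui v) // addrC kl expr0z mulr1.
Qed.

Lemma pairOP_xpowr i U (Ui : in_chart i U) (r : OP K l U) :
  r = pairOP (xpow k Ui) r *: xpow l Ui.
Proof.
apply: secfun_inj => v; rewrite secfunZ pairOPE !secfun_mk.
by rewrite mulrAC -expfzDr ?(Ui v) // kl expr0z mul1r.
Qed.

Lemma pairOP_res U V (h : V `<=` U) (t : OP K k U) (r : OP K l U) :
  rres O h (pairOP t r) = pairOP (mres h t) (mres h r).
Proof. exact: ofun_inj. Qed.

Lemma pairOP_linl U a (t t' : OP K k U) (r : OP K l U) :
  pairOP (a *: t + t') r = a * pairOP t r + pairOP t' r.
Proof.
by apply: ofun_inj => v; rewrite ofunD ofunM !pairOPE secfunD secfunZ mulrDl mulrA.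
Qed.

Lemma pairOP_linr U a (t : OP K k U) (r r' : OP K l U) :
  pairOP t (a *: r + r') = a * pairOP t r + pairOP t r'.
Proof.
by apply: ofun_inj => v; rewrite ofunD ofunM !pairOPE secfunD secfunZ; ring.
Qed.

Variables (F H : sheafMod O).

Section Pairing.
Variables (U : opens) (s : F U) (t : OP K k U).
(** The tensor of [s] and [t] acts by [r |-> (t * r) s], with [t * r] in [O(k + l) = O]. *)
Definition twist_pair_fun V (h : V `<=` U) (r : OP K l V) : F V :=
  pairOP (mres h t) r *: mres h s.
Lemma twist_pair_nat V W (h : V `<=` U) (m : W `<=` V) r :
  twist_pair_fun (subset_trans m h) (mres m r) = mres m (twist_pair_fun h r).
Proof. by rewrite /twist_pair_fun mresZ pairOP_res !mres_comp. Qed.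
Lemma twist_pair_lin V (h : V `<=` U) a r r' :
  twist_pair_fun h (a *: r + r') = a *: twist_pair_fun h r + twist_pair_fun h r'.
Proof. by rewrite /twist_pair_fun pairOP_linr scalerDl scalerA. Qed.
Definition twist_pair : sheafHom (OP K l) F U := mksheafHom twist_pair_nat twist_pair_lin.
Lemma twist_pairE V (h : V `<=` U) r : happ twist_pair h r = pairOP (mres h t) r *: mres h s.
Proof. by []. Qed.
End Pairing.

Lemma twist_pair_bilinl U a (s s' : F U) (t : OP K k U) :
  twist_pair (a *: s + s') t = a *: twist_pair s t + twist_pair s' t.
Proof.
apply: happ_ext => V h r; rewrite happ_lin !twist_pairE mresL scalerDr !scalerA.
by rewrite mulrC.
Qed.

Lemma twist_pair_bilinr U a (s : F U) (t t' : OP K k U) :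
  twist_pair s (a *: t + t') = a *: twist_pair s t + twist_pair s t'.
Proof.
apply: happ_ext => V h r; rewrite happ_lin !twist_pairE mresL pairOP_linl.
by rewrite scalerDl scalerA.
Qed.

Lemma twist_pair_res U V (h : V `<=` U) (s : F U) (t : OP K k U) :
  twist_pair (mres h s) (mres h t) = mres h (twist_pair s t).
Proof.
apply: happ_ext => W m r.
by rewrite (happ_mres _ h m (subset_trans m h)) !twist_pairE !mres_comp.
Qed.

Definition twist_bilin : bilin F (OP K k) (sheafHom (OP K l) F) :=
  Bilin twist_pair_bilinl twist_pair_bilinr twist_pair_res.

(** On a chart [x_i^k] and [x_i^l] are dual generators, so a homomorphism [p] corresponds to the
    tensor of [p (x_i^l)] and [x_i^k]. The value of [b] on this pair does not depend on the chart,
    and the local values glue. *)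
Lemma twist_untwist (b : bilin F (OP K k) H) : exists v : Defs.hom (sheafHom (OP K l) F) H,
  forall U (s : F U) (t : OP K k U), v U (twist_pair s t) = b U s t.
Proof.
pose loc U (p : sheafHom (OP K l) F U) V (h : V `<=` U) i (Vi : in_chart i V) : H V :=
  b V (happ p h (xpow l Vi)) (xpow k Vi).
have loc_res U p V W (h : V `<=` U) (m : W `<=` V) (n : W `<=` U) i
    (Vi : in_chart i V) (Wi : in_chart i W) :
    mres m (loc U p V h i Vi) = loc U p W n i Wi.
  by rewrite /loc -bilin_nat -(happ_res p h m n) !(xpow_res _ m Vi Wi).
have loc_chart U p V (h : V `<=` U) i (Vi : in_chart i V) j (Vj : in_chart j V) :
    loc U p V h i Vi = loc U p V h j Vj.
  rewrite /loc [xpow k Vi](pairOP_xpow Vj) bilinZr -bilinZl -happZ.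
  by rewrite -pairOP_xpowr.
have glue U p : {x : H U | forall i V (h : V `<=` U) (Vi : in_chart i V),
    mres h x = loc U p V h i Vi}.
  apply: cid; pose V i := opensI U (chart_open K i).
  have cov : U `<=` \bigcup_i V i.
    move=> L UL; have [w wL] := opens_cone UL; have [i wi] := cone_coord w.
    by exists i => //; split=> //; exact: mem_chart_open wi wL.
  have [|x [xE _]] := mres_sheaf (fun i => @opensI_subl K U (chart_open K i)) cov
      (s := fun i => loc U p _ (@opensI_subl _ _ _) i (@in_chartI K i U)).
    move=> i j W hi hj; have Wi := in_chart_sub hi (@in_chartI K i U).
    have Wj := in_chart_sub hj (@in_chartI K j U).
    have WU := subset_trans hi (@opensI_subl K U (chart_open K i)).
    by rewrite (loc_res _ _ _ _ _ _ WU _ _ Wi) (loc_res _ _ _ _ _ _ WU _ _ Wj).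
  exists x => i W h Wi; have WV : W `<=` V i.
    move=> L WL; split; first exact: h.
    by have [w wL] := opens_cone WL; exact: mem_chart_open (Wi w) wL.
  have := congr1 (mres WV) (xE i); rewrite (loc_res _ _ _ _ _ _ h _ _ Wi) => <-.
  by rewrite mres_comp; exact: mres_irr.
pose v U p : H U := sval (glue U p).
have vE U p i V (h : V `<=` U) (Vi : in_chart i V) : mres h (v U p) = loc U p V h i Vi.
  exact: (svalP (glue U p)).
have vL U a p q : v U (a *: p + q) = a *: v U p + v U q.
  apply: mres_sep_chart => i V h Vi.
  by rewrite mresL !(vE _ _ _ _ _ Vi) /loc happ_lin bilinLl.
have vN U V (h : V `<=` U) p : v V (mres h p) = mres h (v U p).
  apply: mres_sep_chart => i W m Wi.
  rewrite (vE _ _ _ _ _ Wi) mres_comp (vE _ _ _ _ _ Wi) /loc.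
  by rewrite (happ_mres p h m (subset_trans m h)).
exists (Defs.Hom vL vN) => U s t /=; apply: mres_sep_chart => i V h Vi.
rewrite (vE _ _ _ _ _ Vi) /loc twist_pairE bilinZl -bilinZr -pairOP_xpow.
exact: bilin_nat.
Qed.

(* [sheafHom (OP l) F] is a model of the twist [F (x) OP k]. *)
Lemma twist_model : is_twist F k H -> exists (b : bilin F (OP K k) H)
    (u : Defs.hom H (sheafHom (OP K l) F)),
  (forall U, injective (u U)) /\ forall U s t, u U (b U s t) = twist_pair s t.
Proof.
move=> [b bU]; exists b; have [u uE _] := bU _ twist_bilin; exists u; split=> // U.
have [v vE] := twist_untwist b; have [w _ wU] := bU H b.
have idL (V : opens) a (s t : H V) : idfun (a *: s + t) = a *: idfun s + idfun t by [].
have idN (V W : opens) (h : W `<=` V) (s : H V) : idfun (mres h s) = mres h (idfun s) by [].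
have vuL (V : opens) a (s t : H V) : v V (u V (a *: s + t)) = a *: v V (u V s) + v V (u V t).
  by rewrite !homL.
have vuN (V W : opens) (h : W `<=` V) (s : H V) : v W (u W (mres h s)) = mres h (v V (u V s)).
  by rewrite !hom_nat.
apply: (can_inj (g := v U)) => x.
(* Both [v] after [u] and the identity carry [b] to itself, so uniqueness in the universal property
   equates them with [w]; hence [u] is injective. *)
rewrite (_ : v U (u U x) = w U x); last first.
  by apply: (wU (Defs.Hom vuL vuN)) => V s t /=; rewrite uE vE.
by rewrite -(wU (Defs.Hom idL idN)).
Qed.

End Twist.

(** * The form of a distribution *)

Section FormOfDistribution.
Variables (K : closedFieldType) (d : int) (F : distribution K d).
Notation opens := (opens (proj3 K)).
Notation O := (strO K).
Notation T := (tangent_sheaf K).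
Notation I := (subSheaf (dist_ideal F)).
Implicit Types U V W : opens.

Definition ideal_val U (a : I U) : O U := proj1_sig a.

Lemma ideal_val_inj U (a b : I U) : ideal_val a = ideal_val b -> a = b.
Proof. by case: a b => [a pa] [b pb] /= ab; exact: eq_exist. Qed.

Lemma ideal_mul_linl k U a (s s' : I U) (t : OP K k U) :
  ideal_val (a *: s + s') *: t = a *: (ideal_val s *: t) + ideal_val s' *: t.
Proof. by rewrite scalerA -scalerDl. Qed.

Lemma ideal_mul_linr k U a (s : I U) (t t' : OP K k U) :
  ideal_val s *: (a *: t + t') = a *: (ideal_val s *: t) + ideal_val s *: t'.
Proof. by rewrite scalerDr !scalerA mulrC. Qed.

Lemma ideal_mul_res k U V (h : V `<=` U) (s : I U) (t : OP K k U) :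
  ideal_val (mres h s) *: mres h t = mres h (ideal_val s *: t).
Proof. by rewrite mresZ. Qed.

Definition ideal_mul k : bilin I (OP K k) (OP K k) :=
  Bilin (@ideal_mul_linl k) (@ideal_mul_linr k) (@ideal_mul_res k).

(** The form is the composite of [T -> I_Z(d + 2)], the model [Hom(O(-d - 2), I_Z)] and
    multiplication into [O(d + 2)]. The second clause records that its image fills [I_Z(d + 2)]
    locally; this links its zeros with [Z]. *)
Lemma distribution_form : exists om : Defs.hom T (OP K (d + 2)),
  (forall U D, om U D = 0 <-> exists s, dist_incl F U s = D) /\
  (forall U (a : O U) (t : OP K (d + 2) U), smem (dist_ideal F) a ->
    locally (fun V (h : V `<=` U) => exists D, om V D = mres h (a *: t))).
Proof.
have kl : (d + 2) + (- (d + 2)) = 0 by rewrite subrr.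
have [b [u [uI uE]]] := twist_model kl (dist_twistP F).
have [m mE] := twist_untwist kl (ideal_mul (d + 2)).
have [iI iK pS] := dist_exact F.
(* On a chart [p] is a single tensor of some [a] with [x_i^(d + 2)], and [x_i] is nonzero there. *)
have mI U p : m U p = 0 -> p = 0.
  move=> mp; apply: mres_sep_chart => i V h Vi; rewrite mres0.
  set q := mres h p; have mq : m V q = 0 by rewrite /q hom_nat mp mres0.
  pose a := happ q (@subset_refl _ V) (xpow (- (d + 2)) Vi).
  have qE : q = twist_pair kl a (xpow (d + 2) Vi).
    apply: happ_ext => W n r; have Wi := in_chart_sub n Vi.
    rewrite twist_pairE (xpow_res _ n Vi Wi) -(happ_res q _ _ n) (xpow_res _ n Vi Wi).
    by rewrite -happZ -pairOP_xpowr.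
  move: mq; rewrite qE mE => aE; suff -> : a = 0.
    apply: happ_ext => W n r; rewrite twist_pairE mres0 scaler0; exact: esym.
  apply: ideal_val_inj; apply: ofun_inj => v.
  have /(congr1 (fun s => secfun s v)) := aE; rewrite secfunZ secfun0 secfun_mk => /eqP.
  by rewrite mulf_eq0 expfz_eq0 (negPf (Vi v)) andbF orbF => /eqP.
pose g U (D : T U) := m U (u U (dist_proj F U D)).
have gL U a (D E : T U) : g U (a *: D + E) = a *: g U D + g U E by rewrite /g !homL.
have gN U V (h : V `<=` U) (D : T U) : g V (mres h D) = mres h (g U D).
  by rewrite /g !hom_nat.
exists (Defs.Hom gL gN); split=> [U D|U a t Ia] /=.
  have gE : g U D = 0 <-> dist_proj F U D = 0.
    split=> [/mI e|e]; last by rewrite /g e !hom0.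
    by apply: uI; rewrite e hom0.
  rewrite gE iK; split; first exact: hom_local_image.
  move=> [s <-] L UL; exists U, (@subset_refl _ U); split=> //.
  by exists s; rewrite mres_id.
pose a' : I U := exist _ a (asboolT Ia).
move=> L UL; have [V [h [VL [D DE]]]] := pS U (b U a' t) L UL.
exists V, h; split=> //; exists D.
by rewrite /g DE !hom_nat uE mE.
Qed.

(** Seen in [Hom(O(1), T_F)], a section of [T_F(-1)] becomes a map from [O(1)] to [T] whose image
    lies in the kernel of the form. *)
Lemma section_of_twist (om : Defs.hom T (OP K (d + 2))) :
  (forall U D, om U D = 0 <-> exists s, dist_incl F U s = D) ->
  has_section (dist_tangent F) (0 - 1) ->
  exists2 psi : Defs.hom (OP K 1) T, (forall U r, om U (psi U r) = 0) &
    exists U r, psi U r != 0.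
Proof.
move=> omK [H Ht [s s0]]; have kl : (0 - 1) + 1 = 0 :> int by [].
have [b [u [uI _]]] := twist_model kl Ht.
have [iI _ _] := dist_exact F.
pose p := u _ s; have p0 : p <> 0 by move=> e; apply/s0/uI; rewrite -/p e hom0.
have hT U : U `<=` opensT (proj3 K) by [].
pose g U r : T U := dist_incl F U (happ p (hT U) r).
have gL U a (r r' : OP K 1 U) : g U (a *: r + r') = a *: g U r + g U r'.
  by rewrite /g happL homL.
have gN U V (h : V `<=` U) (r : OP K 1 U) : g V (mres h r) = mres h (g U r).
  by rewrite /g (happ_res p (hT U) h) hom_nat.
exists (Defs.Hom gL gN) => [U r|]; first by apply/omK; exists (happ p (hT U) r).
apply: contrapT => nz; apply: p0; apply: happ_ext => V h r.
have gV : g V r = 0 by apply: contrapT => /eqP gr; apply: nz; exists V, r.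
rewrite (Prop_irrelevance h (hT V)); apply: iI; rewrite -[LHS]/(g V r) gV.
by rewrite [X in dist_incl F V X](_ : _ = 0) ?hom0.
Qed.

End FormOfDistribution.

(** * Coefficients of the twisted 1-form *)

Section FormCoefficients.
Variable K : closedFieldType.
Notation opens := (opens (proj3 K)).
Notation O := (strO K).
Notation T := (tangent_sheaf K).
Implicit Types U V W : opens.

Definition coord i U : OP K 1 U := mksec (@regular_poly K U 1 'X_i (homogX K i)).

Lemma coordE i U v : secfun (coord i U) v = sval v 0 i.
Proof. by rewrite secfun_mk mevalXU. Qed.

Lemma coord_res i U V (h : V `<=` U) : mres h (coord i U) = coord i V.
Proof. exact: secfun_inj. Qed.

Lemma coord_multiple i U (Ui : in_chart i U) (r : OP K 1 U) :
  exists2 a : O U, r = a *: coord i U & forall v, ofun a v = secfun r v / sval v 0 i.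
Proof.
have kl : 1 + (-1) = 0 :> int by [].
exists (pairOP kl r (xpow (-1) Ui)); last by move=> v; rewrite pairOPE secfun_mk.
rewrite {1}(pairOP_xpow kl Ui r); congr (_ *: _).
by apply: secfun_inj => v; rewrite coordE.
Qed.

Lemma vfieldZ U a (w : 'I_4 -> OP K 1 U) : vfield (fun j => a *: w j) = a *: vfield w.
Proof.
apply: tangent_ext => V h f; apply: ofun_inj => v.
rewrite dappZl ofunM !vfieldE mulr_sumr; apply: eq_bigr => j _.
by rewrite secfunZ ofun_res mulrA.
Qed.

Definition single U (l : 'I_4) (r : OP K 1 U) (j : 'I_4) : OP K 1 U := if j == l then r else 0.

Lemma vfield_single U l (r : OP K 1 U) V (h : V `<=` U) f v :
  ofun (dapp (vfield (single l r)) h f) v =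
  secfun r (cone_incl h v) * pderiv l (ofun f) v.
Proof.
rewrite vfieldE (bigD1 l) //= /single eqxx big1 ?addr0 // => j /negPf ->.
by rewrite secfun0 mul0r.
Qed.

Lemma vfield_sum U (w : 'I_4 -> OP K 1 U) : vfield w = \sum_l vfield (single l (w l)).
Proof.
apply: tangent_ext => V h f; apply: ofun_inj => v; rewrite vfieldE.
have -> : ofun (dapp (\sum_l vfield (single l (w l))) h f) v =
    \sum_l ofun (dapp (vfield (single l (w l))) h f) v.
  by elim/big_rec2: _ => [|l D x _ <-]; rewrite ?dapp0l ?ofun0 // dappDl ofunD.
by apply: eq_bigr => l _; rewrite vfield_single.
Qed.

Lemma hom_sum (F G : sheafMod O) (f : Defs.hom F G) U (I : finType) (s : I -> F U) :
  f U (\sum_i s i) = \sum_i f U (s i).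
Proof. by elim/big_rec2: _ => [|i x y _ <-]; rewrite ?hom0 // homD. Qed.

Lemma opensT_cone (v : 'rV[K]_4) : v != 0 -> exists w : cone (opensT (proj3 K)), sval w = v.
Proof. by move=> v0; apply: (cone_of v0 (L := line_of v0)) => //; exact: mem_line_of. Qed.

Lemma opensT_neq0 : opensT (proj3 K) !=set0.
Proof.
have v0 : (\row_i (i == ord0)%:R : 'rV[K]_4) != 0.
  by apply/rV0Pn; exists ord0; rewrite mxE eqxx oner_neq0.
by exists (line_of v0).
Qed.

Lemma chart_open_neq0 i : chart_open K i !=set0.
Proof.
have v0 : (\row_j (j == i)%:R : 'rV[K]_4) 0 i != 0 by rewrite mxE eqxx oner_neq0.
have r0 : (\row_j (j == i)%:R : 'rV[K]_4) != 0 by apply/rV0Pn; exists i.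
by exists (line_of r0); apply: mem_chart_open v0 (mem_line_of r0).
Qed.

Lemma opensT_polynomial k (s : OP K k (opensT (proj3 K))) :
  exists p m, [/\ p \is m.-homog, p = 0 \/ m%:Z = k & forall v, secfun s v = p.@[sval v 0]].
Proof.
apply: (regular_polynomial (i := ord0) (j := ord_max)) => //; first exact: secfun_regular.
move=> v v0; apply: opensT_cone; apply/rV0Pn.
by case: v0; [exists ord0|exists ord_max].
Qed.

Section Form.
Variables (k : int) (om : Defs.hom T (OP K k)).

(** The fields [x_i d/dx_j] are global, so the form takes them to polynomials [W (i, j)] of degree
    [k]. Linearity over [O] gives [W (i, j) * x_l = W (l, j) * x_i], so [W (i, j)] is [x_i] times
    some [A_j], of degree [k - 1] unless it is zero. *)
Lemma form_coefficients : exists (A : 'I_4 -> {mpoly K[4]}) (n : nat),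
  [/\ forall j, A j \is n.-homog,
      (forall j, A j = 0) \/ n%:Z + 1 = k,
      \sum_j 'X_j * A j = 0 &
      forall U (w : 'I_4 -> OP K 1 U) v,
        secfun (om U (vfield w)) v = \sum_j secfun (w j) v * (A j).@[sval v 0]].
Proof.
pose E i j U := vfield (single j (coord i U)).
have E_res i j U V (h : V `<=` U) : mres h (E i j U) = E i j V.
  rewrite /E vfield_res; congr vfield; apply/funext => l; rewrite /single.
  by case: eqP => _; rewrite ?coord_res ?mres0.
have /choice[W /choice[a WP]] : forall ij : 'I_4 * 'I_4, exists p (m : nat),
    [/\ p \is m.-homog, p = 0 \/ m%:Z = k &
      forall U v, secfun (om U (E ij.1 ij.2 U)) v = p.@[sval v 0]].
  move=> [i j]; have [p [m [pm mk pE]]] := opensT_polynomial (om _ (E i j _)).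
  exists p, m; split=> // U v; have h : U `<=` opensT (proj3 K) by [].
  by rewrite /= -(E_res _ _ _ _ h) hom_nat secfun_res pE.
have WX j i l : W (i, j) * 'X_l = W (l, j) * 'X_i.
  apply/eqP; rewrite -subr_eq0; apply/eqP/(cone_vanish (chart_open_neq0 i)) => v.
  have [_ _ Wi] := WP (i, j); have [_ _ Wl] := WP (l, j).
  have [c cE cv] := coord_multiple (@in_chart_open K i) (coord l (chart_open K i)).
  have vi : sval v 0 i != 0 := in_chart_open v.
  rewrite mevalB !mevalM !mevalXU -(Wi (chart_open K i)) -(Wl (chart_open K i)) /=.
  have -> : E l j (chart_open K i) = c *: E i j (chart_open K i).
    rewrite /E -vfieldZ; congr vfield; apply/funext => m; rewrite /single.
    by case: eqP => _; rewrite ?scaler0.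
  by rewrite homZ secfunZ cv coordE mulrAC divfK // mulrC subrr.
have /choice[A AE] : forall j, exists g, forall i, W (i, j) = g * 'X_i.
  move=> j; apply: (proportional_multiple (@mpoly_factorial K 4)) => //.
  - by exists ord0; exact: mpolyXi_neq0.
  - move=> t tp t0 /(fun f => (f ord0, f ord_max))[d0].
    exact: (prime_not_divides_var tp _ d0).
have om_vfield U (w : 'I_4 -> OP K 1 U) v :
    secfun (om U (vfield w)) v = \sum_j secfun (w j) v * (A j).@[sval v 0].
  have [i vi] := cone_coord v; have [u uv] := cone_chart vi.
  rewrite -uv -secfun_res -hom_nat vfield_res vfield_sum hom_sum.
  have -> : forall s : 'I_4 -> OP K k _, secfun (\sum_l s l) u = \sum_l secfun (s l) u.
    by move=> s; elim/big_rec2: _ => [|l x y _ <-]; rewrite ?secfun0 ?secfunD.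
  apply: eq_bigr => j _; rewrite -secfun_res.
  have [c cE cv] := coord_multiple (@in_chartI K i U) (mres (@opensI_subl _ _ _) (w j)).
  have -> : vfield (single j (mres (@opensI_subl _ _ _) (w j))) = c *: E i j _.
    rewrite /E -vfieldZ; congr vfield; apply/funext => m; rewrite /single.
    by case: eqP => _; rewrite ?scaler0.
  have [_ _ Wi] := WP (i, j); rewrite homZ secfunZ Wi AE mevalM mevalXU cv.
  by rewrite [(A j).@[_] * _]mulrC mulrA divfK //; exact: (in_chartI u).
(* The Euler field induces the zero derivation. *)
have XA : \sum_j 'X_j * A j = 0.
  apply: (cone_vanish opensT_neq0) => v.
  have e0 : vfield (fun j => coord j (opensT (proj3 K))) = vfield (fun=> 0).
    by apply/vfield_eq => u i l; rewrite !coordE !secfun0 !subr0 mulrC.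
  have /(congr1 (fun D => secfun (om _ D) v)) := e0; rewrite !om_vfield.
  rewrite [RHS]big1 => [<-|j _]; last by rewrite secfun0 mul0r.
  by rewrite raddf_sum; apply: eq_bigr => j _; rewrite coordE /= mevalM mevalXU.
have AW i j : W (i, j) = A j * 'X_i by rewrite AE.
(* Only a nonzero coefficient determines the degree; [n] is set to 0 when all of them vanish. *)
have [A0|/existsNP[j0 /eqP A0]] := pselect (forall j, A j = 0).
  exists A, 0%N; split=> //; first by move=> j; rewrite A0; exact: dhomog0.
  by left.
have W0 j : A j != 0 -> W (ord0, j) != 0 by move=> Aj; rewrite AW mulf_neq0 // mpolyXi_neq0.
have Wk j : A j != 0 -> (a (ord0, j))%:Z = k.
  by move=> /W0/eqP Wj; have [_ [//|]] := WP (ord0, j).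
have Ah j : A j != 0 -> exists2 n : nat, (A j \is n.-homog) & n%:Z + 1 = k.
  move=> Aj; have [Wh _ _] := WP (ord0, j); have WN := W0 j Aj; move: Wh WN; rewrite AW => Wh WN.
  have [n nh] := dhomog_factor WN Wh; exists n => //.
  rewrite -(Wk j Aj) -(dhomog_uniq WN (dhomogM nh (homogX K ord0)) Wh) addn1.
  by rewrite -addn1 PoszD.
have [n nh nk] := Ah j0 A0; exists A, n; split=> //; last by right.
move=> j; have [->|Aj] := eqVneq (A j) 0; first exact: dhomog0.
have [n' nh' nk'] := Ah j Aj; suff -> : n = n' by [].
by move: nk; rewrite -nk' => /addIr[].
Qed.

End Form.
End FormCoefficients.

Lemma homog1_eval n (R : comNzRingType) (p : {mpoly R[n]}) v : p \is 1.-homog ->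
  p.@[v] = \sum_i p@_U_(i) * v i.
Proof.
move=> p1; have pE : p = \sum_i p@_U_(i) *: 'X_i; last first.
  rewrite {1}pE raddf_sum /=; apply: eq_bigr => i _; by rewrite mevalZ mevalXU.
apply/mpolyP => m; rewrite raddf_sum /=; under eq_bigr do rewrite mcoeffZ.
have [m1|m1] := eqVneq (mdeg m) 1%N; last first.
  rewrite (dhomog_nemf_coeff p1) // big1 // => i _; rewrite mcoeffX.
  by rewrite (_ : (U_(i) == m)%MM = false) ?mulr0 //; apply: contraNF m1 => /eqP <-; rewrite mdeg1.
move/eqP: m1; rewrite mdeg_eq1 => /existsP[i /eqP ->].
rewrite (bigD1 i) //= mcoeffXU eqxx mulr1 big1 ?addr0 // => j /negPf ji.
by rewrite mcoeffXU ji mulr0.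
Qed.

(* Cohomological content: [H^0(T(-1)) = K^4], the constant vector fields. *)
Lemma plucker_linear (K : fieldType) (M : 'I_4 -> 'I_4 -> {mpoly K[4]}) :
  (forall i j, i != j -> M i j \is 1.-homog) ->
  (forall i j, i != j -> M j i = - M i j) ->
  (forall i j k, i != j -> j != k -> i != k ->
     'X_k * M i j + 'X_i * M j k + 'X_j * M k i = 0) ->
  exists e : 'I_4 -> K, forall i j, i != j -> M i j = e j *: 'X_i - e i *: 'X_j.
Proof.
move=> M1 MN MP.
pose m i j l := (M i j)@_U_(l).
have mE i j v : i != j -> (M i j).@[v] = \sum_l m i j l * v l.
  by move=> ij; apply: homog1_eval; exact: M1.
have md i j (c : 'I_4) : i != j -> (M i j).@[fun l => (l == c)%:R] = m i j c.
  move=> ij; rewrite mE // (bigD1 c) //= eqxx mulr1 big1 ?addr0 // => l /negPf ->.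
  by rewrite mulr0.
(* Evaluation of the Plücker relation at the [k]-th basis vector: [M i j] involves [x_i] and [x_j]
   only. *)
have m0 i j k : i != j -> j != k -> i != k -> m i j k = 0.
  move=> ij jk ik; have /(congr1 (meval (fun l => (l == k)%:R))) := MP i j k ij jk ik.
  rewrite !mevalD !mevalM !mevalXU meval0 eqxx (negPf ik) (negPf jk) !mul0r !addr0 mul1r.
  by rewrite md.
(* Evaluation at the sum of the [i]-th and [k]-th basis vectors: the coefficient of [x_i] in [M i j]
   depends on [j] alone. *)
have mik i j k : i != j -> j != k -> i != k -> m i j i = m k j k.
  move=> ij jk ik.
  have /(congr1 (meval (fun l => (l == i)%:R + (l == k)%:R))) := MP i j k ij jk ik.
  rewrite !mevalD !mevalM !mevalXU meval0.
  have -> : (k == i)%:R + (k == k)%:R = 1 :> K by rewrite eqxx eq_sym (negPf ik) add0r.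
  have -> : (i == i)%:R + (i == k)%:R = 1 :> K by rewrite eqxx (negPf ik) addr0.
  have -> : (j == i)%:R + (j == k)%:R = 0 :> K by rewrite eq_sym (negPf ij) (negPf jk) addr0.
  have sumE (a b : 'I_4) : a != b ->
      (M a b).@[fun l => (l == i)%:R + (l == k)%:R] = m a b i + m a b k.
    move=> ab; rewrite -!md // !mE // -big_split; apply: eq_bigr => l _.
    by rewrite mulrDr.
  have kj : k != j by rewrite eq_sym.
  have ki : k != i by rewrite eq_sym.
  rewrite !sumE // !mul0r !mul1r addr0 (m0 i j k) // (m0 j k i) 1?eq_sym //.
  rewrite addr0 add0r; have -> : m j k k = - m k j k by rewrite /m (MN k j) // mcoeffN.
  by move/eqP; rewrite subr_eq0 => /eqP.
(* An auxiliary index other than [j]; by [mik] any other one would give the same [e j]. *)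
pose o (j : 'I_4) : 'I_4 := lift j (ord0 : 'I_3).
have oj j : o j != j by rewrite eq_sym neq_lift.
pose e j := m (o j) j (o j).
have me i j : i != j -> m i j i = e j.
  move=> ij; have [->//|io] := eqVneq i (o j).
  by apply: mik => //; rewrite eq_sym oj.
exists e => i j ij; have ji : j != i by rewrite eq_sym.
apply/mpolyP => w; have [w1|w1] := eqVneq (mdeg w) 1%N; last first.
  have w0 c : (U_(c) == w)%MM = false by apply: contraNF w1 => /eqP <-; rewrite mdeg1.
  by rewrite mcoeffB !mcoeffZ !mcoeffX !w0 !mulr0 subrr (dhomog_nemf_coeff (M1 _ _ ij)).
move/eqP: w1; rewrite mdeg_eq1 => /existsP[l /eqP ->].
rewrite mcoeffB !mcoeffZ !mcoeffXU -/(m i j l).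
have [<-|il] := eqVneq i l; first by rewrite mulr1 (negPf ji) mulr0 subr0 me.
have [<-|jl] := eqVneq j l; last by rewrite !mulr0 subrr m0.
by rewrite mulr0 mulr1 sub0r -(me j i) // /m (MN j i) // mcoeffN.
Qed.

(** * Sections of [T(-1)] are constant fields *)

Section ConstantFields.
Variable K : closedFieldType.
Notation opens := (opens (proj3 K)).
Notation O := (strO K).
Notation T := (tangent_sheaf K).
Implicit Types U V W : opens.
Variable psi : Defs.hom (OP K 1) T.

(** For [psi r = r * sum e_j d/dx_j] this is [(e_j x_i - e_i x_j) / x_i], so that multiplication by
    [x_i] gives a Plücker coordinate of [e] and [x]. *)
Definition slope i j V (Vi : in_chart i V) : O V :=
  dapp (psi V (coord i V)) (@subset_refl _ V) (chart j Vi).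

Lemma slope_res i j V W (h : W `<=` V) (Vi : in_chart i V) (Wi : in_chart i W) :
  rres O h (slope j Vi) = slope j Wi.
Proof.
rewrite /slope -(dapp_res _ (@subset_refl _ V) h h) (chart_res j h Vi Wi).
by rewrite -(coord_res i h) hom_nat (dapp_mres _ h (@subset_refl _ W) h).
Qed.

Lemma coord_change i j V (Vi : in_chart i V) : coord j V = chart j Vi *: coord i V.
Proof.
by apply: secfun_inj => v; rewrite secfunZ chartE !coordE divfK //; exact: Vi.
Qed.

Lemma dapp_coord i j V (Vi : in_chart i V) f :
  dapp (psi V (coord j V)) (@subset_refl _ V) f =
  chart j Vi * dapp (psi V (coord i V)) (@subset_refl _ V) f.
Proof. by rewrite (coord_change j Vi) homZ dappZl rres_id. Qed.

(** The Leibniz rule for [x_k / x_i] as the product of [x_k / x_j] and [x_j / x_i]; it becomes the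
    Plücker relation. *)
Lemma slope_plucker i j k V (Vi : in_chart i V) (Vj : in_chart j V) :
  slope k Vi = slope k Vj + chart k Vj * slope j Vi.
Proof.
rewrite /slope [in X in _ = X + _](dapp_coord j Vi).
have -> : chart k Vi = chart k Vj * chart j Vi.
  by apply: ofun_inj => v; rewrite ofunM !chartE mulrA divfK //; exact: Vj.
by rewrite dappM addrC.
Qed.

Lemma slope_self i V (Vi : in_chart i V) : slope i Vi = 0.
Proof. by rewrite /slope chart_id dapp1. Qed.

Lemma slope_opp i j V (Vi : in_chart i V) (Vj : in_chart j V) (v : cone V) :
  sval v 0 j * ofun (slope i Vj) v = - (sval v 0 i * ofun (slope j Vi) v).
Proof.
have /(congr1 (fun f => ofun f v)) := slope_plucker i Vi Vj.
rewrite slope_self ofunD ofunM ofun0 chartE => /esym/eqP; rewrite addr_eq0 => /eqP ->.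
by rewrite mulrN mulrA mulrCA divff ?mulr1 //; exact: Vj.
Qed.

(** By [slope_opp] the local sections on the charts of [x_i] and [x_j] glue to a section of [O(1)]
    outside the line [x_i = x_j = 0]; by extension across codimension two it is a linear form. *)
Lemma slope_polynomial i j : i != j -> exists p : {mpoly K[4]}, [/\ p \is 1.-homog,
  forall V (Vi : in_chart i V) (v : cone V), sval v 0 i * ofun (slope j Vi) v = p.@[sval v 0] &
  forall V (Vj : in_chart j V) (v : cone V), sval v 0 j * ofun (slope i Vj) v = - p.@[sval v 0]].
Proof.
move=> ij.
pose Ci := chart_open K i; pose Cj := chart_open K j.
pose U : opens := Opens (openU (oset_open Ci) (oset_open Cj)).
pose C b := if b then Ci else Cj.
have CU b : C b `<=` U by case: b => L; [left|right].
have cov : U `<=` \bigcup_b C b by move=> L [CL|CL]; [exists true|exists false].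
pose s b : OP K 1 (C b) := if b as b return OP K 1 (C b)
  then slope j (@in_chart_open K i) *: coord i Ci
  else - (slope i (@in_chart_open K j) *: coord j Cj).
have overlap W (h : W `<=` Ci) (k : W `<=` Cj) : mres h (s true) = mres k (s false).
  apply: secfun_inj => v; rewrite /s mresN !mresZ.
  rewrite -[RHS]/(- secfun _ v) !secfunZ.
  rewrite (slope_res _ h _ (in_chart_sub h (@in_chart_open K i))).
  rewrite (slope_res _ k _ (in_chart_sub k (@in_chart_open K j))).
  rewrite !coord_res !coordE ![_ * sval v 0 _]mulrC.
  by rewrite (slope_opp (in_chart_sub h (@in_chart_open K i))) opprK.
have [|t [tE _]] := mres_sheaf CU cov (s := s).
  move=> [] [] W hi hj; [exact: mres_irr|exact: overlap|exact/esym/overlap|exact: mres_irr].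
have [|p [m [pm m1 pE]]] := regular_polynomial ij (secfun_regular t).
  move=> v vij; have v0 : v != 0 by apply/rV0Pn; case: vij; [exists i|exists j].
  apply: (@cone_of K U v _ v0 _ (mem_line_of v0)).
  by case: vij => vi; [left|right]; apply: mem_chart_open vi (mem_line_of v0).
have Ei V (Vi : in_chart i V) (v : cone V) : sval v 0 i * ofun (slope j Vi) v = p.@[sval v 0].
  have h : V `<=` Ci.
    by move=> L VL; have [w wL] := opens_cone VL; exact: mem_chart_open (Vi w) wL.
  have /(congr1 (fun r => secfun (mres h r) v)) := tE true.
  rewrite [LHS]secfun_res [LHS]secfun_res pE /s mresZ secfunZ (slope_res _ h _ Vi).
  by rewrite coord_res coordE mulrC => ->.
have Ej V (Vj : in_chart j V) (v : cone V) : sval v 0 j * ofun (slope i Vj) v = - p.@[sval v 0].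
  have h : V `<=` Cj.
    by move=> L VL; have [w wL] := opens_cone VL; exact: mem_chart_open (Vj w) wL.
  have /(congr1 (fun r => secfun (mres h r) v)) := tE false.
  rewrite [LHS]secfun_res [LHS]secfun_res pE /s mresN mresZ (slope_res _ h _ Vj).
  by rewrite -[RHS]/(- secfun _ v) secfunZ coord_res coordE mulrC => ->; rewrite opprK.
exists p; split=> //; by case: m1 pm => [-> _|[->] //]; exact: dhomog0.
Qed.

Lemma twisted_field_constant : exists e : 'I_4 -> K, forall U r,
  psi U r = vfield (fun j => cstO U (e j) *: r).
Proof.
have /choice[M MP] : forall ij : 'I_4 * 'I_4, exists p : {mpoly K[4]}, ij.1 != ij.2 ->
    [/\ p \is 1.-homog,
    forall V (Vi : in_chart ij.1 V) (v : cone V),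
      sval v 0 ij.1 * ofun (slope ij.2 Vi) v = p.@[sval v 0] &
    forall V (Vj : in_chart ij.2 V) (v : cone V),
      sval v 0 ij.2 * ofun (slope ij.1 Vj) v = - p.@[sval v 0]].
  move=> [i j]; have [ij|ij] := eqVneq i j; first by exists 0.
  by have [p pP] := slope_polynomial ij; exists p.
have [||i j k ij jk ik|e eE] := @plucker_linear K (fun i j => M (i, j)).
- by move=> i j ij; have [] := MP (i, j) ij.
- move=> i j ij; have ji : j != i by rewrite eq_sym.
  have [_ _ E1] := MP (i, j) ij; have [_ E2 _] := MP (j, i) ji.
  apply/eqP; rewrite -subr_eq0 opprK; apply/eqP/(cone_vanish (chart_open_neq0 K j)) => v.
  by rewrite mevalD -(E2 _ (@in_chart_open K j)) (E1 _ (@in_chart_open K j)) /= addNr.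
- pose V := opensI (opensI (chart_open K i) (chart_open K j)) (chart_open K k).
  have V0 : V !=set0 by do ?apply: opensI_neq0; exact: chart_open_neq0.
  have Vk : in_chart k V by exact: in_chartI.
  have Vj : in_chart j V by apply: in_chart_sub (@in_chart_open K j) => ? [[]].
  have Vi : in_chart i V by apply: in_chart_sub (@in_chart_open K i) => ? [[]].
  have [_ Eij _] := MP (i, j) ij; have [_ Ejk _] := MP (j, k) jk.
  have ki : k != i by rewrite eq_sym.
  have [_ _ Eki] := MP (k, i) ki.
  apply: (cone_vanish V0) => v; rewrite !mevalD !mevalM !mevalXU.
  rewrite -(Eij V Vi) -(Ejk V Vj) -[(M (k, i)).@[_]]opprK -(Eki V Vi) /=.
  rewrite (slope_plucker k Vi Vj) ofunD ofunM chartE.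
  by field; exact: Vj.
exists e => U r; apply: mres_sep_chart => i V h Vi.
rewrite vfield_res -hom_nat; set r' := mres h r.
apply: (tangent_chart_ext (Ui := Vi)) => l; apply: ofun_inj => v.
have [c rE cv] := coord_multiple Vi r'.
rewrite [in LHS]rE homZ dappZl ofunM rres_id cv vfield_chart !cone_incl_id.
rewrite !mresZ !secfunZ.
have vi : sval v 0 i != 0 := Vi v.
have -> : ofun (rres O h (cstO U (e l))) v = e l by [].
have -> : ofun (rres O h (cstO U (e i))) v = e i by [].
have [<-|il] := eqVneq i l.
  by rewrite -/(slope i Vi) slope_self ofun0 mulr0 subrr mul0r.
have [_ E _] := MP (i, l) il; have := E V Vi v; rewrite /= eE // mevalB !mevalZ !mevalXU.
rewrite -/(slope l Vi) -/r' => El.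
apply: (mulfI vi); rewrite mulrCA El; field; exact: vi.
Qed.

End ConstantFields.

(** * Singular locus *)

Section Hypersurface.
Variable K : closedFieldType.
Implicit Types (f g t : {mpoly K[4]}) (L M : proj3 K).

Lemma closed_zeros (A : set (proj3 K)) : closed A ->
  exists2 S : set {mpoly K[4]}, (forall f, S f -> exists n : nat, f \is n.-homog) & A = zeros S.
Proof.
by move=> /closed_openC[S Sh AS]; exists S => //; exact: setC_inj.
Qed.

Lemma zeros1_closed n f : f \is n.-homog -> closed (zeros [set f]).
Proof. by move=> /openD_subproof/open_closedC; rewrite setCK. Qed.

Lemma zeros1P n f (v : 'rV[K]_4) L : f \is n.-homog -> v != 0 -> v \in val L ->
  zeros [set f] L <-> f.@[v 0] = 0.
Proof.
move=> fn v0 vL; split=> [|fv g w -> wL]; first by move=> /(_ f v erefl vL).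
have [c ->] := proj3_colinear v0 vL wL.
by rewrite (homog_scale _ _ fn) fv mulr0.
Qed.

Lemma homog_nullstellensatz_line n t g : prime_elt t -> t \is n.-homog ->
  ~ divides t g -> exists L v, [/\ v != 0, v \in val L, zeros [set t] L & g.@[v 0] != 0].
Proof.
move=> tp tn ntg; have [v [[i vi] tv gv]] := homog_nullstellensatz tp ntg.
have r0 := row_neq0 vi; exists (line_of r0), (\row_i v i); split=> //.
- exact: mem_line_of.
- by apply/(zeros1P tn r0 (mem_line_of r0)); rewrite meval_row.
- by rewrite meval_row.
Qed.

Variables (n : nat) (t : {mpoly K[4]}).
Hypotheses (tp : prime_elt t) (tn : t \is n.-homog).

Lemma vanish_divides f : (forall L v, zeros [set t] L -> v \in val L -> f.@[v 0] = 0) ->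
  divides t f.
Proof.
move=> ft; apply: contrapT => /(homog_nullstellensatz_line tp tn)[L [v [_ vL tL]]].
by rewrite (ft L v tL vL) eqxx.
Qed.

(** Otherwise some [f] vanishing on [A] and some [g] vanishing on [B] are not divisible by the prime
    [t], nor is their product; the Nullstellensatz gives a point of the hypersurface in neither [A]
    nor [B]. *)
Lemma hypersurface_irreducible : irreducible_set (zeros [set t]).
Proof.
split.
  have [|L [v [_ _ tL _]]] := @homog_nullstellensatz_line n t 1 tp tn; last by exists L.
  by move=> [c e]; have [/negP tu _] := tp; apply/tu/unitrPr; exists c; rewrite mulrC.
move=> A B /closed_zeros[S _ ->] /closed_zeros[S' _ ->] YAB.
apply: contrapT => /not_orP[/existsNP[L /not_implyP[tL AL]] /existsNP[M /not_implyP[tM BM]]].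
have /zerosCP[f [v [Sf vL fv]]] := AL; have /zerosCP[g [w [Sg wM gw]]] := BM.
have [|N [u [u0 uN tN]]] := @homog_nullstellensatz_line n t (f * g) tp tn.
  move=> /tp.2[] [c e].
    by move: fv; rewrite e mevalM (tL t v) // mulr0 eqxx.
  by move: gw; rewrite e mevalM (tM t w) // mulr0 eqxx.
rewrite mevalM mulf_eq0 negb_or => /andP[fu gu].
by have [/(_ f u Sf uN)/eqP|/(_ g u Sg uN)/eqP] := YAB N tN; rewrite ?(negPf fu) ?(negPf gu).
Qed.

(** A homogeneous [f] vanishing on [A] vanishes on the hypersurface, hence is [c * t]. As [A] is
    irreducible and not inside the hypersurface, [c] vanishes on [A] too, and descent on the size
    gives [f = 0]. *)
Lemma hypersurface_maximal (A : set (proj3 K)) : closed A -> irreducible_set A ->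
  zeros [set t] `<` A -> A = setT.
Proof.
move=> Ac [_ Ai] [tA nAt]; have [S Sh AS] := closed_zeros Ac.
suff f0 f m : f \is m.-homog -> A `<=` zeros [set f] -> f = 0.
  rewrite AS; apply/seteqP; split=> // L _ f v Sf vL.
  have [m fm] := Sh f Sf; rewrite (f0 f m) ?meval0 // AS.
  by move=> M AM g w -> wM; exact: AM.
have [s] := ubnP (msize f); elim: s f m => // s IH f m fs fm Af.
have [c fE] : divides t f by apply: vanish_divides => L v /tA/Af fL; exact: fL.
have [->//|f0] := eqVneq f 0; move: (f0); rewrite fE mulf_eq0 negb_or => /andP[c0 t0].
have [e ce] : exists e : nat, (c \is e.-homog).
  by apply: (@dhomog_factor _ _ m c t); rewrite -fE.
have [|||At|Ac'] := Ai (zeros [set t]) (zeros [set c]).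
- exact: zeros1_closed tn.
- exact: zeros1_closed ce.
- move=> L AL; have [v v0 vL] := proj3_vector L.
  have /(zeros1P fm v0 vL)/eqP := Af L AL; rewrite fE mevalM mulf_eq0 => /orP[]/eqP ?.
    by right; apply/(zeros1P ce v0 vL).
  by left; apply/(zeros1P tn v0 vL).
- by case: nAt.
- rewrite (IH c e _ ce Ac') ?mul0r //; move: fs; rewrite fE msizeM //.
  have := tp.1; rewrite mpoly_unitP.
  rewrite -!msize_poly_eq0 in c0 t0; move: c0 t0; move: (msize c) (msize t).
  by clear; lia.
Qed.

(** A chain of length two starting at the hypersurface would have the whole space in its middle. *)
Lemma hypersurface_codim : ~ codim_ge 2 (zeros [set t]).
Proof.
move=> /(_ _ (zeros1_closed tn) hypersurface_irreducible (@subset_refl _ _)).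
move=> [C [C0 Ci Cs]]; have [C1c C1i] := Ci 1%N isT.
have C1T : C 1%N = setT by apply: hypersurface_maximal => //; rewrite -C0; exact: Cs.
by have [_] := Cs 1%N isT; apply; rewrite C1T.
Qed.

End Hypersurface.

Lemma codim_geS (X : topologicalType) m (Z Z' : set X) : Z `<=` Z' -> codim_ge m Z' -> codim_ge m Z.
Proof. by move=> ZZ' Zm Y Yc Yi /subset_trans/(_ ZZ'); exact: Zm. Qed.

Section SingularLocus.
Variables (K : closedFieldType) (d : int) (F : distribution K d).
Notation opens := (opens (proj3 K)).
Notation O := (strO K).
Notation T := (tangent_sheaf K).
Implicit Types U V W : opens.
Variables (om : Defs.hom T (OP K (d + 2))) (A : 'I_4 -> {mpoly K[4]}) (n : nat).
Hypothesis om_image : forall U (a : O U) (t : OP K (d + 2) U), smem (dist_ideal F) a ->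
  locally (fun V (h : V `<=` U) => exists D, om V D = mres h (a *: t)).
Hypothesis omE : forall U (w : 'I_4 -> OP K 1 U) v,
  secfun (om U (vfield w)) v = \sum_j secfun (w j) v * (A j).@[sval v 0].
Hypothesis An : forall j, A j \is n.-homog.

(** If 1 were in the ideal near the point, some local field would be carried to [x_i^(d + 2)], which
    is nonzero there, while the form takes only the value 0 at a common zero of the [A j]. *)
Lemma coefficients_singular (L : proj3 K) (v : 'rV[K]_4) : v != 0 -> v \in val L ->
  (forall j, (A j).@[v 0] = 0) -> support_quotient (dist_ideal F) L.
Proof.
move=> v0 vL Av U UL I1; have [u uv] := cone_of v0 UL vL.
have [i ui] := cone_coord u; pose V := opensI U (chart_open K i).
have Vi : in_chart i V by exact: in_chartI.
have I1V : smem (dist_ideal F) (1 : O V).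
  have -> : 1 = rres O (@opensI_subl K U (chart_open K i)) 1 by rewrite rmorph1.
  exact: (smem_res (@opensI_subl K U (chart_open K i)) I1).
have VL : oset V L by split=> //; rewrite uv in ui; exact: mem_chart_open ui vL.
have [W [h [WL [D DE]]]] := om_image (xpow (d + 2) Vi) I1V VL.
have [w wv] := cone_of v0 WL vL.
have [r [rE _]] := tangent_vfield D (in_chart_sub h Vi).
have /(congr1 (fun s => secfun s w)) := DE; rewrite rE omE scale1r secfun_res secfun_mk.
rewrite big1 => [/esym/eqP|j _]; last by rewrite wv Av mulr0.
by rewrite expfz_eq0 (_ : sval (cone_incl h w) = v) // -uv (negPf ui) andbF.
Qed.

(** The zeros of a common prime factor would be a hypersurface inside [Z]. The factor is homogeneous
    because it divides a nonzero homogeneous [A j]. *)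
Lemma coefficients_coprime t : prime_elt t -> ~ forall j, divides t (A j).
Proof.
have homog_case m s : prime_elt s -> s \is m.-homog -> ~ forall j, divides s (A j).
  move=> sp sm sA; apply: (hypersurface_codim sp sm).
  apply: (codim_geS _ (@dist_codim _ _ F)) => L sL; have [v v0 vL] := proj3_vector L.
  apply: (coefficients_singular v0 vL) => j; have [c ->] := sA j.
  by rewrite mevalM (sL s v) // mulr0.
move=> tp tA; have [A0|/existsNP[j /eqP Aj]] := pselect (forall j, A j = 0).
  (* If all coefficients vanish, the prime 0 is a common factor, and its zero set is the whole
     space. *)
  have h0 : (0 : {mpoly K[4]}) \is 0.-homog by exact: dhomog0.
  apply: (homog_case _ _ (prime_elt0 _) h0) => j.
  by rewrite A0; exists 0; rewrite mul0r.
have [c cE] := tA j; have [m tm] : exists m : nat, (t \is m.-homog).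
  by apply: (@dhomog_factor _ _ n t c); rewrite mulrC -cE.
exact: homog_case tp tm tA.
Qed.

End SingularLocus.

Lemma solve_coefficient (K : fieldType) (e : 'I_4 -> K) (A : 'I_4 -> {mpoly K[4]}) i0 :
  e i0 != 0 -> \sum_j e j *: A j = 0 ->
  A i0 = - \sum_j (e (lift i0 j) / e i0) *: A (lift i0 j).
Proof.
move=> e0 eA; have : e i0 *: (A i0 + \sum_j (e (lift i0 j) / e i0) *: A (lift i0 j)) = 0.
  rewrite -[RHS]eA [RHS](bigD1_ord i0) //= scalerDr scaler_sumr; congr (_ + _).
  by apply: eq_bigr => j _; rewrite scalerA mulrC divfK.
by move/eqP; rewrite -mul_mpolyC mulf_eq0 mpolyC_eq0 (negPf e0) addr_eq0 => /eqP.
Qed.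

(** * The splitting by [e] and [B] *)

Section Splitting.
Variable K : closedFieldType.
Notation opens := (opens (proj3 K)).
Notation O := (strO K).
Notation T := (tangent_sheaf K).
Implicit Types U V W : opens.

Lemma meval_cross (a b : 'I_3 -> {mpoly K[4]}) j x :
  (cross a b j).@[x] = cross (fun i => (a i).@[x]) (fun i => (b i).@[x]) j.
Proof. by rewrite /cross mevalB !mevalM. Qed.

Variables (d : int) (e : 'I_4 -> K) (A : 'I_4 -> {mpoly K[4]}) (i0 : 'I_4) (m : nat)
  (B : 'I_3 -> {mpoly K[4]}).
Hypotheses (e0 : e i0 != 0) (dm : d = m%:Z).

Let c j := e (lift i0 j) / e i0.
Let A' j := A (lift i0 j).
Let y := lform i0 c.

Hypotheses (Bm : forall j, B j \is m.-homog) (AB : forall j, A' j = cross y B j).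
Hypotheses (eA : \sum_j e j *: A j = 0) (A'0 : exists j, A' j != 0).
Hypothesis A'cop : forall t, prime_elt t -> t != 0 -> ~ forall j, divides t (A' j).

(** The component at [i0] may be taken to be 0, because [B] matters only modulo [e], and
    [e i0 != 0]. *)
Let B' (l : 'I_4) : {mpoly K[4]} := if unlift i0 l is Some j then B j else 0.

Let B'_homog l : B' l \is m.-homog.
Proof. by rewrite /B'; case: unliftP => [j _|_]; rewrite ?Bm ?dhomog0. Qed.

Let e_lift j : e (lift i0 j) = c j * e i0.
Proof. by rewrite /c divfK. Qed.

Let Ai0 : A i0 = - \sum_j c j *: A' j := solve_coefficient e0 eA.

(** Subtracting [w i0 / e i0] times [e] from [w] removes the component at [i0] and, by [eA], does
    not change the pairing with [A]. *)
Let dot_reduce (w : 'I_4 -> K) x : \sum_j w j * (A j).@[x] =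
  \sum_j (w (lift i0 j) - c j * w i0) * (A' j).@[x].
Proof.
have AiE : (A i0).@[x] = - \sum_j c j * (A' j).@[x].
  by rewrite Ai0 mevalN (raddf_sum (meval x)); congr (- _); apply: eq_bigr => j _; exact: mevalZ.
rewrite (bigD1_ord i0) //= AiE mulrN mulr_sumr -sumrN -big_split; apply: eq_bigr => j _ /=.
by rewrite -/(A' j); ring.
Qed.

Section Theta.
Variable U : opens.

Lemma scaled_regular l (b : OP K (1 - d) U) :
  regular 1 ((fun v : cone U => (B' l).@[sval v 0]) * secfun b).
Proof.
have := regularM (@regular_poly K U _ _ (B'_homog l)) (secfun_regular b).
by have -> : m%:Z + (1 - d) = 1%R by rewrite dm addrC subrK.
Qed.

Definition theta_field (ab : direct_sum (OP K 1) (OP K (1 - d)) U) (l : 'I_4) : OP K 1 U :=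
  cstO U (e l) *: ab.1 + mksec (scaled_regular l ab.2).

Lemma theta_fieldE ab l v : secfun (theta_field ab l) v =
  e l * secfun ab.1 v + (B' l).@[sval v 0] * secfun ab.2 v.
Proof. by []. Qed.

Lemma theta_fieldL a s t l :
  theta_field (a *: s + t) l = a *: theta_field s l + theta_field t l.
Proof.
apply: secfun_inj => v.
change (e l * (ofun a v * secfun s.1 v + secfun t.1 v)
    + (B' l).@[sval v 0] * (ofun a v * secfun s.2 v + secfun t.2 v) =
  ofun a v * (e l * secfun s.1 v + (B' l).@[sval v 0] * secfun s.2 v)
    + (e l * secfun t.1 v + (B' l).@[sval v 0] * secfun t.2 v)).
ring.
Qed.

(** The lifted field is then a multiple of the Euler field, and eliminating this multiple gives the
    relation [rel] between [y] and [B]. Its vector product with [y] shows that [ab.2] times [x_i0]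
    kills every [A' j]; so [ab.2 = 0], and then [ab.1 = 0]. *)
Lemma vfield_theta_eq0 ab : vfield (theta_field ab) = 0 -> ab = 0.
Proof.
move=> th0; have {}th0 : vfield (theta_field ab) = vfield (fun=> 0).
  rewrite th0; apply: tangent_ext => V h f; apply: ofun_inj => v.
  rewrite dapp0l ofun0 vfieldE big1 // => j _; by rewrite secfun0 mul0r.
have rel v j : secfun ab.2 v * (B j).@[sval v 0] * sval v 0 i0 =
    e i0 * secfun ab.1 v * (y j).@[sval v 0].
  have /vfield_eq/(_ v i0 (lift i0 j)) := th0.
  rewrite !secfun0 !subr0 !theta_fieldE /B' liftK unlift_none meval0 mul0r addr0 e_lift.
  rewrite /y /lform mevalB mevalZ !mevalXU => E.
  rewrite mulrBr [X in _ = X - _](_ : _ = (e i0 * secfun ab.1 v) * sval v 0 (lift i0 j)) //.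
  by rewrite -E; ring.
have b0 v : secfun ab.2 v = 0.
  have [j Aj] := A'0; apply: (regular_dense (f := 'X_i0 * A' j) _ (secfun_regular ab.2)).
    by rewrite mulf_neq0 // mpolyXi_neq0.
  move=> u; rewrite mevalM mevalXU AB meval_cross.
  have [|/eqP + _] := @cross_comb _ (fun j => (y j).@[sval u 0]) (fun j => (B j).@[sval u 0])
      (- (e i0 * secfun ab.1 u)) (secfun ab.2 u * sval u 0 i0) _ j.
    by move=> l; rewrite mulrAC rel; ring.
  rewrite !mulf_eq0 => /orP[/orP[/eqP -> //|/eqP ->]|/eqP ->].
    by rewrite eqxx.
  by rewrite eqxx orbT.
have a0 v : secfun ab.1 v = 0.
  apply: (regular_dense (f := y ord0) _ (secfun_regular ab.1)); first exact: lform_neq0.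
  move=> u yu; have := rel u ord0; rewrite b0 !mul0r => /esym/eqP.
  by rewrite !mulf_eq0 (negPf e0) (negPf yu) orbF => /eqP.
case: ab {th0 rel} a0 b0 => a b /= a0 b0; congr (_, _); exact: secfun_inj.
Qed.

Lemma vfield_theta_onto (w : 'I_4 -> OP K 1 U) :
  (forall v, \sum_j secfun (w j) v * (A j).@[sval v 0] = 0) ->
  exists ab, vfield (theta_field ab) = vfield w.
Proof.
move=> wA; pose w' j : OP K 1 U := w (lift i0 j) - cstO U (c j) *: w i0.
have w'E j v : secfun (w' j) v = secfun (w (lift i0 j)) v - c j * secfun (w i0) v by [].
pose yf j (v : cone U) := (y j).@[sval v 0]; pose Bf j (v : cone U) := (B j).@[sval v 0].
have yr j : regular 1 (yf j) by exact/regular_poly/lform_homog.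
have Br j : regular m%:Z (Bf j) by exact/regular_poly.
have w'r j : regular 1 (secfun (w' j)) by exact: secfun_regular.
have A'n j : A' j \is m.+1.-homog.
  rewrite AB; apply: rpredB; rewrite -[m.+1]add1n; apply: dhomogM; rewrite ?Bm //;
    exact: lform_homog.
have w'A v : \sum_j secfun (w' j) v * cross (yf^~ v) (Bf^~ v) j = 0.
  rewrite -[RHS](wA v) [RHS]dot_reduce; apply: eq_bigr => j _.
  by rewrite AB meval_cross w'E.
have A'E (v : cone U) j : (A' j).@[sval v 0] = cross (yf^~ v) (Bf^~ v) j by rewrite AB meval_cross.
(* [y x w'] has degree 2 and [A'] has degree [m + 1 = d + 1], so the quotient [g] lies in
   [O(1 - d)]. *)
have [||g gr gE] := @regular_multiple K 3 U
    (fun j v => cross (yf^~ v) (fun i => secfun (w' i) v) j) A' (1 + 1) m.+1 _ A'n A'0 A'cop.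
- move=> j; apply: (@regularB K (1 + 1) U (yf _ * secfun (w' _)) (yf _ * secfun (w' _)));
    by apply: regularM.
- by move=> v j l; rewrite !A'E; exact: cross_orthl.
(* [w' x B] and [A'] both have degree [m + 1], so [a] has degree 0. *)
have [||a ar aE] := @regular_multiple K 3 U
    (fun j v => cross (fun i => secfun (w' i) v) (Bf^~ v) j) A' (1 + m%:Z) m.+1 _ A'n A'0 A'cop.
- move=> j; apply: (@regularB K (1 + m%:Z) U (secfun (w' _) * Bf _) (secfun (w' _) * Bf _));
    by apply: regularM.
- by move=> v j l; rewrite !A'E; exact: cross_orthr.
have gd : 1 + 1 - m.+1%:Z = 1 - d by rewrite dm; lia.
have ad : 1 + m%:Z - m.+1%:Z = 0 by lia.
rewrite gd in gr; rewrite ad in ar.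
(* Cramer's rule gives this after multiplication by a nonzero [A' l], hence on a dense open set. *)
have dec v j : secfun (w' j) v = a v * yf j v + g v * Bf j v.
  have [l Al] := A'0.
  pose s := secfun (w' j) - (a * yf j + g * Bf j).
  have sr : regular 1 s.
    apply: regularB (w'r j) _; apply: regularD; first by rewrite -[1]add0r; exact: regularM.
    have := regularM gr (Br j).
    by have -> : 1 - d + m%:Z = 1%R by rewrite dm subrK.
  suff s0 u : s u = 0 by apply/eqP; rewrite -subr_eq0; apply/eqP/(s0 v).
  apply: (regular_dense Al sr) => {}u Alu; apply: (mulfI Alu); rewrite mulr0.
  have := cross_decomp (w'A u) j l; rewrite -!A'E (aE u) (gE u) => D.
  change ((A' l).@[sval u 0] * (secfun (w' j) u - (a u * yf j u + g u * Bf j u)) = 0).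
  by rewrite mulrBr D; ring.
(* Chosen so that [e i0 * b + a * x_i0 = w i0]. The field built from [b] and [g] then differs from
   [w] by [a] times the Euler field in all four components. *)
pose b : OP K 1 U := cstO U (e i0)^-1 *: (w i0 - mkfun ar *: coord i0 U).
have bE v : e i0 * secfun b v = secfun (w i0) v - a v * sval v 0 i0.
  rewrite secfunZ ofun_cst mulrA divff // mul1r.
  rewrite -[LHS]/(secfun (w i0) v - secfun (mkfun ar *: coord i0 U) v).
  rewrite secfunZ coordE.
  by rewrite ofun_mk.
exists (b, mksec gr); apply/vfield_eq => v i l.
suff H k : secfun (theta_field (b, mksec gr) k) v - secfun (w k) v = - (a v * sval v 0 k).
  by rewrite !H; ring.
change (e k * secfun b v + (B' k).@[sval v 0] * g v - secfun (w k) v = - (a v * sval v 0 k)).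
case: (unliftP i0 k) => [j|] ->; last first.
  by rewrite /B' unlift_none meval0 mul0r addr0 bE; ring.
rewrite /B' liftK e_lift -mulrA bE.
have -> : secfun (w (lift i0 j)) v = secfun (w' j) v + c j * secfun (w i0) v.
  by rewrite w'E subrK.
by rewrite dec /yf /Bf /y /lform mevalB mevalZ !mevalXU; ring.
Qed.

End Theta.

Lemma theta_linear U a (s t : direct_sum (OP K 1) (OP K (1 - d)) U) :
  vfield (theta_field (a *: s + t)) =
  a *: vfield (theta_field s) + vfield (theta_field t).
Proof.
by rewrite -vfieldL; congr vfield; apply/funext => l; exact: theta_fieldL.
Qed.

Lemma theta_nat U V (h : V `<=` U) (s : direct_sum (OP K 1) (OP K (1 - d)) U) :
  vfield (theta_field (mres h s)) = mres h (vfield (theta_field s)).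
Proof.
rewrite vfield_res; congr vfield; apply/funext => l; exact: secfun_inj.
Qed.

Definition theta : Defs.hom (direct_sum (OP K 1) (OP K (1 - d))) T :=
  Defs.Hom theta_linear theta_nat.

Lemma theta_inj U : injective (theta U).
Proof.
move=> s t st; apply/eqP; rewrite -subr_eq0; apply/eqP/vfield_theta_eq0.
by rewrite -[LHS]/(theta U (s - t)) homB st subrr.
Qed.

(** Locally a field in the kernel lifts to four sections of [O(1)], to which [vfield_theta_onto]
    applies; as [theta] is injective, the local preimages glue. Conversely [e] is orthogonal to [A],
    and [B] to [y x B]. *)
Lemma theta_kernel k (om : Defs.hom T (OP K k)) :
  (forall U (w : 'I_4 -> OP K 1 U) v,
    secfun (om U (vfield w)) v = \sum_j secfun (w j) v * (A j).@[sval v 0]) ->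
  forall U D, om U D = 0 <-> exists ab, theta U ab = D.
Proof.
move=> omE U D; split=> [D0|[ab <-]].
  apply: (hom_local_image theta_inj) => L UL; have [v vL] := opens_cone UL.
  have [i vi] := cone_coord v.
  exists (opensI U (chart_open K i)), (@opensI_subl _ _ _); split.
    by split=> //; exact: mem_chart_open vi vL.
  have [w [wE _]] := tangent_vfield (mres (@opensI_subl _ _ _) D) (@in_chartI K i U).
  rewrite wE; apply: vfield_theta_onto => u.
  by rewrite -omE -wE hom_nat D0 mres0.
apply: secfun_inj => v; rewrite omE secfun0 dot_reduce.
transitivity (\sum_j secfun ab.2 v * (B j * cross y B j).@[sval v 0]); last first.
  by rewrite -mulr_sumr -(raddf_sum (meval _)) dot_cross raddf0 mulr0.
apply: eq_bigr => j _; rewrite !theta_fieldE /B' liftK unlift_none meval0 mul0r addr0.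
by rewrite mevalM AB e_lift; ring.
Qed.

End Splitting.

Lemma isomorphic_images (X : topologicalType) (O : ringSheaf X) (F G H : sheafMod O)
    (f : Defs.hom F H) (g : Defs.hom G H) :
  (forall U, injective (f U)) -> (forall U, injective (g U)) ->
  (forall U D, (exists s, f U s = D) <-> (exists t, g U t = D)) -> isomorphic F G.
Proof.
move=> fI gI fg.
have P U s : {t | g U t = f U s} by apply/cid/fg; exists s.
have Q U t : {s | f U s = g U t} by apply/cid/fg; exists t.
pose p U s := sval (P U s); have pE U s : g U (p U s) = f U s := svalP (P U s).
have pL U a (s t : F U) : p U (a *: s + t) = a *: p U s + p U t.
  by apply: gI; rewrite homL !pE homL.
have pN (U V : opens X) (h : V `<=` U) (s : F U) : p V (mres h s) = mres h (p U s).
  by apply: gI; rewrite hom_nat !pE hom_nat.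
exists (Defs.Hom pL pN) => U /=; exists (fun t => sval (Q U t)) => [s|t].
  by apply: fI; rewrite (svalP (Q _ _)) pE.
by apply: gI; rewrite pE (svalP (Q U t)).
Qed.

Lemma distribution_split (K : closedFieldType) (d : int) (F : distribution K d) :
  has_section (dist_tangent F) (0 - 1) ->
  isomorphic (dist_tangent F) (direct_sum (OP K 1) (OP K (1 - d))) /\ 0 <= d.
Proof.
move=> hs; have [om [omK omI]] := distribution_form F.
have [psi ompsi [U1 [r1 psi0]]] := section_of_twist omK hs.
have [A [n [An An0 XA omE]]] := form_coefficients om.
have cop t : prime_elt t -> ~ forall j, divides t (A j).
  exact: (coefficients_coprime omI omE An).
have A0 : ~ forall j, A j = 0.
  by move=> A0; apply: (cop 0 (prime_elt0 _)) => j; exists 0; rewrite A0 mul0r.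
have nd : n%:Z + 1 = d + 2 by case: An0.
have [e psiE] := twisted_field_constant psi.
have [i0 e0] : exists i, e i != 0.
  apply: contrapT => /forallNP ne; case/eqP: psi0; rewrite psiE.
  apply: tangent_ext => V h f; apply: ofun_inj => v; rewrite dapp0l ofun0 vfieldE big1 // => j _.
  by rewrite secfunZ ofun_cst; have /negP/negPn/eqP -> := ne j; rewrite !mul0r.
have eA : \sum_j e j *: A j = 0.
  apply: (cone_vanish (chart_open_neq0 K i0)) => v.
  have := congr1 (fun s => secfun s v) (ompsi _ (coord i0 (chart_open K i0))).
  rewrite psiE omE secfun0 => E; apply: (mulfI (in_chart_open v)); rewrite mulr0 -[RHS]E.
  rewrite (raddf_sum (meval _)) mulr_sumr; apply: eq_bigr => j _.
  by rewrite secfunZ ofun_cst coordE /= mevalZ; ring.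
pose c j := e (lift i0 j) / e i0.
(* [A i0] is a combination of the other three coefficients, so these inherit nonvanishing and
   coprimality. *)
have Ai0 : A i0 = - \sum_j c j *: A (lift i0 j) := solve_coefficient e0 eA.
have A'0 : exists j, A (lift i0 j) != 0.
  apply: contrapT => /forallNP A'0; apply: A0.
  have {}A'0 j : A (lift i0 j) = 0 by apply/eqP/negPn/negP/A'0.
  move=> l; case: (unliftP i0 l) => [j|] -> //.
  by rewrite Ai0 big1 ?oppr0 // => j _; rewrite A'0 scaler0.
have A'cop t : prime_elt t -> t != 0 -> ~ forall j, divides t (A (lift i0 j)).
  move=> tp _ tA; apply: (cop t tp) => l; case: (unliftP i0 l) => [j|] -> //.
  rewrite Ai0; have /choice[q qE] := tA; exists (- \sum_j c j *: q j).
  rewrite mulNr mulr_suml; congr (- _); apply: eq_bigr => j _.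
  by rewrite qE scalerAl.
have yA : \sum_j lform i0 c j * A (lift i0 j) = 0.
  rewrite -[RHS]XA [RHS](bigD1_ord i0) //= [in RHS]Ai0 mulrN mulr_sumr -sumrN -big_split.
  by apply: eq_bigr => j _; rewrite /lform -!mul_mpolyC /=; ring.
have [m [B [nm Bm AB]]] := koszul (fun j => An (lift i0 j)) yA A'0.
(* From [n + 1 = d + 2] and [n = m + 1]. *)
have dm : d = m%:Z by move: nd; rewrite nm; clear; lia.
split; last by rewrite dm.
have thI U : injective (theta e i0 dm Bm U) by move=> s t; exact: (theta_inj e0 AB A'0).
have thK := theta_kernel e0 dm Bm AB eA A'0 A'cop omE.
have [iI _ _] := dist_exact F.
apply: (isomorphic_images iI thI) => U D.
by rewrite -(omK U D) thK.
Qed.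

Theorem corollary3p6 (R : realType) (d : int) (F : @distribution R[i] d)
    (ht : is_min_section_twist (dist_tangent F) 0) :
  isomorphic (dist_tangent F) (direct_sum (OP R[i] 1) (OP R[i] (1 - d))) /\
  0 <= d.
Proof. by case: ht => hs _; exact: distribution_split hs. Qed.
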